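(* Let $N<0$, $\tau>0$, $\lambda_\sharp<\lambda_\flat$, and let $\alpha\in\mathbb{C}$ be arbitrary. Let $\varepsilon>0$ and let $\gamma=L_{\theta^-,\theta^+}$ be any contour whose two terminal rays satisfy $\cos 2\theta^{\pm}>0$, $|\theta^{\pm}|\ge\varepsilon$ and $|\pi-|\theta^{\pm}||\ge\varepsilon$. Then along $\gamma$, writing $s=re^{i\theta}$, $$\big|\phi(s)z^{-s}\big|\le\exp\!\Big(-\frac{|N|}{2\tau}\cos(2\theta)\,r^{2}\ln r\,(1+o(1))\Big),\qquad r=|s|\to\infty .$$ Consequently the integral $K(z)=\frac{1}{2\pi i}\int_\gamma\phi(s)z^{-s}\,ds$ converges absolutely for every $z$ on the Riemann surface of the logarithm; its value depends only on the homotopy (equivalence) class of $\gamma$; and $w\mapsto K(e^{2\pi w})$ extends to an entire function of $w\in\mathbb{C}$.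
   Context: For $\tau>0$, $G(z;\tau)$ is the Barnes double gamma function: the entire function $G(z;\tau)=\frac{z}{\tau}e^{c_1 z/\tau+c_2 z^2/(2\tau^2)}\prod_{(k,l)\in\mathbb{Z}_{\ge0}^2\setminus\{(0,0)\}}\big(1+\frac{z}{k\tau+l}\big)e^{-\frac{z}{k\tau+l}+\frac{z^2}{2(k\tau+l)^2}}$, with real constants $c_1,c_2$ (depending on $\tau$) uniquely determined by $G(z+1;\tau)=\Gamma(z/\tau)G(z;\tau)$ and $G(z+\tau;\tau)=(2\pi)^{(\tau-1)/2}\tau^{1/2-z}\Gamma(z)G(z;\tau)$. It satisfies $G(1;\tau)=1$. Let $0\le m\le q$, $0\le n\le p$ be integers, $\mathbf a=(a_1,\dots,a_p)\in\mathbb{C}^p$, $\mathbf b=(b_1,\dots,b_q)\in\mathbb{C}^q$, $\alpha\in\mathbb{C}$. Put $$\mathcal G(s)=\frac{\prod_{j=1}^{m}G(b_j-s;\tau)\prod_{j=1}^{n}G(1+\tau-a_j+s;\tau)}{\prod_{j=m+1}^{q}G(1+\tau-b_j+s;\tau)\prod_{j=n+1}^{p}G(a_j-s;\tau)},\quad \phi(s)=\mathcal G(s)e^{\pi\alpha s^2/\tau},\quad N=2(m+n)-p-q .$$ Put $\Lambda^+=\{a_j+l\tau+k: n<j\le p,\ l,k\in\mathbb{Z}_{\ge0}\}$, $\Lambda^-=\{b_j-l\tau-k: m<j\le q,\ l,k\in\mathbb{Z}_{\ge1}\}$, $\lambda_\sharp=\max_{m<j\le q}\operatorname{Re}b_j-\tau-1$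 ($=-\infty$ if $m=q$), $\lambda_\flat=\min_{n<j\le p}\operatorname{Re}a_j$ ($=+\infty$ if $n=p$). For $z$ on the Riemann surface of the logarithm, $z^{-s}=e^{-s\log z}$, and $z=e^{2\pi w}$ means $\log z=2\pi w$. Contours: let $P=\Lambda^+\cup\Lambda^-$. $L_{\theta^-,\theta^+}$ denotes a contour $\gamma$ such that: (A1) $\gamma$ is a simple, piecewise smooth, proper curve $\mathbb{R}\to\mathbb{C}\setminus P$; (A2) outside some disc it coincides with two straight rays of angles $\theta^-\in(-\pi,0)$ and $\theta^+\in(0,\pi)$, and is traversed from the $\theta^-$ end to the $\theta^+$ end; (A3) $\mathbb{C}\setminus\gamma$ has two components, $\Lambda^+$ lies in the one containing the large positive reals and $\Lambda^-$ in the other ($\Lambda^-$ on the left, $\Lambda^+$ on the right of $\gamma$). It is admissible if moreover (A4) $\int_\gamma|\phi(s)z^{-s}||ds|<\infty$. Two admissible contours are in the same class if one can be deformed into the other through admissible contours. *)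

(* Defs.v *)
From Stdlib Require Import Reals ZArith List ClassicalEpsilon.
From Coquelicot Require Import Coquelicot.

Open Scope R_scope.

Definition Cexp (z : C) : C :=
  (exp (Re z) * cos (Im z), exp (Re z) * sin (Im z)).

Definition polar (r theta : R) : C := (r * cos theta, r * sin theta).

Definition Clim_seq (u : nat -> C) : C :=
  (real (Lim_seq (fun n => Re (u n))), real (Lim_seq (fun n => Im (u n)))).

Definition Cprod (l : list C) : C := fold_right Cmult (RtoC 1) l.

(** Euler's limit [n! n^z / (z (z+1) ... (z+n))]; meaningful away from the
    poles [0, -1, -2, ...]. *)
Definition CGamma (z : C) : C :=
  Clim_seq (fun n =>
    (RtoC (INR (fact n)) * Cexp (z * RtoC (ln (INR n)))
     / Cprod (map (fun k => z + RtoC (INR k)) (seq 0 (S n))))%C).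

Definition Gamma_pole (z : C) : Prop := exists k : nat, z = RtoC (- INR k).

Definition lattice (tau : R) (kl : nat * nat) : R :=
  INR (fst kl) * tau + INR (snd kl).

Definition barnes_factor (tau : R) (z : C) (kl : nat * nat) : C :=
  match kl with
  | (O, O) => RtoC 1
  | _ =>
      let w := RtoC (lattice tau kl) in
      ((1 + z / w) * Cexp (- (z / w) + z * z / (2 * (w * w))))%C
  end.

(** The double product converges absolutely, so it may be computed as the limit
    over the squares [0 <= k, l < n]. *)
Definition barnes_product (tau : R) (z : C) : C :=
  Clim_seq (fun n =>
    Cprod (map (barnes_factor tau z) (list_prod (seq 0 n) (seq 0 n)))).

Definition barnes_form (tau : R) (c : R * R) (z : C) : C :=
  (z / RtoC tau
   * Cexp (RtoC (fst c) * z / RtoC tau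
           + RtoC (snd c) * (z * z) / RtoC (2 * tau ^ 2))
   * barnes_product tau z)%C.

Definition barnes_equations (tau : R) (c : R * R) : Prop :=
  let G := barnes_form tau c in
  (forall z : C, ~ Gamma_pole (z / RtoC tau)%C ->
     G (z + 1)%C = (CGamma (z / RtoC tau) * G z)%C) /\
  (forall z : C, ~ Gamma_pole z ->
     G (z + RtoC tau)%C =
     (RtoC (Rpower (2 * PI) ((tau - 1) / 2))
      * Cexp ((RtoC (1 / 2) - z) * RtoC (ln tau)) * CGamma z * G z)%C).

(** The pair [(c_1, c_2)] is the one determined by the two functional
    equations. *)
Definition barnes_constants (tau : R) : R * R :=
  epsilon (inhabits (0, 0)) (barnes_equations tau).

Definition double_gamma (tau : R) (z : C) : C :=
  barnes_form tau (barnes_constants tau) z.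

(** [a] and [b] are the lists [a_1, ..., a_p] and [b_1, ..., b_q];
    [firstn n a] is [a_1, ..., a_n] and [skipn n a] is [a_{n+1}, ..., a_p]. *)

Definition calG (tau : R) (m n : nat) (a b : list C) (s : C) : C :=
  let G := double_gamma tau in
  let t := RtoC tau in
  (Cprod (map (fun bj => G (bj - s)) (firstn m b))
   * Cprod (map (fun aj => G (1 + t - aj + s)) (firstn n a))
   / (Cprod (map (fun bj => G (1 + t - bj + s)) (skipn m b))
      * Cprod (map (fun aj => G (aj - s)) (skipn n a))))%C.

Definition phi (tau : R) (m n : nat) (a b : list C) (alpha s : C) : C :=
  (calG tau m n a b s * Cexp (RtoC PI * alpha * (s * s) / RtoC tau))%C.

Definition index_N (p q m n : nat) : Z :=
  (2 * (Z.of_nat m + Z.of_nat n) - Z.of_nat p - Z.of_nat q)%Z.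

Definition Lambda_plus (tau : R) (n : nat) (a : list C) (s : C) : Prop :=
  exists (aj : C) (l k : nat), In aj (skipn n a) /\
    s = (aj + RtoC (INR l * tau) + RtoC (INR k))%C.

Definition Lambda_minus (tau : R) (m : nat) (b : list C) (s : C) : Prop :=
  exists (bj : C) (l k : nat), (1 <= l)%nat /\ (1 <= k)%nat /\
    In bj (skipn m b) /\
    s = (bj - RtoC (INR l * tau) - RtoC (INR k))%C.

Definition Rbar_max (x y : Rbar) : Rbar := if Rbar_le_dec x y then y else x.

Definition lambda_sharp (tau : R) (m : nat) (b : list C) : Rbar :=
  fold_right Rbar_max m_infty
    (map (fun bj => Finite (Re bj - tau - 1)) (skipn m b)).

Definition lambda_flat (n : nat) (a : list C) : Rbar :=
  fold_right Rbar_min p_infty (map (fun aj => Finite (Re aj)) (skipn n a)).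

(** The Riemann surface of the logarithm, as pairs (modulus, argument): the argument
    is a real number, not reduced modulo [2 pi]. *)
Definition log_surface : Type := (posreal * R)%type.

Definition slog (z : log_surface) : C := (ln (fst z), snd z).

(** The point whose logarithm is [w]. *)
Definition sexp (w : C) : log_surface :=
  (mkposreal (exp (Re w)) (exp_pos (Re w)), Im w).

Definition power_neg (z : log_surface) (s : C) : C := Cexp (- (s * slog z))%C.

(** [C^1] on the closed interval [[a, b]], one-sidedly at the end points,
    expressed by a [C^1] extension to the line. *)
Definition C1_on (gamma : R -> C) (a b : R) : Prop :=
  exists g : R -> C,
    (forall t, ex_derive (fun u => Re (g u)) t /\
               ex_derive (fun u => Im (g u)) t /\
               continuous (Derive (fun u => Re (g u))) t /\
               continuous (Derive (fun u => Im (g u))) t) /\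
    (forall t, a <= t <= b -> gamma t = g t).

Inductive piecewise_C1 (gamma : R -> C) : R -> R -> Prop :=
| piecewise_C1_one a b : a <= b -> C1_on gamma a b -> piecewise_C1 gamma a b
| piecewise_C1_cat a b c :
    piecewise_C1 gamma a b -> piecewise_C1 gamma b c -> piecewise_C1 gamma a c.

(** At the break points the value is a finite real number which does not affect
    any integral. *)
Definition curve_derive (gamma : R -> C) (t : R) : C :=
  (Derive (fun u => Re (gamma u)) t, Derive (fun u => Im (gamma u)) t).

Definition on_ray (c : C) (theta : R) (s : C) : Prop :=
  exists rho : R, 0 <= rho /\ s = (c + polar rho theta)%C.

Definition connected (U : C -> Prop) : Prop :=
  forall A B : C -> Prop, open A -> open B ->
    (forall s, U s -> A s \/ B s) ->
    (exists s, U s /\ A s) -> (exists s, U s /\ B s) ->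
    exists s, U s /\ A s /\ B s.

(** The union of two disjoint nonempty open connected sets has these two sets as
    its connected components. *)
Definition two_components (W U V : C -> Prop) : Prop :=
  open U /\ open V /\ connected U /\ connected V /\
  (exists s, U s) /\ (exists s, V s) /\
  (forall s, ~ (U s /\ V s)) /\ (forall s, W s <-> U s \/ V s).

Record is_contour (Lp Lm : C -> Prop) (thm thp : R) (gamma : R -> C) : Prop := {
  contour_simple : forall t u, gamma t = gamma u -> t = u;
  contour_smooth : forall a b, a <= b -> piecewise_C1 gamma a b;
  contour_proper_m : is_lim (fun t => Cmod (gamma t)) m_infty p_infty;
  contour_proper_p : is_lim (fun t => Cmod (gamma t)) p_infty p_infty;
  contour_avoids : forall t, ~ Lp (gamma t) /\ ~ Lm (gamma t);
  contour_angle_m : - PI < thm < 0;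
  contour_angle_p : 0 < thp < PI;
  contour_rays : exists (cm cp : C) (rad : R),
    (forall s, rad < Cmod s ->
       (exists t, gamma t = s) <-> (on_ray cm thm s \/ on_ray cp thp s)) /\
    Rbar_locally m_infty (fun t => on_ray cm thm (gamma t)) /\
    Rbar_locally p_infty (fun t => on_ray cp thp (gamma t));
  contour_separates : exists U V : C -> Prop,
    two_components (fun s => forall t, gamma t <> s) U V /\
    Rbar_locally p_infty (fun x => U (RtoC x)) /\
    (forall s, Lp s -> U s) /\ (forall s, Lm s -> V s)
}.

Definition contour_integrand (f : C -> C) (gamma : R -> C) (t : R) : C :=
  (f (gamma t) * curve_derive gamma t)%C.

Definition contour_RInt (f : C -> C) (gamma : R -> C) : C :=
  RInt_gen (V := C_R_CompleteNormedModule) (contour_integrand f gamma)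
    (Rbar_locally m_infty) (Rbar_locally p_infty).

Definition contour_ex_RInt (f : C -> C) (gamma : R -> C) : Prop :=
  ex_RInt_gen (V := C_R_NormedModule) (contour_integrand f gamma)
    (Rbar_locally m_infty) (Rbar_locally p_infty).

Definition contour_abs_finite (f : C -> C) (gamma : R -> C) : Prop :=
  ex_RInt_gen (fun t => Cmod (contour_integrand f gamma t))
    (Rbar_locally m_infty) (Rbar_locally p_infty).

(** [f] stands for [s |-> phi(s) z^{-s}]. *)
Definition admissible (f : C -> C) (Lp Lm : C -> Prop) (thm thp : R)
    (gamma : R -> C) : Prop :=
  is_contour Lp Lm thm thp gamma /\ contour_abs_finite f gamma.

(** A deformation moves the contour and its two asymptotic directions
    continuously.  Continuity of [H] alone controls only compact pieces of the
    contour: the ends could then jump from one direction to another. *)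
Definition same_class (f : C -> C) (Lp Lm : C -> Prop) (g0 g1 : R -> C) : Prop :=
  exists (H : R -> R -> C) (thm thp : R -> R),
    (forall u t, 0 <= u <= 1 ->
       continuous (fun x : R * R => H (fst x) (snd x)) (u, t)) /\
    (forall u, 0 <= u <= 1 -> continuous thm u /\ continuous thp u) /\
    (forall u, 0 <= u <= 1 -> admissible f Lp Lm (thm u) (thp u) (H u)) /\
    (forall t, H 0 t = g0 t) /\ (forall t, H 1 t = g1 t).

Definition Kfun (f : C -> C) (gamma : R -> C) (z : log_surface) : C :=
  (/ (2 * RtoC PI * Ci)
   * contour_RInt (fun s => (f s * power_neg z s)%C) gamma)%C.

Definition entire (F : C -> C) : Prop :=
  forall w : C, ex_derive (K := C_AbsRing) (V := C_NormedModule) F w.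

Definition good_angle (eps theta : R) : Prop :=
  0 < cos (2 * theta) /\ eps <= Rabs theta /\ eps <= Rabs (PI - Rabs theta).

(* Main.v *)
Require Import Defs.
From Stdlib Require Import Reals ZArith List Lra Lia Psatz Permutation.
From Stdlib Require Import ClassicalEpsilon FunctionalExtensionality.
From Coquelicot Require Import Coquelicot.
Open Scope R_scope.

(** The integrand is estimated through the Weierstrass product of the double gamma
    function [G], without its functional equations: whatever the two constants in the
    exponential factor are, they only contribute [O(|z|^2)] to [ln |G z|]. The product over
    the square of indices [k, l < n], with [n] of the order of [|z|], contributes
    [Re z^2 / 2] times the sum of the [1 / (k tau + l)^2], which is
    [ln n / tau + O(1)], and [O(|z|^2)] otherwise, provided that [z] keeps away from the real
    directions; the remaining factors contribute [O(|z|^2)]. So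
    [ln |G z| = Re z^2 ln |z| / (2 tau) + O(|z|^2)] ([double_gamma_growth]), and the
    logarithm of the modulus of the integrand is [N Re s^2 ln |s| / (2 tau) + O(|s|^2)].
    On rays with [cos (2 theta) > 0] this is the bound of the theorem, and it gives the
    absolute convergence with any exponential weight, hence also the differentiation in
    [w] under the integral sign ([contour_transform_deriv]).

    For the independence of the contour, continuity of a deformation says little about
    the ends, where it need not be uniform. It is used only to see that the ends stay in
    the same sectors: a direction passing from one sector to the other would be vertical
    at some moment, but there the integrand is large and the contour is not
    admissible ([no_vertical_direction]). The equality of the integrals is then a homology
    argument. On a large disc the integrand is the sum of fractions [r / (s - p)] and of a
    derivative ([residue_decomposition]). The integral of [1 / (s - p)] along a contour,
    normalised at the ends by the principal logarithm, is locally constant in [p] off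
    the contour, hence constant on each of the two components; it is [- 2 pi i] for large
    positive [p] and [0] for large negative [p], so it has the first value on the right of
    the contour and the second on the left ([contour_index]). Two contours that separate
    the poles therefore give every pole the same index, and their integrals differ only by
    the integrals over segments joining their ends, which tend to zero
    ([contour_integrals_agree]). *)

(** * Moduli *)

Lemma Cmod_le_add (z : C) : Cmod z <= Rabs (Re z) + Rabs (Im z).
Proof.
  replace z with ((RtoC (Re z)) + Ci * RtoC (Im z))%C at 1.
  - eapply Rle_trans. apply Cmod_triangle. rewrite Cmod_mult, Cmod_Ci, !Cmod_R. lra.
  - destruct z as [x y]; unfold Ci, RtoC, Cplus, Cmult; simpl. f_equal; ring.
Qed.

Lemma Im_le_Cmod (z : C) : Rabs (Im z) <= Cmod z.
Proof. eapply Rle_trans; [apply Rmax_r | apply Rmax_Cmod]. Qed.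

Lemma Cmod_sub_comm (z w : C) : Cmod (z - w)%C = Cmod (w - z)%C.
Proof. rewrite <- Cmod_opp. f_equal. ring. Qed.

Lemma Cmod_triangle_sub (z w : C) : Cmod (z - w)%C <= Cmod z + Cmod w.
Proof. unfold Cminus. eapply Rle_trans; [apply Cmod_triangle|]. rewrite Cmod_opp. lra. Qed.

Lemma Cmod_triangle_rev (z w : C) : Cmod z - Cmod w <= Cmod (z + w)%C.
Proof.
  assert (H := Cmod_triangle_sub (z + w)%C w).
  replace (z + w - w)%C with z in H by ring. lra.
Qed.

Lemma Cmod_neq_0 (z : C) : z <> RtoC 0 -> 0 < Cmod z.
Proof. intro H. now apply Cmod_gt_0. Qed.

Lemma neq_0_of_Cmod (z : C) : 0 < Cmod z -> z <> RtoC 0.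
Proof. intros H E. rewrite E, Cmod_0 in H. lra. Qed.

(** * Complex derivatives *)

(** Continuity and complex differentiability at a point, with the modulus of the
    increment. [Ccont_iff] and [Cderiv_iff] give the formulation with filters. *)
Definition Ccont (f : C -> C) (z : C) : Prop :=
  forall eps, 0 < eps -> exists d, 0 < d /\
    forall h, Cmod h < d -> Cmod (f (z + h) - f z)%C <= eps.

Definition Cderiv (f : C -> C) (z l : C) : Prop :=
  forall eps, 0 < eps -> exists d, 0 < d /\
    forall h, Cmod h < d -> Cmod (f (z + h) - f z - l * h)%C <= eps * Cmod h.

(** Holomorphic on [D]: complex differentiable at every point of [D], with a
    continuous derivative. Asking for continuity of the derivative allows
    differentiation under the integral sign in the proof of Cauchy's theorem. *)
Definition hol (D : C -> Prop) (f : C -> C) : Prop :=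
  exists f' : C -> C, forall z, D z -> Cderiv f z (f' z) /\ Ccont f' z.

(** The complex numbers as a normed module over themselves. *)
Notation C_space := (AbsRing_NormedModule C_AbsRing).

Lemma Ccont_iff f z : Ccont f z <-> continuous (T := C_space) (U := C_space) f z.
Proof.
  split; intros H.
  - apply (filterlim_locally (U := C_space) f (f z)). intros [eps He]. destruct (H (eps / 2) ltac:(lra)) as (d & Hd & Hh).
    exists (mkposreal d Hd). intros y' Hy. set (y := y' : C). change (Cmod (f y - f z)%C < eps).
    specialize (Hh (y - z)%C Hy). replace (z + (y - z))%C with y in Hh by ring. lra.
  - intros eps He. destruct (proj1 (filterlim_locally (U := C_space) f (f z)) H (mkposreal eps He)) as ([d Hd] & Hh).
    exists d. split; auto. intros h Hh'. apply Rlt_le, (Hh (z + h)%C).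
    change (Cmod (z + h - z)%C < d). now replace (z + h - z)%C with h by ring.
Qed.

Lemma Cderiv_iff f z l : Cderiv f z l <-> is_derive (K := C_AbsRing) (V := C_space) f z l.
Proof.
  split; intros H.
  - split. apply is_linear_scal_l.
    intros x Hx. apply (is_filter_lim_locally_unique (K := C_AbsRing) (V := C_space)) in Hx. subst x.
    intros [eps He]. destruct (H eps He) as (d & Hd & Hh). exists (mkposreal d Hd). intros y' Hy'.
    set (y := y' : C). specialize (Hh (y - z)%C Hy').
    replace (z + (y - z))%C with y in Hh by ring. rewrite (Cmult_comm l) in Hh. exact Hh.
  - destruct H as [_ H]. intros eps He.
    destruct (H z (fun P HP => HP) (mkposreal eps He)) as ([d Hd] & Hh). exists d. split; auto. intros h Hh'.
    assert (Q := Hh (z + h)%C). change (Cmod (z + h - z)%C < d -> Cmod (f (z + h) - f z - (z + h - z) * l)%C <= eps * Cmod (z + h - z)%C) in Q.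
    replace (z + h - z)%C with h in Q by ring. rewrite (Cmult_comm h l) in Q. auto.
Qed.

Lemma Cderiv_is_C_derive f z l : Cderiv f z l -> is_derive (K := C_AbsRing) (V := C_NormedModule) f z l.
Proof.
  intros H. split. apply is_linear_scal_l.
  intros x Hx. apply (is_filter_lim_locally_unique (K := C_AbsRing) (V := C_space)) in Hx. subst x.
  intros [eps He]. destruct (H eps He) as (d & Hd & Hh). exists (mkposreal d Hd). intros y' Hy'.
  set (y := y' : C). specialize (Hh (y - z)%C Hy').
  replace (z + (y - z))%C with y in Hh by ring. rewrite (Cmult_comm l) in Hh. exact Hh.
Qed.

Lemma Cderiv_unique f z l l' : Cderiv f z l -> Cderiv f z l' -> l = l'.
Proof.
  intros H H'. rewrite <- (is_C_derive_unique f z l), <- (is_C_derive_unique f z l'); auto using Cderiv_is_C_derive.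
Qed.

Lemma Ccont_ext_loc f g z r : 0 < r -> (forall y, Cmod (y - z)%C < r -> f y = g y) ->
  Ccont f z -> Ccont g z.
Proof.
  intros Hr E H eps He. destruct (H eps He) as (d & Hd & Hh).
  exists (Rmin d r). split. now apply Rmin_pos. intros h Hhd.
  assert (Cmod h < d) by (eapply Rlt_le_trans; [apply Hhd|apply Rmin_l]).
  assert (Cmod h < r) by (eapply Rlt_le_trans; [apply Hhd|apply Rmin_r]).
  rewrite <- !E. auto.
  replace (z - z)%C with (RtoC 0) by ring. now rewrite Cmod_0.
  now replace (z + h - z)%C with h by ring.
Qed.

Lemma Cderiv_ext_loc f g z l r : 0 < r -> (forall y, Cmod (y - z)%C < r -> f y = g y) ->
  Cderiv f z l -> Cderiv g z l.
Proof.
  intros Hr E H eps He. destruct (H eps He) as (d & Hd & Hh).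
  exists (Rmin d r). split. now apply Rmin_pos. intros h Hhd.
  assert (Cmod h < d) by (eapply Rlt_le_trans; [apply Hhd|apply Rmin_l]).
  assert (Cmod h < r) by (eapply Rlt_le_trans; [apply Hhd|apply Rmin_r]).
  rewrite <- !E. auto.
  replace (z - z)%C with (RtoC 0) by ring. now rewrite Cmod_0.
  now replace (z + h - z)%C with h by ring.
Qed.

Lemma Cderiv_ext f g z l : (forall y, f y = g y) -> Cderiv f z l -> Cderiv g z l.
Proof. intros E. apply Cderiv_ext_loc with 1; [lra|auto]. Qed.

Lemma Cderiv_eq f z l l' : Cderiv f z l -> l = l' -> Cderiv f z l'.
Proof. now intros H <-. Qed.

Lemma Ccont_const c z : Ccont (fun _ => c) z.
Proof. apply Ccont_iff. apply (@continuous_const C_space C_space). Qed.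

Lemma Ccont_plus f g z : Ccont f z -> Ccont g z -> Ccont (fun x => (f x + g x)%C) z.
Proof. rewrite !Ccont_iff. apply (@continuous_plus C_space C_AbsRing C_space f g z). Qed.

Lemma Ccont_mult f g z : Ccont f z -> Ccont g z -> Ccont (fun x => (f x * g x)%C) z.
Proof. rewrite !Ccont_iff. apply (@continuous_mult C_space C_AbsRing f g z). Qed.

Lemma Ccont_comp f g z : Ccont g z -> Ccont f (g z) -> Ccont (fun x => f (g x)) z.
Proof. rewrite !Ccont_iff. apply (@continuous_comp C_space C_space C_space g f z). Qed.

Lemma Cderiv_const c z : Cderiv (fun _ => c) z (RtoC 0).
Proof. apply Cderiv_iff, (is_derive_const (V := C_space)). Qed.

Lemma Cderiv_id z : Cderiv (fun x => x) z (RtoC 1).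
Proof. apply Cderiv_iff, (is_derive_id (K := C_AbsRing)). Qed.

Lemma Cderiv_plus f g z l m : Cderiv f z l -> Cderiv g z m -> Cderiv (fun x => (f x + g x)%C) z (l + m)%C.
Proof. rewrite !Cderiv_iff. apply (is_derive_plus (V := C_space) f g). Qed.

Lemma Cderiv_mult f g z l m : Cderiv f z l -> Cderiv g z m -> Cderiv (fun x => (f x * g x)%C) z (l * g z + f z * m)%C.
Proof. rewrite !Cderiv_iff. intros H H'. apply (is_derive_mult (K := C_AbsRing) f g); auto. apply Cmult_comm. Qed.

Lemma Cderiv_minus f g z l m : Cderiv f z l -> Cderiv g z m -> Cderiv (fun x => (f x - g x)%C) z (l - m)%C.
Proof. rewrite !Cderiv_iff. apply (is_derive_minus (V := C_space) f g). Qed.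

Lemma Cderiv_scal c f z l : Cderiv f z l -> Cderiv (fun x => (c * f x)%C) z (c * l)%C.
Proof. rewrite !Cderiv_iff. intros H.
  replace (c * l)%C with (RtoC 0 * f z + c * l)%C by ring.
  apply (is_derive_mult (K := C_AbsRing) (fun _ => c) f); auto. apply (is_derive_const (V := C_space)). apply Cmult_comm. Qed.

Lemma Cderiv_comp f g z l m : Cderiv g z m -> Cderiv f (g z) l -> Cderiv (fun x => f (g x)) z (l * m)%C.
Proof. rewrite !Cderiv_iff. intros H H'. rewrite Cmult_comm. now apply (is_derive_comp (V := C_space) f g). Qed.

Lemma Cderiv_cont f z l : Cderiv f z l -> Ccont f z.
Proof. rewrite Cderiv_iff, Ccont_iff. intros H. apply (ex_derive_continuous (V := C_space) f). now exists l. Qed.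

Lemma Ccont_inv z : z <> RtoC 0 -> Ccont (fun x => (/ x)%C) z.
Proof.
  intros Hz eps He. assert (P := Cmod_neq_0 _ Hz).
  set (d := Rmin (Cmod z / 2) (eps * (Cmod z * Cmod z) / 2)).
  assert (0 < eps * (Cmod z * Cmod z) / 2). { apply Rdiv_lt_0_compat; [|lra]. repeat apply Rmult_lt_0_compat; auto. }
  exists d. split. apply Rmin_pos; lra. intros h Hh.
  assert (H1 : Cmod h < Cmod z / 2) by (eapply Rlt_le_trans; [apply Hh|apply Rmin_l]).
  assert (H2 : Cmod h < eps * (Cmod z * Cmod z) / 2) by (eapply Rlt_le_trans; [apply Hh|apply Rmin_r]).
  assert (T := Cmod_triangle_rev z h).
  assert (Hzh : (z + h)%C <> RtoC 0) by (apply neq_0_of_Cmod; lra).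
  replace (/ (z + h) - / z)%C with (- h / (z * (z + h)))%C by (field; auto).
  rewrite Cmod_div, Cmod_opp, Cmod_mult.
  2:{ apply Cmult_neq_0; auto. }
  apply Rle_trans with (Cmod h / (Cmod z * (Cmod z / 2))).
  apply Rmult_le_compat_l. apply Cmod_ge_0. apply Rinv_le_contravar.
  apply Rmult_lt_0_compat; lra. apply Rmult_le_compat_l; lra.
  apply Rle_trans with (eps * (Cmod z * Cmod z) / 2 / (Cmod z * (Cmod z / 2))).
  apply Rmult_le_compat_r. apply Rlt_le, Rinv_0_lt_compat. apply Rmult_lt_0_compat; lra. lra.
  right. field. lra.
Qed.

Lemma Cderiv_inv z : z <> RtoC 0 -> Cderiv (fun x => (/ x)%C) z (- / (z * z))%C.
Proof.
  intros Hz eps He. assert (P := Cmod_neq_0 _ Hz).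
  set (c := eps * (Cmod z * Cmod z * Cmod z) / 2).
  assert (0 < c). { apply Rdiv_lt_0_compat; [|lra]. repeat apply Rmult_lt_0_compat; auto. }
  exists (Rmin (Cmod z / 2) c). split. apply Rmin_pos; lra. intros h Hh.
  assert (H1 : Cmod h < Cmod z / 2) by (eapply Rlt_le_trans; [apply Hh|apply Rmin_l]).
  assert (H2 : Cmod h < c) by (eapply Rlt_le_trans; [apply Hh|apply Rmin_r]).
  assert (T := Cmod_triangle_rev z h).
  assert (Hzh : (z + h)%C <> RtoC 0) by (apply neq_0_of_Cmod; lra).
  replace (/ (z + h) - / z - - / (z * z) * h)%C with (h * h / (z * z * (z + h)))%C by (field; auto).
  rewrite Cmod_div, !Cmod_mult.
  2:{ repeat apply Cmult_neq_0; auto. }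
  assert (Q := Cmod_ge_0 h).
  apply Rle_trans with (c * Cmod h / (Cmod z * Cmod z * (Cmod z / 2))).
  - unfold Rdiv. apply Rmult_le_compat.
    apply Rmult_le_pos; lra. apply Rlt_le, Rinv_0_lt_compat. repeat apply Rmult_lt_0_compat; lra.
    apply Rmult_le_compat_r; lra.
    apply Rinv_le_contravar. repeat apply Rmult_lt_0_compat; lra.
    apply Rmult_le_compat_l. apply Rmult_le_pos; lra. lra.
  - right. unfold c. field. lra.
Qed.

(** * Curves with a derivative *)

(** The derivative of a curve, component by component. *)
Definition curve_deriv_at (g : R -> C) (t : R) (v : C) : Prop :=
  is_derive (fun u => Re (g u)) t (Re v) /\ is_derive (fun u => Im (g u)) t (Im v).

Lemma curve_deriv_eps g t v : curve_deriv_at g t v ->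
  forall eps, 0 < eps -> exists d, 0 < d /\ forall h, Rabs h < d ->
    Cmod (g (t + h)%R - g t - v * RtoC h)%C <= eps * Rabs h.
Proof.
  intros [H1 H2] eps He. apply is_derive_Reals in H1. apply is_derive_Reals in H2.
  destruct (H1 (eps/2)) as (d1 & Hd1). lra. destruct (H2 (eps/2)) as (d2 & Hd2). lra.
  exists (Rmin d1 d2). split. apply Rmin_pos; apply cond_pos.
  intros h Hh.
  destruct (Req_dec h 0) as [->|N].
  { rewrite Rplus_0_r, Rabs_R0. replace (g t - g t - v * RtoC 0)%C with (RtoC 0) by ring. rewrite Cmod_0. lra. }
  assert (L1 : Rabs h < d1) by (eapply Rlt_le_trans; [apply Hh|apply Rmin_l]).
  assert (L2 : Rabs h < d2) by (eapply Rlt_le_trans; [apply Hh|apply Rmin_r]).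
  specialize (Hd1 h N L1). specialize (Hd2 h N L2).
  assert (P : 0 < Rabs h) by now apply Rabs_pos_lt.
  assert (A : forall x y l, Rabs ((x - y) / h - l) < eps / 2 -> Rabs (x - y - l * h) <= eps / 2 * Rabs h).
  { intros x y l Hx. replace (x - y - l * h) with (((x - y) / h - l) * h) by (field; auto).
    rewrite Rabs_mult. apply Rmult_le_compat_r; lra. }
  apply A in Hd1. apply A in Hd2.
  eapply Rle_trans; [apply Cmod_le_add|].
  replace (Re (g (t + h)%R - g t - v * RtoC h)%C) with (Re (g (t+h)) - Re (g t) - Re v * h).
  replace (Im (g (t + h)%R - g t - v * RtoC h)%C) with (Im (g (t+h)) - Im (g t) - Im v * h).
  lra.
  destruct (g (t+h)), (g t), v; simpl; ring. destruct (g (t+h)), (g t), v; simpl; ring.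
Qed.

Lemma curve_deriv_of_eps g t v :
  (forall eps, 0 < eps -> exists d, 0 < d /\ forall h, Rabs h < d ->
    Cmod (g (t + h)%R - g t - v * RtoC h)%C <= eps * Rabs h) -> curve_deriv_at g t v.
Proof.
  intros H. split; apply is_derive_Reals; intros eps He.
  - destruct (H (eps/2)) as (d & Hd & Hh). lra. exists (mkposreal d Hd). simpl. intros h N L.
    specialize (Hh h L). assert (P : 0 < Rabs h) by now apply Rabs_pos_lt.
    assert (Q := Rle_trans _ _ _ (re_le_Cmod _) Hh).
    replace (Re (g (t + h)%R - g t - v * RtoC h)%C) with (((Re (g (t+h)) - Re (g t)) / h - Re v) * h) in Q.
    rewrite Rabs_mult in Q. apply Rmult_le_reg_r in Q; lra.
    destruct (g (t+h)), (g t), v; simpl. field. auto.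
  - destruct (H (eps/2)) as (d & Hd & Hh). lra. exists (mkposreal d Hd). simpl. intros h N L.
    specialize (Hh h L). assert (P : 0 < Rabs h) by now apply Rabs_pos_lt.
    assert (Q := Rle_trans _ _ _ (Im_le_Cmod _) Hh).
    replace (Im (g (t + h)%R - g t - v * RtoC h)%C) with (((Im (g (t+h)) - Im (g t)) / h - Im v) * h) in Q.
    rewrite Rabs_mult in Q. apply Rmult_le_reg_r in Q; lra.
    destruct (g (t+h)), (g t), v; simpl. field. auto.
Qed.

Lemma curve_deriv_comp f g t l v : curve_deriv_at g t v -> Cderiv f (g t) l ->
  curve_deriv_at (fun u => f (g u)) t (l * v)%C.
Proof.
  intros H H'. apply curve_deriv_of_eps. intros eps He.
  assert (Pm := Cmod_ge_0 v). assert (Pl := Cmod_ge_0 l).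
  set (e1 := eps / (2 * (Cmod v + 1))). set (e2 := eps / (2 * (Cmod l + 1))).
  assert (He1 : 0 < e1) by (apply Rdiv_lt_0_compat; lra).
  assert (He2 : 0 < e2) by (apply Rdiv_lt_0_compat; lra).
  destruct (H' e1 He1) as (d' & Hd' & Hh').
  destruct (curve_deriv_eps _ _ _ H e2 He2) as (d2 & Hd2 & Hh2).
  destruct (curve_deriv_eps _ _ _ H 1 Rlt_0_1) as (d3 & Hd3 & Hh3).
  set (d4 := d' / (Cmod v + 1)).
  assert (Hd4 : 0 < d4) by (apply Rdiv_lt_0_compat; lra).
  exists (Rmin d4 (Rmin d2 d3)). split. repeat apply Rmin_pos; auto. intros h Hhd.
  assert (L : Rabs h < d4) by (eapply Rlt_le_trans; [apply Hhd|apply Rmin_l]).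
  assert (L' : Rabs h < d2) by (eapply Rlt_le_trans; [apply Hhd|eapply Rle_trans; [apply Rmin_r|apply Rmin_l]]).
  assert (L2 : Rabs h < d3) by (eapply Rlt_le_trans; [apply Hhd|eapply Rle_trans; [apply Rmin_r|apply Rmin_r]]).
  specialize (Hh2 h L'). specialize (Hh3 h L2).
  set (k := (g (t+h)%R - g t)%C) in *.
  assert (K : Cmod k <= (Cmod v + 1) * Rabs h).
  { replace k with ((k - v * RtoC h) + v * RtoC h)%C by ring.
    eapply Rle_trans; [apply Cmod_triangle|]. rewrite Cmod_mult, Cmod_R. lra. }
  assert (Hk : Cmod k < d').
  { eapply Rle_lt_trans; [apply K|]. apply Rlt_le_trans with ((Cmod v + 1) * d4).
    apply Rmult_lt_compat_l; lra. right; unfold d4; field; lra. }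
  specialize (Hh' k Hk).
  replace (g (t + h)%R) with (g t + k)%C by (unfold k; ring).
  replace (f (g t + k) - f (g t) - l * v * RtoC h)%C
    with ((f (g t + k) - f (g t) - l * k) + l * (k - v * RtoC h))%C by ring.
  eapply Rle_trans; [apply Cmod_triangle|]. rewrite Cmod_mult.
  apply Rle_trans with (e1 * ((Cmod v + 1) * Rabs h) + (Cmod l + 1) * (e2 * Rabs h)).
  apply Rplus_le_compat.
  eapply Rle_trans; [apply Hh'|]. apply Rmult_le_compat_l; lra.
  apply Rmult_le_compat; try lra. apply Cmod_ge_0.
  right. unfold e1, e2. field. split; lra.
Qed.

Lemma curve_deriv_line z h t : curve_deriv_at (fun u => (z + RtoC u * h)%C) t h.
Proof.
  apply curve_deriv_of_eps. intros eps He. exists 1. split; [lra|]. intros k _.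
  rewrite RtoC_plus.
  replace (z + (RtoC t + RtoC k) * h - (z + RtoC t * h) - h * RtoC k)%C with (RtoC 0) by ring.
  rewrite Cmod_0. apply Rmult_le_pos. lra. apply Rabs_pos.
Qed.

Lemma is_derive_Rminus (f g : R -> R) (x a b c : R) :
  is_derive f x a -> is_derive g x b -> c = a - b -> is_derive (fun u => f u - g u) x c.
Proof. intros H H' ->. now apply (is_derive_minus f g). Qed.

Lemma is_derive_Rplus (f g : R -> R) (x a b c : R) :
  is_derive f x a -> is_derive g x b -> c = a + b -> is_derive (fun u => f u + g u) x c.
Proof. intros H H' ->. now apply (is_derive_plus f g). Qed.

Lemma is_derive_Rmult (f g : R -> R) (x a b c : R) :
  is_derive f x a -> is_derive g x b -> c = a * g x + f x * b -> is_derive (fun u => f u * g u) x c.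
Proof. intros H H' ->. apply (is_derive_mult f g); auto. exact Rmult_comm. Qed.

Lemma curve_deriv_mult g h t v w : curve_deriv_at g t v -> curve_deriv_at h t w ->
  curve_deriv_at (fun u => (g u * h u)%C) t (v * h t + g t * w)%C.
Proof.
  intros [G1 G2] [H1 H2]. split.
  - eapply is_derive_Rminus. eapply is_derive_Rmult; [apply G1|apply H1|reflexivity].
    eapply is_derive_Rmult; [apply G2|apply H2|reflexivity].
    destruct v, w, (g t), (h t); simpl; ring.
  - eapply is_derive_Rplus. eapply is_derive_Rmult; [apply G1|apply H2|reflexivity].
    eapply is_derive_Rmult; [apply G2|apply H1|reflexivity].
    destruct v, w, (g t), (h t); simpl; ring.
Qed.

Lemma curve_deriv_const c t : curve_deriv_at (fun _ => c) t (RtoC 0).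
Proof. split; apply (is_derive_const (V := R_NormedModule)). Qed.

Lemma curve_deriv_minus g h t v w : curve_deriv_at g t v -> curve_deriv_at h t w ->
  curve_deriv_at (fun u => (g u - h u)%C) t (v - w)%C.
Proof.
  intros [G1 G2] [H1 H2]. split.
  - apply (is_derive_Rminus _ _ _ _ _ _ G1 H1). reflexivity.
  - apply (is_derive_Rminus _ _ _ _ _ _ G2 H2). reflexivity.
Qed.

(** The factor 2 comes from applying the mean value theorem to the real and to
    the imaginary part separately. *)
Lemma curve_mean_value (g g' : R -> C) (M : R) :
  (forall t, 0 <= t <= 1 -> curve_deriv_at g t (g' t)) ->
  (forall t, 0 <= t <= 1 -> Cmod (g' t) <= M) ->
  Cmod (g 1 - g 0)%C <= 2 * M.
Proof.
  intros H HM.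
  assert (A : forall (p : C -> R), (p = Re \/ p = Im) -> Rabs (p (g 1) - p (g 0)) <= M).
  { intros p Hp.
    assert (Hd : forall t, 0 <= t <= 1 -> is_derive (fun u => p (g u)) t (p (g' t))).
    { intros t Ht. destruct (H t Ht). destruct Hp; subst p; auto. }
    destruct (MVT_gen (fun u => p (g u)) 0 1 (fun t => p (g' t))) as (c & Hc & E).
    - rewrite Rmin_left, Rmax_right by lra. intros; apply Hd; lra.
    - rewrite Rmin_left, Rmax_right by lra. intros x Hx. apply continuity_pt_filterlim.
      apply (ex_derive_continuous (fun u => p (g u))). eexists. now apply Hd.
    - rewrite Rmin_left, Rmax_right in Hc by lra. rewrite E. replace (p (g' c) * (1 - 0)) with (p (g' c)) by ring.
      eapply Rle_trans; [|apply (HM c Hc)]. destruct Hp; subst p. apply re_le_Cmod. apply Im_le_Cmod. }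
  eapply Rle_trans; [apply Cmod_le_add|].
  assert (A1 := A Re (or_introl eq_refl)). assert (A2 := A Im (or_intror eq_refl)).
  replace (Re (g 1 - g 0)%C) with (Re (g 1) - Re (g 0)) by reflexivity.
  replace (Im (g 1 - g 0)%C) with (Im (g 1) - Im (g 0)) by reflexivity. lra.
Qed.

Lemma Cderiv_mean_value (f f' : C -> C) (z h l : C) (M : R) :
  (forall t, 0 <= t <= 1 -> Cderiv f (z + RtoC t * h)%C (f' (z + RtoC t * h)%C)) ->
  (forall t, 0 <= t <= 1 -> Cmod (f' (z + RtoC t * h) - l)%C <= M) ->
  Cmod (f (z + h) - f z - l * h)%C <= 2 * M * Cmod h.
Proof.
  intros H HM.
  assert (Q := curve_mean_value (fun t => f (z + RtoC t * h) - l * (RtoC 0 + RtoC t * h))%C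
     (fun t => (f' (z + RtoC t * h) - l) * h)%C (M * Cmod h)).
  replace (f (z + h) - f z - l * h)%C with
   (f (z + RtoC 1 * h) - l * (RtoC 0 + RtoC 1 * h) - (f (z + RtoC 0 * h) - l * (RtoC 0 + RtoC 0 * h)))%C.
  - rewrite Rmult_assoc. apply Q.
    + intros t Ht.
      assert (D1 := curve_deriv_comp f (fun u => (z + RtoC u * h)%C) t _ h (curve_deriv_line z h t) (H t Ht)).
      destruct D1 as [D1 D2].
      destruct (curve_deriv_comp (fun x => (l * x)%C) (fun u => (RtoC 0 + RtoC u * h)%C) t l h (curve_deriv_line _ h t)) as [D3 D4].
      { eapply Cderiv_eq; [apply (Cderiv_scal l (fun x => x)), Cderiv_id | ring]. }
      split.
      * apply (is_derive_Rminus _ _ _ _ _ _ D1 D3).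
        generalize (f' (z + RtoC t * h)%C); intros [u v]; destruct h, l; simpl; ring.
      * apply (is_derive_Rminus _ _ _ _ _ _ D2 D4).
        generalize (f' (z + RtoC t * h)%C); intros [u v]; destruct h, l; simpl; ring.
    + intros t Ht. rewrite Cmod_mult. apply Rmult_le_compat_r. apply Cmod_ge_0. auto.
  - replace (z + RtoC 1 * h)%C with (z + h)%C by ring. replace (z + RtoC 0 * h)%C with z by ring. ring.
Qed.

(** Convexity of a set of complex numbers. *)
Definition Cconvex (U : C -> Prop) : Prop :=
  forall z w t, U z -> U w -> 0 <= t <= 1 -> U (z + RtoC t * (w - z))%C.

Lemma Cderiv_zero_convex U f : Cconvex U -> (forall z, U z -> Cderiv f z (RtoC 0)) ->
  forall z w, U z -> U w -> f z = f w.
Proof.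
  intros HU H z w Hz Hw.
  assert (E : Cmod (f (z + (w - z)) - f z - RtoC 0 * (w - z))%C <= 2 * 0 * Cmod (w - z)%C).
  { apply (Cderiv_mean_value f (fun _ => RtoC 0)).
    intros; apply H; auto. intros. replace (RtoC 0 - RtoC 0)%C with (RtoC 0) by ring. rewrite Cmod_0; lra. }
  replace (z + (w - z))%C with w in E by ring.
  assert (E0 : Cmod (f w - f z - RtoC 0 * (w - z))%C = 0).
  { apply Rle_antisym. lra. apply Cmod_ge_0. }
  apply Cmod_eq_0 in E0. replace (f w) with (f w - f z - RtoC 0 * (w-z) + f z)%C by ring. rewrite E0. ring.
Qed.

(** * The exponential *)

Lemma Cexp_add z w : Cexp (z + w)%C = (Cexp z * Cexp w)%C.
Proof.
  destruct z as [x y], w as [u v]. unfold Cexp, Cmult, Cplus; simpl.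
  rewrite exp_plus, cos_plus, sin_plus. f_equal; ring.
Qed.

Lemma Cexp_0 : Cexp (RtoC 0) = RtoC 1.
Proof. unfold Cexp, RtoC; simpl. rewrite exp_0, cos_0, sin_0. f_equal; ring. Qed.

Lemma Cmod_Cexp z : Cmod (Cexp z) = exp (Re z).
Proof.
  unfold Cmod, Cexp; simpl.
  assert (S := sin2_cos2 (Im z)). unfold Rsqr, Im in *.
  replace (exp (Re z) * cos (snd z) * (exp (Re z) * cos (snd z) * 1) +
    exp (Re z) * sin (snd z) * (exp (Re z) * sin (snd z) * 1)) with (exp (Re z) * exp (Re z)).
  apply sqrt_square. left; apply exp_pos.
  unfold Re. nra.
Qed.

Lemma Cexp_neq_0 z : Cexp z <> RtoC 0.
Proof. apply neq_0_of_Cmod. rewrite Cmod_Cexp. apply exp_pos. Qed.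

Lemma Cexp_opp_mult z : (Cexp z * Cexp (- z) = RtoC 1)%C.
Proof. rewrite <- Cexp_add. replace (z + - z)%C with (RtoC 0) by ring. apply Cexp_0. Qed.

Lemma exp_le_compat x y : x <= y -> exp x <= exp y.
Proof. intros [H| ->]. left; now apply exp_increasing. lra. Qed.

Lemma Cexp_line_deriv h t : curve_deriv_at (fun u => Cexp (RtoC u * h)%C) t (Cexp (RtoC t * h) * h)%C.
Proof.
  destruct h as [x y]. unfold curve_deriv_at, Cexp; simpl. split.
  - auto_derive; auto. unfold Rminus. ring.
  - auto_derive; auto. unfold Rminus. ring.
Qed.

Lemma Cmod_Cexp_line h t : 0 <= t <= 1 -> Cmod (Cexp (RtoC t * h)%C) <= exp (Cmod h).
Proof.
  intros Ht. rewrite Cmod_Cexp. apply exp_le_compat.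
  replace (Re (RtoC t * h)%C) with (t * Re h) by (destruct h; simpl; ring).
  assert (H := re_le_Cmod h). assert (H' := Rle_abs (Re h)). assert (P := Cmod_ge_0 h).
  apply Rle_trans with (t * Cmod h). apply Rmult_le_compat_l; lra. nra.
Qed.

Lemma Cexp_sub1_le h : Cmod (Cexp h - RtoC 1)%C <= 2 * Cmod h * exp (Cmod h).
Proof.
  assert (Q := curve_mean_value (fun u => Cexp (RtoC u * h)%C) (fun t => (Cexp (RtoC t * h) * h)%C)
     (Cmod h * exp (Cmod h))).
  cbv beta in Q. replace (RtoC 1 * h)%C with h in Q by ring. replace (RtoC 0 * h)%C with (RtoC 0) in Q by ring.
  rewrite Cexp_0 in Q. rewrite Rmult_assoc. apply Q.
  - intros; apply Cexp_line_deriv.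
  - intros t Ht. rewrite Cmod_mult, Rmult_comm. apply Rmult_le_compat_l. apply Cmod_ge_0. now apply Cmod_Cexp_line.
Qed.

Lemma Cexp_taylor1 h : Cmod (Cexp h - RtoC 1 - h)%C <= 4 * (Cmod h * Cmod h) * exp (Cmod h).
Proof.
  assert (Q := curve_mean_value (fun u => Cexp (RtoC u * h) - RtoC u * h)%C (fun t => ((Cexp (RtoC t * h) - RtoC 1) * h)%C)
     (2 * Cmod h * exp (Cmod h) * Cmod h)).
  cbv beta in Q.
  replace (Cexp (RtoC 1 * h) - RtoC 1 * h - (Cexp (RtoC 0 * h) - RtoC 0 * h))%C with (Cexp h - RtoC 1 - h)%C in Q.
  2:{ replace (RtoC 1 * h)%C with h by ring. replace (RtoC 0 * h)%C with (RtoC 0) by ring. rewrite Cexp_0. ring. }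
  eapply Rle_trans. apply Q.
  - intros t Ht. destruct (Cexp_line_deriv h t) as [D1 D2].
    destruct (curve_deriv_line (RtoC 0) h t) as [D3 D4].
    apply (is_derive_ext _ (fun u => Re (RtoC u * h)%C)) in D3.
    2:{ intros u. destruct h; simpl; ring. }
    apply (is_derive_ext _ (fun u => Im (RtoC u * h)%C)) in D4.
    2:{ intros u. destruct h; simpl; ring. }
    split.
    + apply (is_derive_Rminus _ _ _ _ _ _ D1 D3).
      generalize (Cexp (RtoC t * h)%C); intros [u v]; destruct h; simpl; ring.
    + apply (is_derive_Rminus _ _ _ _ _ _ D2 D4).
      generalize (Cexp (RtoC t * h)%C); intros [u v]; destruct h; simpl; ring.
  - intros t Ht. rewrite Cmod_mult. apply Rmult_le_compat_r. apply Cmod_ge_0.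
    eapply Rle_trans. apply Cexp_sub1_le.
    assert (P := Cmod_ge_0 h).
    assert (E : Cmod (RtoC t * h)%C <= Cmod h).
    { rewrite Cmod_mult, Cmod_R, Rabs_pos_eq by lra. nra. }
    assert (P2 := Cmod_ge_0 (RtoC t * h)%C).
    apply Rmult_le_compat. lra. left; apply exp_pos. lra. now apply exp_le_compat.
  - right; ring.
Qed.

Lemma Cderiv_Cexp z : Cderiv Cexp z (Cexp z).
Proof.
  intros eps He. set (K := Cmod (Cexp z) * 4 * exp 1).
  assert (HK : 0 < K). { unfold K. rewrite Cmod_Cexp. repeat apply Rmult_lt_0_compat; try lra; apply exp_pos. }
  exists (Rmin 1 (eps / K)). split. apply Rmin_pos. lra. apply Rdiv_lt_0_compat; lra.
  intros h Hh.
  assert (H1 : Cmod h < 1) by (eapply Rlt_le_trans; [apply Hh|apply Rmin_l]).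
  assert (H2 : Cmod h < eps / K) by (eapply Rlt_le_trans; [apply Hh|apply Rmin_r]).
  rewrite Cexp_add.
  replace (Cexp z * Cexp h - Cexp z - Cexp z * h)%C with (Cexp z * (Cexp h - RtoC 1 - h))%C by ring.
  rewrite Cmod_mult.
  assert (P := Cmod_ge_0 h).
  apply Rle_trans with (Cmod (Cexp z) * (4 * (Cmod h * Cmod h) * exp 1)).
  { apply Rmult_le_compat_l. apply Cmod_ge_0. eapply Rle_trans; [apply Cexp_taylor1|].
    apply Rmult_le_compat_l. nra. apply exp_le_compat; lra. }
  replace (Cmod (Cexp z) * (4 * (Cmod h * Cmod h) * exp 1)) with (K * Cmod h * Cmod h) by (unfold K; ring).
  apply Rmult_le_compat_r; auto.
  apply Rle_trans with (K * (eps / K)). apply Rmult_le_compat_l; lra. right; field; lra.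
Qed.

(** * Holomorphic functions *)

Lemma hol_ext D f g : (forall z, f z = g z) -> hol D f -> hol D g.
Proof.
  intros E (f' & H). exists f'. intros z Hz. destruct (H z Hz). split; auto.
  eapply Cderiv_ext; eauto.
Qed.

Lemma hol_sub (D D' : C -> Prop) f : (forall z, D' z -> D z) -> hol D f -> hol D' f.
Proof. intros I (f' & H). exists f'. auto. Qed.

Lemma hol_cont D f z : hol D f -> D z -> Ccont f z.
Proof. intros (f' & H) Hz. eapply Cderiv_cont. apply H; auto. Qed.

Lemma hol_const D c : hol D (fun _ => c).
Proof. exists (fun _ => RtoC 0). intros; split. apply Cderiv_const. apply Ccont_const. Qed.

Lemma hol_id D : hol D (fun z => z).
Proof. exists (fun _ => RtoC 1). intros; split. apply Cderiv_id. apply Ccont_const. Qed.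

Lemma hol_plus D f g : hol D f -> hol D g -> hol D (fun z => (f z + g z)%C).
Proof.
  intros (f' & H) (g' & H'). exists (fun z => f' z + g' z)%C. intros z Hz.
  destruct (H z Hz), (H' z Hz). split. now apply Cderiv_plus. now apply Ccont_plus.
Qed.

Lemma hol_mult D f g : hol D f -> hol D g -> hol D (fun z => (f z * g z)%C).
Proof.
  intros (f' & H) (g' & H').
  exists (fun z => f' z * g z + f z * g' z)%C. intros z Hz.
  destruct (H z Hz), (H' z Hz). split. now apply Cderiv_mult.
  apply Ccont_plus; apply Ccont_mult; auto; eapply Cderiv_cont; eauto.
Qed.

Lemma hol_opp D f : hol D f -> hol D (fun z => (- f z)%C).
Proof.
  intros H. apply hol_ext with (fun z => (RtoC (-1) * f z)%C).
  intros z. destruct (f z). unfold Cmult, Copp; simpl. f_equal; ring.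
  apply hol_mult; auto. apply hol_const.
Qed.

Lemma hol_minus D f g : hol D f -> hol D g -> hol D (fun z => (f z - g z)%C).
Proof. intros. apply hol_plus; auto. now apply hol_opp. Qed.

Lemma hol_comp D D' f g : hol D g -> hol D' f -> (forall z, D z -> D' (g z)) -> hol D (fun z => f (g z)).
Proof.
  intros (g' & H) (f' & H') I. exists (fun z => f' (g z) * g' z)%C. intros z Hz.
  destruct (H z Hz) as [A B], (H' _ (I z Hz)) as [A' B']. split. now apply Cderiv_comp.
  apply Ccont_mult; auto. apply (Ccont_comp f' g); auto. eapply Cderiv_cont; eauto.
Qed.

Lemma hol_inv D f : hol D f -> (forall z, D z -> f z <> RtoC 0) -> hol D (fun z => (/ f z)%C).
Proof.
  intros H N. apply (hol_comp D (fun w => w <> RtoC 0) (fun w => / w)%C f); auto.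
  exists (fun w => - / (w * w))%C. intros z Hz. split. now apply Cderiv_inv.
  apply Ccont_ext_loc with (fun w => RtoC (-1) * (/ w * / w))%C (Cmod z). now apply Cmod_neq_0.
  - intros y Hy. assert (y <> RtoC 0).
    { intros ->. replace (RtoC 0 - z)%C with (- z)%C in Hy by ring. rewrite Cmod_opp in Hy. lra. }
    replace (RtoC (-1)) with (- RtoC 1)%C by (unfold RtoC, Copp; simpl; f_equal; ring). field. auto.
  - apply Ccont_mult. apply Ccont_const. apply Ccont_mult; now apply Ccont_inv.
Qed.

Lemma hol_Cexp D f : hol D f -> hol D (fun z => Cexp (f z)).
Proof.
  intros H. apply (hol_comp D (fun _ => True) Cexp f); auto.
  exists Cexp. intros; split. apply Cderiv_Cexp. eapply Cderiv_cont, Cderiv_Cexp.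
Qed.

Lemma hol_div D f g : hol D f -> hol D g -> (forall z, D z -> g z <> RtoC 0) ->
  hol D (fun z => (f z / g z)%C).
Proof. intros. apply hol_mult; auto. now apply hol_inv. Qed.

(** * Primitives on convex open sets *)

(** Openness for the modulus; see [Copen_of_open] and [open_of_Copen]. *)
Definition Copen (U : C -> Prop) : Prop :=
  forall z, U z -> exists r, 0 < r /\ forall y, Cmod (y - z)%C < r -> U y.

Lemma Ccont_Re z : Ccont (fun w => RtoC (Re w)) z.
Proof.
  intros eps He. exists eps; split; auto. intros h Hh.
  replace (RtoC (Re (z + h)%C) - RtoC (Re z))%C with (RtoC (Re h)).
  rewrite Cmod_R. assert (Q := re_le_Cmod h). lra.
  destruct z, h; unfold RtoC, Cminus, Cplus, Copp; simpl; f_equal; ring.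
Qed.

Lemma Ccont_Im z : Ccont (fun w => RtoC (Im w)) z.
Proof.
  intros eps He. exists eps; split; auto. intros h Hh.
  replace (RtoC (Im (z + h)%C) - RtoC (Im z))%C with (RtoC (Im h)).
  rewrite Cmod_R. assert (Q := Im_le_Cmod h). lra.
  destruct z, h; unfold RtoC, Cminus, Cplus, Copp; simpl; f_equal; ring.
Qed.

(** [p] is the real or the imaginary part. Integrals and derivatives of complex
    functions are treated for both parts at once. *)
Definition is_part (p : C -> R) : Prop := p = Re \/ p = Im.

Lemma part_le p z : is_part p -> Rabs (p z) <= Cmod z.
Proof. intros [-> | ->]. apply re_le_Cmod. apply Im_le_Cmod. Qed.

Lemma part_sub p z w : is_part p -> p (z - w)%C = p z - p w.
Proof. intros [-> | ->]; reflexivity. Qed.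

Lemma part_deriv p g t v : is_part p -> curve_deriv_at g t v ->
  is_derive (fun u => p (g u)) t (p v).
Proof. intros [-> | ->] []; auto. Qed.

Lemma Cmod_pair_lt u v d : Rabs u < d / 2 -> Rabs v < d / 2 -> Cmod (u, v) < d.
Proof. intros. eapply Rle_lt_trans. apply Cmod_le_add. simpl. lra. Qed.

Lemma Ccont_2d p (e : C -> C) x y : is_part p -> Ccont e (x, y) ->
  continuity_2d_pt (fun u v => p (e (u, v))) x y.
Proof.
  intros Hp H [eps He]. destruct (H (eps/2)) as (d & Hd & Hh). lra.
  assert (Hd2 : 0 < d / 2) by lra.
  exists (mkposreal _ Hd2). simpl. intros u v Hu Hv.
  rewrite <- (part_sub p _ _ Hp).
  eapply Rle_lt_trans; [apply part_le; auto|].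
  apply Rle_lt_trans with (eps / 2); [|lra].
  replace (u, v) with ((x, y) + ((u - x)%R, (v - y)%R))%C.
  apply Hh. now apply Cmod_pair_lt.
  unfold Cplus; simpl; f_equal; ring.
Qed.

Lemma Ccont_curve p (e : C -> C) g t v : is_part p -> curve_deriv_at g t v -> Ccont e (g t) ->
  continuous (fun u => p (e (g u))) t.
Proof.
  intros Hp Hg He. apply continuity_pt_filterlim. intros eps Heps.
  destruct (He (eps/2)) as (d & Hd & Hh). lra.
  destruct (curve_deriv_eps _ _ _ Hg 1 Rlt_0_1) as (d' & Hd' & Hh').
  assert (P := Cmod_ge_0 v).
  exists (Rmin d' (d / (Cmod v + 1))). split. apply Rmin_pos; auto. apply Rdiv_lt_0_compat; lra.
  intros x [_ Hx]. unfold dist in *. simpl in *. unfold R_dist in *.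
  rewrite <- (part_sub p _ _ Hp). eapply Rle_lt_trans; [apply part_le; auto|].
  apply Rle_lt_trans with (eps / 2); [|lra].
  assert (L1 : Rabs (x - t) < d') by (eapply Rlt_le_trans; [apply Hx|apply Rmin_l]).
  assert (L2 : Rabs (x - t) < d / (Cmod v + 1)) by (eapply Rlt_le_trans; [apply Hx|apply Rmin_r]).
  specialize (Hh' _ L1). replace (t + (x - t)) with x in Hh' by ring.
  replace (g x) with (g t + (g x - g t))%C by ring. apply Hh.
  replace (g x - g t)%C with ((g x - g t - v * RtoC (x - t)) + v * RtoC (x - t))%C by ring.
  eapply Rle_lt_trans; [apply Cmod_triangle|]. rewrite Cmod_mult, Cmod_R.
  apply Rle_lt_trans with ((Cmod v + 1) * Rabs (x - t)). lra.
  apply Rlt_le_trans with ((Cmod v + 1) * (d / (Cmod v + 1))). apply Rmult_lt_compat_l; lra.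
  right; field; lra.
Qed.

Section ConvexPrimitive.
Variables (U : C -> Prop) (f f' : C -> C) (s0 : C).
Hypothesis (HU : Copen U) (CU : Cconvex U) (H0 : U s0)
  (Hf : forall z, U z -> Cderiv f z (f' z) /\ Ccont f' z).

(** The integral of [f] along the segment from [s0] to [s]. *)
Let cone_prim (s : C) : C :=
  (RInt (fun t => Re (f (s0 + RtoC t * (s - s0)) * (s - s0))%C) 0 1,
   RInt (fun t => Im (f (s0 + RtoC t * (s - s0)) * (s - s0))%C) 0 1).

(** Cauchy's theorem for the triangle [s0, s, s + h], followed by the mean value
    theorem on the side from [s] to [s + h]. Moving the end point of the segment
    along that side, the derivative under the integral sign is the derivative
    of a product in the other variable, and integrates to a boundary term. *)
Lemma cone_prim_increment (p : C -> R) (s h : C) : is_part p -> U s -> U (s + h)%C ->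
  exists c, 0 <= c <= 1 /\
    p (cone_prim (s + h) - cone_prim s)%C = p (f (s + RtoC c * h) * h)%C.
Proof.
  intros Hp Hs Hsh.
  set (D := fun u : R => (s + RtoC u * h - s0)%C).
  set (P := fun (u v : R) => (s0 + RtoC v * D u)%C).
  set (A := fun u => RInt (fun t => p (f (P u t) * D u)%C) 0 1).
  set (E := fun u v => (f' (P u v) * (RtoC v * h) * D u + f (P u v) * h)%C).
  assert (Hin : forall u, 0 <= u <= 1 -> U (s + RtoC u * h)%C).
  { intros u Hu. replace (s + RtoC u * h)%C with (s + RtoC u * (s + h - s))%C by ring. auto. }
  assert (HP : forall u v, U (s + RtoC u * h)%C -> 0 <= v <= 1 -> U (P u v)).
  { intros u v Hu Hv. apply CU; auto. }
  (* [E] is the derivative of the integrand in [u], and also the derivative in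
     [v] of [v f(P u v) h]; this exchange is the whole point *)
  assert (Du : forall u v, U (P u v) -> is_derive (fun x => p (f (P x v) * D x)%C) u (p (E u v))).
  { intros u v HPu. destruct (Hf _ HPu) as [Hd Hc].
    assert (L := curve_deriv_line s h u).
    apply (part_deriv p (fun x => f (P x v) * D x)%C u (E u v) Hp).
    replace (E u v) with (((f' (P u v) * (RtoC v * RtoC 1)) * D u + f (P u v) * RtoC 1) * h)%C by (unfold E; ring).
    apply (curve_deriv_comp (fun w => f (s0 + RtoC v * (w - s0)) * (w - s0))%C (fun x => s + RtoC x * h)%C u _ h L).
    assert (D0 : Cderiv (fun w => w - s0)%C (s + RtoC u * h)%C (RtoC 1)).
    { eapply Cderiv_eq. apply Cderiv_minus. apply Cderiv_id. apply Cderiv_const. ring. }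
    apply (Cderiv_mult (fun w => f (s0 + RtoC v * (w - s0)))%C (fun w => w - s0)%C); auto.
    apply (Cderiv_comp f (fun w => s0 + RtoC v * (w - s0))%C); auto.
    eapply Cderiv_eq. apply (Cderiv_plus (fun _ => s0) (fun w => RtoC v * (w - s0))%C). apply Cderiv_const.
    apply (Cderiv_scal (RtoC v)), D0. ring. }
  assert (Dv : forall u v, U (P u v) -> is_derive (fun y => p (RtoC y * f (P u y) * h)%C) v (p (E u v))).
  { intros u v HPu. destruct (Hf _ HPu) as [Hd Hc].
    apply (part_deriv p (fun y => RtoC y * f (P u y) * h)%C v (E u v) Hp).
    replace (E u v) with (((RtoC 1 * f (P u v) + RtoC v * (f' (P u v) * D u)) * h))%C by (unfold E; ring).
    assert (G1 : curve_deriv_at (fun y => f (P u y)) v (f' (P u v) * D u)%C).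
    { apply (curve_deriv_comp f (fun y => s0 + RtoC y * D u)%C v _ (D u) (curve_deriv_line _ _ _)). exact Hd. }
    replace ((RtoC 1 * f (P u v) + RtoC v * (f' (P u v) * D u)) * h)%C with
      ((RtoC 1 * f (P u v) + RtoC v * (f' (P u v) * D u)) * h + (RtoC v * f (P u v)) * RtoC 0)%C by ring.
    apply (curve_deriv_mult (fun y => RtoC y * f (P u y))%C (fun _ => h)); [|apply curve_deriv_const].
    apply (curve_deriv_mult RtoC (fun y => f (P u y))); auto.
    split; simpl. apply (is_derive_id (K := R_AbsRing)). apply (is_derive_const (V := R_NormedModule)). }
  assert (CP : forall u v, Ccont (fun w => P (Re w) (Im w)) (u, v)).
  { intros u v. unfold P, D. apply Ccont_plus. apply Ccont_const. apply Ccont_mult. apply Ccont_Im.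
    apply Ccont_plus; [|apply Ccont_const]. apply Ccont_plus. apply Ccont_const. apply Ccont_mult. apply Ccont_Re. apply Ccont_const. }
  assert (CE : forall u v, U (P u v) -> Ccont (fun w => E (Re w) (Im w)) (u, v)).
  { intros u v HPu. destruct (Hf _ HPu) as [Hd Hc]. unfold E.
    apply Ccont_plus. apply Ccont_mult. apply Ccont_mult.
    apply (Ccont_comp f'); auto. apply Ccont_mult. apply Ccont_Im. apply Ccont_const.
    unfold D. apply Ccont_plus; [|apply Ccont_const]. apply Ccont_plus. apply Ccont_const. apply Ccont_mult. apply Ccont_Re. apply Ccont_const.
    apply Ccont_mult; [|apply Ccont_const]. apply (Ccont_comp f); auto. eapply Cderiv_cont; eauto. }
  assert (LU : forall u, U (s + RtoC u * h)%C -> locally u (fun x => U (s + RtoC x * h)%C)).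
  { intros u Hu. destruct (HU _ Hu) as (r & Hr & Hr').
    assert (Q := Cmod_ge_0 h).
    assert (Hrr : 0 < r / (Cmod h + 1)) by (apply Rdiv_lt_0_compat; lra).
    exists (mkposreal _ Hrr). intros x Hx. apply Hr'.
    replace (s + RtoC x * h - (s + RtoC u * h))%C with (RtoC (x - u) * h)%C by (rewrite RtoC_minus; ring).
    rewrite Cmod_mult, Cmod_R. assert (Hx' : Rabs (x - u) < r / (Cmod h + 1)) by exact Hx.
    apply Rle_lt_trans with (Rabs (x - u) * (Cmod h + 1)).
    apply Rmult_le_compat_l. apply Rabs_pos. lra.
    apply Rlt_le_trans with (r / (Cmod h + 1) * (Cmod h + 1)). apply Rmult_lt_compat_r; lra. right; field; lra. }
  assert (dA : forall u, U (s + RtoC u * h)%C -> is_derive A u (p (f (s + RtoC u * h) * h)%C)).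
  { intros u Hu. 
    replace (p (f (s + RtoC u * h) * h)%C) with (RInt (fun t => Derive (fun x => p (f (P x t) * D x)%C) u) 0 1).
    - apply (is_derive_RInt_param (fun x t => p (f (P x t) * D x)%C)).
      + rewrite Rmin_left, Rmax_right by lra. generalize (LU u Hu). apply filter_imp.
        intros x Hx t Ht. eexists. apply Du. auto.
      + rewrite Rmin_left, Rmax_right by lra. intros t Ht.
        apply (continuity_2d_pt_ext_loc (fun x y => p (E x y))).
        * destruct (HU _ (HP u t Hu Ht)) as (r & Hr & Hr').
          destruct (CP u t (r/2)) as (d & Hd & Hd'). lra.
          assert (Hd2 : 0 < d/2) by lra. exists (mkposreal _ Hd2). simpl. intros x y Hx Hy.
          symmetry. apply is_derive_unique, Du. apply Hr'.
          specialize (Hd' (x - u, y - t) (Cmod_pair_lt _ _ _ Hx Hy)). simpl in Hd'.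
          replace (u + (x - u)) with x in Hd' by ring. replace (t + (y - t)) with y in Hd' by ring. lra.
        * apply (Ccont_2d p (fun w => E (Re w) (Im w))); auto.
      + generalize (LU u Hu). apply filter_imp. intros x Hx. apply (ex_RInt_continuous (V := R_CompleteNormedModule)).
        rewrite Rmin_left, Rmax_right by lra. intros t Ht.
        apply (Ccont_curve p (fun w => f w * D x)%C (fun t => s0 + RtoC t * D x)%C t (D x)); auto. apply curve_deriv_line.
        apply Ccont_mult; [|apply Ccont_const]. eapply Cderiv_cont. apply Hf. apply HP; auto.
    - rewrite (RInt_ext _ (fun t => p (E u t))).
      + apply is_RInt_unique.
        replace (p (f (s + RtoC u * h) * h)%C) with (minus (p (RtoC 1 * f (P u 1%R) * h)%C) (p (RtoC 0 * f (P u 0%R) * h)%C)).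
        apply (is_RInt_derive (fun y => p (RtoC y * f (P u y) * h)%C)); rewrite Rmin_left, Rmax_right by lra.
        * intros t Ht. auto.
        * intros t Ht.
          apply (continuous_ext (fun y => p ((fun w => E (Re w) (Im w)) ((u, 0%R) + RtoC y * Ci)%C))).
          { intros y. simpl. f_equal. f_equal; ring. }
          apply (Ccont_curve p (fun w => E (Re w) (Im w)) (fun y => (u,0) + RtoC y * Ci)%C t Ci); auto. apply curve_deriv_line.
          replace ((u, 0%R) + RtoC t * Ci)%C with (u, t). auto.
          unfold Cplus, Cmult, RtoC, Ci; simpl; f_equal; ring.
        * unfold minus, plus, opp; simpl.
          replace (p (RtoC 0 * f (P u 0%R) * h)%C) with 0.
          replace (P u 1%R) with (s + RtoC u * h)%C by (unfold P, D; ring).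
          replace (RtoC 1 * f (s + RtoC u * h) * h)%C with (f (s + RtoC u * h) * h)%C by ring. ring.
          replace (RtoC 0 * f (P u 0%R) * h)%C with (RtoC 0) by ring. destruct Hp; subst p; reflexivity.
      + rewrite Rmin_left, Rmax_right by lra. intros t Ht. apply is_derive_unique. apply Du. apply HP; auto. lra. }
  destruct (MVT_gen A 0 1 (fun u => p (f (s + RtoC u * h) * h)%C)) as (c & Hc & Ec).
  - rewrite Rmin_left, Rmax_right by lra. intros. apply dA. apply Hin. lra.
  - rewrite Rmin_left, Rmax_right by lra. intros x Hx. apply continuity_pt_filterlim.
    apply (ex_derive_continuous A). eexists. apply dA. apply Hin. lra.
  - rewrite Rmin_left, Rmax_right in Hc by lra. exists c. split; auto.
    replace (p (f (s + RtoC c * h) * h)%C) with (p (f (s + RtoC c * h) * h)%C * (1 - 0)) by ring.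
    rewrite <- Ec, part_sub by auto.
    assert (EA : forall u w, D u = (w - s0)%C -> A u = p (cone_prim w)).
    { intros u w Eq. unfold A, P, cone_prim. rewrite Eq. destruct Hp; subst p; reflexivity. }
    rewrite (EA 1 (s + h)%C), (EA 0 s). reflexivity. unfold D; ring. unfold D; ring.
Qed.

Lemma cone_prim_deriv s : U s -> Cderiv cone_prim s (f s).
Proof.
  intros Hs eps He. destruct (HU s Hs) as (r & Hr & HrU).
  destruct (Cderiv_cont _ _ _ (proj1 (Hf s Hs)) (eps/2)) as (d & Hd & Hh). lra.
  exists (Rmin r d). split. now apply Rmin_pos. intros h Hhd.
  assert (L1 : Cmod h < r) by (eapply Rlt_le_trans; [apply Hhd|apply Rmin_l]).
  assert (L2 : Cmod h < d) by (eapply Rlt_le_trans; [apply Hhd|apply Rmin_r]).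
  assert (Hsh : U (s + h)%C). { apply HrU. now replace (s + h - s)%C with h by ring. }
  assert (B : forall p, is_part p -> Rabs (p (cone_prim (s + h) - cone_prim s - f s * h)%C) <= eps / 2 * Cmod h).
  { intros p Hp. destruct (cone_prim_increment p s h Hp Hs Hsh) as (c & Hc & E).
    rewrite part_sub, E, <- part_sub by auto.
    eapply Rle_trans; [apply part_le; auto|].
    replace (f (s + RtoC c * h) * h - f s * h)%C with ((f (s + RtoC c * h) - f s) * h)%C by ring.
    rewrite Cmod_mult. apply Rmult_le_compat_r. apply Cmod_ge_0. apply Hh.
    rewrite Cmod_mult, Cmod_R, Rabs_pos_eq by lra. assert (Q := Cmod_ge_0 h). nra. }
  eapply Rle_trans; [apply Cmod_le_add|].
  assert (B1 := B Re (or_introl eq_refl)). assert (B2 := B Im (or_intror eq_refl)). lra.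
Qed.

End ConvexPrimitive.

(** [f] has a primitive on [U]. *)
Definition has_prim (U : C -> Prop) (f : C -> C) : Prop :=
  exists F, forall z, U z -> Cderiv F z (f z).

Theorem convex_primitive U f : Copen U -> Cconvex U -> hol U f -> has_prim U f.
Proof.
  intros HU CU (f' & Hf).
  destruct (classic (exists s0, U s0)) as [(s0 & H0)|N].
  - eexists. intros z Hz. eapply (cone_prim_deriv U f f' s0); eauto.
  - exists f. intros z Hz. exfalso; eauto.
Qed.

(** Two primitives that agree where both are defined are glued; the values of the
    glued function are recorded for further gluing. *)
Lemma glue_primitives (U1 U2 : C -> Prop) (f F1 F2 : C -> C) :
  Copen U1 -> Copen U2 ->
  (forall z, U1 z -> Cderiv F1 z (f z)) -> (forall z, U2 z -> Cderiv F2 z (f z)) ->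
  (forall z, U1 z -> U2 z -> F1 z = F2 z) ->
  exists F, (forall z, U1 z -> F z = F1 z) /\ (forall z, U2 z -> F z = F2 z) /\
    (forall z, U1 z \/ U2 z -> Cderiv F z (f z)).
Proof.
  intros O1 O2 D1 D2 E.
  set (F := fun z => if excluded_middle_informative (U1 z) then F1 z else F2 z).
  assert (E1 : forall z, U1 z -> F z = F1 z).
  { intros z Hz. unfold F. destruct (excluded_middle_informative (U1 z)); tauto. }
  assert (E2 : forall z, U2 z -> F z = F2 z).
  { intros z Hz. unfold F. destruct (excluded_middle_informative (U1 z)); auto. }
  exists F. repeat split; auto.
  intros z [Hz|Hz].
  - destruct (O1 z Hz) as (r & Hr & H). apply Cderiv_ext_loc with F1 r; auto. intros; symmetry; auto.
  - destruct (O2 z Hz) as (r & Hr & H). apply Cderiv_ext_loc with F2 r; auto. intros; symmetry; auto.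
Qed.

Lemma primitives_differ_by_constant V f F1 F2 : Cconvex V ->
  (forall z, V z -> Cderiv F1 z (f z)) -> (forall z, V z -> Cderiv F2 z (f z)) ->
  exists c, forall z, V z -> F1 z = (F2 z + c)%C.
Proof.
  intros CV D1 D2. destruct (classic (exists z0, V z0)) as [(z0 & H0)|N].
  - exists (F1 z0 - F2 z0)%C. intros z Hz.
    assert (E : (F1 z - F2 z)%C = (F1 z0 - F2 z0)%C).
    { apply (Cderiv_zero_convex V (fun x => F1 x - F2 x)%C CV); auto.
      intros y Hy. eapply Cderiv_eq. apply Cderiv_minus; eauto. ring. }
    rewrite <- E. ring.
  - exists (RtoC 0). intros z Hz. exfalso; eauto.
Qed.

Lemma Copen_and U V : Copen U -> Copen V -> Copen (fun z => U z /\ V z).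
Proof.
  intros HU HV z [H1 H2]. destruct (HU z H1) as (r & Hr & A). destruct (HV z H2) as (r' & Hr' & A').
  exists (Rmin r r'). split. now apply Rmin_pos. intros y Hy. split.
  apply A. eapply Rlt_le_trans; [apply Hy|apply Rmin_l].
  apply A'. eapply Rlt_le_trans; [apply Hy|apply Rmin_r].
Qed.

Lemma Cconvex_and U V : Cconvex U -> Cconvex V -> Cconvex (fun z => U z /\ V z).
Proof. intros HU HV z w t [] []; split; auto. Qed.

Lemma open_part_gt p x : is_part p -> Copen (fun z => x < p z).
Proof.
  intros Hp z Hz. exists (p z - x). split. lra. intros y Hy.
  assert (Q := part_le p (y - z)%C Hp). rewrite part_sub in Q by auto.
  assert (Q' := Rle_abs (- (p y - p z))). rewrite Rabs_Ropp in Q'. lra.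
Qed.

Lemma open_part_lt p x : is_part p -> Copen (fun z => p z < x).
Proof.
  intros Hp z Hz. exists (x - p z). split. lra. intros y Hy.
  assert (Q := part_le p (y - z)%C Hp). rewrite part_sub in Q by auto.
  assert (Q' := Rle_abs (p y - p z)). lra.
Qed.

Lemma part_segment p z w t : is_part p -> p (z + RtoC t * (w - z))%C = p z + t * (p w - p z).
Proof. intros [-> | ->]; destruct z, w; simpl; ring. Qed.

Lemma convex_part_gt p x : is_part p -> Cconvex (fun z => x < p z).
Proof. intros Hp z w t Hz Hw Ht. rewrite part_segment by auto. destruct (Req_dec t 0); nra. Qed.

Lemma convex_part_lt p x : is_part p -> Cconvex (fun z => p z < x).
Proof. intros Hp z w t Hz Hw Ht. rewrite part_segment by auto. destruct (Req_dec t 0); nra. Qed.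

Lemma part_Re : is_part Re. Proof. now left. Qed.
Lemma part_Im : is_part Im. Proof. now right. Qed.

Lemma open_compl_point p : Copen (fun z => z <> p).
Proof.
  intros z Hz. exists (Cmod (z - p)%C). split.
  - apply Cmod_neq_0. intros E. apply Hz. replace z with (z - p + p)%C by ring. rewrite E; ring.
  - intros y Hy ->. rewrite Cmod_sub_comm in Hy. lra.
Qed.

Lemma open_compl_list (l : list C) : Copen (fun z => ~ In z l).
Proof.
  induction l as [|p l IH].
  - intros z _. exists 1. split. lra. simpl; auto.
  - intros z Hz. destruct (Copen_and _ _ (open_compl_point p) IH z) as (r & Hr & H).
    + split. intros ->. apply Hz; now left. intros I; apply Hz; now right.
    + exists r. split; auto. intros y Hy [->|I]; destruct (H y Hy); auto.
Qed.

Lemma sub_neq_0 (z p : C) : z <> p -> (z - p)%C <> RtoC 0.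
Proof. intros H E. apply H. replace z with (z - p + p)%C by ring. rewrite E; ring. Qed.

Lemma hol_inv_sub D p : (forall z, D z -> z <> p) -> hol D (fun z => / (z - p))%C.
Proof.
  intros H. apply (hol_inv D (fun z => z - p)%C). apply hol_minus. apply hol_id. apply hol_const.
  intros z Hz. apply sub_neq_0; auto.
Qed.

(** * The logarithm *)

Lemma neq_0_of_Re z : 0 < Re z -> z <> RtoC 0.
Proof. intros H ->. simpl in H. lra. Qed.

(** A primitive of [1 / z] on the right half plane, vanishing at [1]. *)
Definition rlog_spec (F : C -> C) : Prop :=
  (forall z, 0 < Re z -> Cderiv F z (/ z)%C) /\ F (RtoC 1) = RtoC 0.

(** The logarithm on the right half plane. *)
Definition rlog : C -> C := epsilon (inhabits (fun z => z)) rlog_spec.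

Lemma rlog_correct : rlog_spec rlog.
Proof.
  unfold rlog. apply epsilon_spec.
  destruct (convex_primitive (fun z => 0 < Re z) (fun z => / z)%C) as (F & HF).
  - apply (open_part_gt Re 0 part_Re).
  - apply (convex_part_gt Re 0 part_Re).
  - apply (hol_inv _ (fun z => z)). apply hol_id. intros z Hz. now apply neq_0_of_Re.
  - exists (fun z => F z - F (RtoC 1))%C. split.
    + intros z Hz. eapply Cderiv_eq. apply Cderiv_minus. apply HF, Hz. apply Cderiv_const. ring.
    + ring.
Qed.

Lemma Cexp_rlog z : 0 < Re z -> Cexp (rlog z) = z.
Proof.
  intros Hz. destruct rlog_correct as [D E].
  assert (H : (z * Cexp (RtoC (-1) * rlog z))%C = (RtoC 1 * Cexp (RtoC (-1) * rlog (RtoC 1)))%C).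
  { apply (Cderiv_zero_convex (fun z => 0 < Re z) (fun x => x * Cexp (RtoC (-1) * rlog x))%C).
    apply (convex_part_gt Re 0 part_Re).
    - intros y Hy. eapply Cderiv_eq. apply Cderiv_mult. apply Cderiv_id.
      apply (Cderiv_comp Cexp (fun x => RtoC (-1) * rlog x)%C). apply Cderiv_scal, D, Hy. apply Cderiv_Cexp.
      cbv beta. replace (RtoC (-1)) with (- RtoC 1)%C by (unfold RtoC, Copp; simpl; f_equal; ring).
      field. now apply neq_0_of_Re.
    - auto.
    - simpl; lra. }
  rewrite E in H. replace (RtoC (-1) * RtoC 0)%C with (RtoC 0) in H by ring. rewrite Cexp_0 in H.
  replace (RtoC (-1) * rlog z)%C with (- rlog z)%C in H.
  2:{ destruct (rlog z). unfold Cmult, Copp, RtoC; simpl; f_equal; ring. }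
  replace (Cexp (rlog z)) with ((RtoC 1 * RtoC 1) * Cexp (rlog z))%C by ring. rewrite <- H.
  replace (z * Cexp (- rlog z) * Cexp (rlog z))%C with (z * (Cexp (rlog z) * Cexp (- rlog z)))%C by ring.
  rewrite Cexp_opp_mult. ring.
Qed.

(** The curve [u |-> rlog (Cexp (u h)) - u h] has derivative zero. *)
Lemma rlog_Cexp h : Rabs (Im h) < PI / 2 -> rlog (Cexp h) = h.
Proof.
  intros Hh. destruct rlog_correct as [D E].
  assert (Q := curve_mean_value (fun u => rlog (Cexp (RtoC u * h)) - (RtoC 0 + RtoC u * h))%C (fun _ => RtoC 0) 0).
  cbv beta in Q.
  assert (Q' : Cmod (rlog (Cexp (RtoC 1 * h)) - (RtoC 0 + RtoC 1 * h) - (rlog (Cexp (RtoC 0 * h)) - (RtoC 0 + RtoC 0 * h)))%C <= 2 * 0).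
  { apply Q.
    - intros t Ht.
      assert (P : 0 < Re (Cexp (RtoC t * h)%C)).
      { simpl. apply Rmult_lt_0_compat. apply exp_pos.
        replace (t * snd h + 0 * fst h) with (t * Im h) by (unfold Im; ring).
        apply Rabs_def2 in Hh. apply cos_gt_0; nra. }
      replace (RtoC 0) with (/ Cexp (RtoC t * h) * (Cexp (RtoC t * h) * h) - h)%C.
      apply curve_deriv_minus. 2: apply curve_deriv_line.
      apply (curve_deriv_comp rlog (fun u => Cexp (RtoC u * h))%C). apply Cexp_line_deriv. now apply D.
      field. apply Cexp_neq_0.
    - intros. rewrite Cmod_0. lra. }
  replace (RtoC 1 * h)%C with h in Q' by ring. replace (RtoC 0 * h)%C with (RtoC 0) in Q' by ring.
  rewrite Cexp_0, E in Q'.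
  assert (Z : Cmod (rlog (Cexp h) - h)%C = 0).
  { apply Rle_antisym. 2: apply Cmod_ge_0.
    replace (rlog (Cexp h) - h)%C with (rlog (Cexp h) - (RtoC 0 + h) - (RtoC 0 - (RtoC 0 + RtoC 0)))%C by ring. lra. }
  apply Cmod_eq_0 in Z. replace (rlog (Cexp h)) with (rlog (Cexp h) - h + h)%C by ring. rewrite Z. ring.
Qed.

(** The principal logarithm: quarter turns of [rlog] in the upper and in the lower
    half plane. The value on the half line of nonpositive reals is irrelevant. *)
Definition Clog (z : C) : C :=
  if Rlt_dec 0 (Im z) then (rlog (- Ci * z) + (0%R, (PI / 2)%R))%C
  else if Rlt_dec (Im z) 0 then (rlog (Ci * z) - (0%R, (PI / 2)%R))%C
  else rlog z.

(** The plane without the half line of nonpositive reals. *)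
Definition slit (z : C) : Prop := Im z <> 0 \/ 0 < Re z.

Lemma Clog_upper z : 0 < Im z -> Clog z = (rlog (- Ci * z) + (0%R, (PI / 2)%R))%C.
Proof. intros H. unfold Clog. destruct (Rlt_dec 0 (Im z)); tauto. Qed.

Lemma Clog_lower z : Im z < 0 -> Clog z = (rlog (Ci * z) - (0%R, (PI / 2)%R))%C.
Proof. intros H. unfold Clog. destruct (Rlt_dec 0 (Im z)). lra. destruct (Rlt_dec (Im z) 0); tauto. Qed.

Lemma rlog_rot_deriv c z : c <> RtoC 0 -> 0 < Re (c * z)%C -> Cderiv (fun x => rlog (c * x)%C) z (/ z)%C.
Proof.
  intros Hc Hz. eapply Cderiv_eq. apply (Cderiv_comp rlog (fun x => c * x)%C).
  apply Cderiv_scal, Cderiv_id. apply rlog_correct; auto.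
  field. split; auto. intros ->. apply neq_0_of_Re in Hz. apply Hz. ring.
Qed.

Lemma Ci_neq_0 : Ci <> RtoC 0.
Proof. apply neq_0_of_Cmod. rewrite Cmod_Ci; lra. Qed.

Lemma opp_Ci_neq_0 : (- Ci)%C <> RtoC 0.
Proof. apply neq_0_of_Cmod. rewrite Cmod_opp, Cmod_Ci; lra. Qed.

Lemma Clog_upper_deriv z : 0 < Im z -> Cderiv (fun x => rlog (- Ci * x) + (0%R, (PI / 2)%R))%C z (/ z)%C.
Proof.
  intros H. eapply Cderiv_eq. apply Cderiv_plus; [|apply Cderiv_const].
  apply rlog_rot_deriv. apply opp_Ci_neq_0. destruct z; simpl in *; lra. ring.
Qed.

Lemma Clog_lower_deriv z : Im z < 0 -> Cderiv (fun x => rlog (Ci * x) - (0%R, (PI / 2)%R))%C z (/ z)%C.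
Proof.
  intros H. eapply Cderiv_eq. apply Cderiv_minus; [|apply Cderiv_const].
  apply rlog_rot_deriv. apply Ci_neq_0. destruct z; simpl in *; lra. ring.
Qed.

Lemma Cexp_imag t : Cexp (0, t) = (cos t, sin t).
Proof. unfold Cexp; simpl. rewrite exp_0. f_equal; ring. Qed.

(** The branches of [Clog] fit together on the right half plane: two primitives of
    [1 / z] on a quadrant are compared at [exp (+- i pi / 4)]. *)
Lemma Clog_right z : 0 < Re z -> Clog z = rlog z.
Proof.
  intros Hz. assert (PP := PI_RGT_0). destruct (Rtotal_order (Im z) 0) as [H|[H|H]].
  - rewrite Clog_lower by auto. set (F := fun x => (rlog (Ci * x) - (0%R, (PI / 2)%R))%C). change (F z = rlog z).
    destruct (primitives_differ_by_constant (fun z => 0 < Re z /\ Im z < 0) (fun z => / z)%C F rlog) as (c & Hc).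
    + apply Cconvex_and. apply (convex_part_gt Re 0 part_Re). apply (convex_part_lt Im 0 part_Im).
    + intros x [_ Hx]. now apply Clog_lower_deriv.
    + intros x [Hx _]. now apply rlog_correct.
    + assert (E := Hc (Cexp (0, - (PI / 4)))). unfold F in E.
      replace (Ci * Cexp (0%R, (- (PI / 4))%R))%C with (Cexp (0, PI / 4)) in E.
      * rewrite !rlog_Cexp in E. 2,3: simpl; apply Rabs_def1; lra.
        assert (c = RtoC 0).
        { replace c with ((0%R, (- (PI/4))%R) + c - (0%R, (- (PI/4))%R))%C by ring. rewrite <- E.
          unfold Cminus, Cplus, Copp, RtoC; simpl; f_equal; field.
          rewrite Cexp_imag; simpl. split. apply cos_gt_0; lra.
          rewrite sin_neg. assert (0 < sin (PI/4)) by (apply sin_gt_0; lra). lra. }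
        rewrite Hc, H0 by auto. ring.
      * replace Ci with (Cexp (0, PI / 2)). rewrite <- Cexp_add. f_equal. unfold Cplus; simpl; f_equal; field.
        rewrite Cexp_imag, cos_PI2, sin_PI2. reflexivity.
  - unfold Clog. rewrite H. destruct (Rlt_dec 0 0); [lra|reflexivity].
  - rewrite Clog_upper by auto. set (F := fun x => (rlog (- Ci * x) + (0%R, (PI / 2)%R))%C). change (F z = rlog z).
    destruct (primitives_differ_by_constant (fun z => 0 < Re z /\ 0 < Im z) (fun z => / z)%C F rlog) as (c & Hc).
    + apply Cconvex_and. apply (convex_part_gt Re 0 part_Re). apply (convex_part_gt Im 0 part_Im).
    + intros x [_ Hx]. now apply Clog_upper_deriv.
    + intros x [Hx _]. now apply rlog_correct.
    + assert (E := Hc (Cexp (0, PI / 4))). unfold F in E.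
      replace (- Ci * Cexp (0%R, (PI / 4)%R))%C with (Cexp (0, - (PI / 4))) in E.
      * rewrite !rlog_Cexp in E. 2,3: simpl; apply Rabs_def1; lra.
        assert (c = RtoC 0).
        { replace c with ((0%R, ((PI/4))%R) + c - (0%R, ((PI/4))%R))%C by ring. rewrite <- E.
          unfold Cminus, Cplus, Copp, RtoC; simpl; f_equal; field.
          rewrite Cexp_imag; simpl. split. apply cos_gt_0; lra. apply sin_gt_0; lra. }
        rewrite Hc, H0 by auto. ring.
      * replace (- Ci)%C with (Cexp (0, - (PI / 2))). rewrite <- Cexp_add. f_equal. unfold Cplus; simpl; f_equal; field.
        rewrite Cexp_imag, cos_neg, sin_neg, cos_PI2, sin_PI2. unfold Ci, Copp; simpl; f_equal; ring.
Qed.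

Lemma Clog_deriv z : slit z -> Cderiv Clog z (/ z)%C.
Proof.
  intros [H|H].
  - destruct (Rtotal_order (Im z) 0) as [L|[L|L]]; [|lra|].
    + destruct (open_part_lt Im 0 part_Im z L) as (r & Hr & O).
      apply Cderiv_ext_loc with (fun x => rlog (Ci * x) - (0%R, (PI / 2)%R))%C r; auto.
      intros y Hy. symmetry. apply Clog_lower; auto. now apply Clog_lower_deriv.
    + destruct (open_part_gt Im 0 part_Im z L) as (r & Hr & O).
      apply Cderiv_ext_loc with (fun x => rlog (- Ci * x) + (0%R, (PI / 2)%R))%C r; auto.
      intros y Hy. symmetry. apply Clog_upper; auto. now apply Clog_upper_deriv.
  - destruct (open_part_gt Re 0 part_Re z H) as (r & Hr & O).
    apply Cderiv_ext_loc with rlog r; auto.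
    intros y Hy. symmetry. apply Clog_right; auto. now apply rlog_correct.
Qed.

(** The logarithm cut along the positive half line, [Clog (- z) + i pi], equals
    [Clog] above the real axis and exceeds it by [2 pi i] below. *)
Lemma Clog_opp_upper z : 0 < Im z -> (Clog (- z) + (0%R, PI))%C = Clog z.
Proof.
  intros H. rewrite (Clog_upper z), (Clog_lower (- z)%C) by (auto; destruct z; simpl in *; lra).
  replace (Ci * - z)%C with (- Ci * z)%C by ring.
  destruct (rlog (- Ci * z)%C). unfold Cminus, Cplus, Copp; simpl; f_equal; field.
Qed.

Lemma Clog_opp_lower z : Im z < 0 -> (Clog (- z) + (0%R, PI))%C = (Clog z + (0%R, (2 * PI)%R))%C.
Proof.
  intros H. rewrite (Clog_lower z), (Clog_upper (- z)%C) by (auto; destruct z; simpl in *; lra).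
  replace (- Ci * - z)%C with (Ci * z)%C by ring.
  destruct (rlog (Ci * z)%C). unfold Cminus, Cplus, Copp; simpl; f_equal; field.
Qed.

Lemma Clog_1 : Clog (RtoC 1) = RtoC 0.
Proof. rewrite Clog_right. apply rlog_correct. simpl; lra. Qed.

Lemma Cexp_Clog z : 0 < Re z -> Cexp (Clog z) = z.
Proof. intros H. rewrite Clog_right by auto. now apply Cexp_rlog. Qed.

Lemma Clog_sub_deriv p z : slit (z - p)%C -> Cderiv (fun s => Clog (s - p)) z (/ (z - p))%C.
Proof.
  intros H. eapply Cderiv_eq. apply (Cderiv_comp Clog (fun s => s - p)%C).
  apply Cderiv_minus. apply Cderiv_id. apply Cderiv_const. apply Clog_deriv, H. ring.
Qed.

Lemma Clog_opp_sub_deriv p z : slit (- (z - p))%C ->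
  Cderiv (fun s => Clog (- (s - p)) + (0%R, PI))%C z (/ (z - p))%C.
Proof.
  intros H. eapply Cderiv_eq. apply Cderiv_plus; [|apply Cderiv_const].
  apply (Cderiv_comp Clog (fun s => - (s - p))%C).
  apply Cderiv_ext with (fun s => p - s)%C. intros; ring.
  apply Cderiv_minus. apply Cderiv_const. apply Cderiv_id. apply Clog_deriv, H.
  field. intros E. destruct H as [H|H]; rewrite E in H; simpl in H; lra.
Qed.

(** * Residues *)

Lemma Copen_ext (U V : C -> Prop) : (forall z, U z <-> V z) -> Copen U -> Copen V.
Proof.
  intros E H z Hz. destruct (H z) as (r & Hr & A). now apply E. exists r; split; auto.
  intros y Hy. apply E; auto.
Qed.

Lemma Copen_or U V : Copen U -> Copen V -> Copen (fun z => U z \/ V z).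
Proof.
  intros HU HV z [H|H].
  - destruct (HU z H) as (r & Hr & A). exists r; split; auto.
  - destruct (HV z H) as (r & Hr & A). exists r; split; auto.
Qed.

Lemma convex_hol_primitive D U f : hol D f -> (forall z, U z -> D z) -> Copen U -> Cconvex U -> has_prim U f.
Proof. intros H I O V. apply convex_primitive; auto. now apply hol_sub with D. Qed.

(** The residue at an isolated singularity. The punctured convex set is the union of
    four convex halves, on each of which [f] has a primitive; going once around [p]
    the primitives are matched except for one jump, which is removed by
    subtracting a multiple of [1 / (z - p)], whose primitive is the logarithm. *)
Lemma residue_one_pole U f p : Copen U -> Cconvex U -> hol (fun z => U z /\ z <> p) f ->
  exists r, has_prim (fun z => U z /\ z <> p) (fun z => (f z - r / (z - p))%C).
Proof.
  intros OU CU Hf.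
  set (UR := fun z => U z /\ Re p < Re z). set (UT := fun z => U z /\ Im p < Im z).
  set (UL := fun z => U z /\ Re z < Re p). set (UB := fun z => U z /\ Im z < Im p).
  assert (OR : Copen UR) by (apply Copen_and; auto; apply (open_part_gt Re _ part_Re)).
  assert (OT : Copen UT) by (apply Copen_and; auto; apply (open_part_gt Im _ part_Im)).
  assert (OL : Copen UL) by (apply Copen_and; auto; apply (open_part_lt Re _ part_Re)).
  assert (OB : Copen UB) by (apply Copen_and; auto; apply (open_part_lt Im _ part_Im)).
  assert (CR : Cconvex UR) by (apply Cconvex_and; auto; apply (convex_part_gt Re _ part_Re)).
  assert (CT : Cconvex UT) by (apply Cconvex_and; auto; apply (convex_part_gt Im _ part_Im)).
  assert (CL : Cconvex UL) by (apply Cconvex_and; auto; apply (convex_part_lt Re _ part_Re)).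
  assert (CB : Cconvex UB) by (apply Cconvex_and; auto; apply (convex_part_lt Im _ part_Im)).
  destruct (convex_hol_primitive _ UR f Hf) as (FR & DR); auto.
  { intros z [H1 H2]; split; auto. intros ->; lra. }
  destruct (convex_hol_primitive _ UT f Hf) as (FT0 & DT0); auto.
  { intros z [H1 H2]; split; auto. intros ->; lra. }
  destruct (convex_hol_primitive _ UL f Hf) as (FL0 & DL0); auto.
  { intros z [H1 H2]; split; auto. intros ->; lra. }
  destruct (convex_hol_primitive _ UB f Hf) as (FB0 & DB0); auto.
  { intros z [H1 H2]; split; auto. intros ->; lra. }
  (* adjust constants so that consecutive primitives agree, anticlockwise *)
  destruct (primitives_differ_by_constant (fun z => UR z /\ UT z) f FR FT0) as (c1 & E1).
  { now apply Cconvex_and. } { intros z []; auto. } { intros z []; auto. }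
  set (FT := fun z => (FT0 z + c1)%C).
  assert (DT : forall z, UT z -> Cderiv FT z (f z)).
  { intros z Hz. eapply Cderiv_eq. apply Cderiv_plus; [apply DT0, Hz|apply Cderiv_const]. ring. }
  destruct (primitives_differ_by_constant (fun z => UT z /\ UL z) f FT FL0) as (c2 & E2).
  { now apply Cconvex_and. } { intros z []; auto. } { intros z []; auto. }
  set (FL := fun z => (FL0 z + c2)%C).
  assert (DL : forall z, UL z -> Cderiv FL z (f z)).
  { intros z Hz. eapply Cderiv_eq. apply Cderiv_plus; [apply DL0, Hz|apply Cderiv_const]. ring. }
  destruct (primitives_differ_by_constant (fun z => UL z /\ UB z) f FL FB0) as (c3 & E3).
  { now apply Cconvex_and. } { intros z []; auto. } { intros z []; auto. }
  set (FB := fun z => (FB0 z + c3)%C).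
  assert (DB : forall z, UB z -> Cderiv FB z (f z)).
  { intros z Hz. eapply Cderiv_eq. apply Cderiv_plus; [apply DB0, Hz|apply Cderiv_const]. ring. }
  destruct (primitives_differ_by_constant (fun z => UB z /\ UR z) f FB FR) as (c4 & E4).
  { now apply Cconvex_and. } { intros z []; auto. } { intros z []; auto. }
  (* the remaining jump [c4] is the period of [f]; the logarithm has period [2 pi i] *)
  set (P := (0%R, (2 * PI)%R) : C).
  assert (HP : P <> RtoC 0). { intros E. apply (f_equal snd) in E. simpl in E. assert (Q := PI_RGT_0). lra. }
  set (r := (c4 / P)%C). exists r.
  set (LL := fun z => (Clog (- (z - p)) + (0%R, PI))%C).
  set (L := fun z => Clog (z - p)%C).
  set (LB := fun z => (Clog (z - p) + P)%C).
  assert (DLR : forall z, UR z -> Cderiv L z (/ (z - p))%C).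
  { intros z [_ Hz]. apply Clog_sub_deriv. right. destruct z, p; simpl in *; lra. }
  assert (DLT : forall z, UT z -> Cderiv L z (/ (z - p))%C).
  { intros z [_ Hz]. apply Clog_sub_deriv. left. destruct z, p; simpl in *; lra. }
  assert (DLL : forall z, UL z -> Cderiv LL z (/ (z - p))%C).
  { intros z [_ Hz]. apply Clog_opp_sub_deriv. right. destruct z, p; simpl in *; lra. }
  assert (DLB : forall z, UB z -> Cderiv LB z (/ (z - p))%C).
  { intros z [_ Hz]. eapply Cderiv_eq. apply Cderiv_plus; [|apply Cderiv_const].
    apply Clog_sub_deriv. left. destruct z, p; simpl in *; lra. ring. }
  assert (comb : forall F M z, Cderiv F z (f z) -> Cderiv M z (/ (z - p))%C ->
    Cderiv (fun x => F x - r * M x)%C z (f z - r / (z - p))%C).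
  { intros F M z HF HM. apply (Cderiv_minus F (fun x => r * M x)%C); auto. apply Cderiv_scal, HM. }
  set (g := fun z => (f z - r / (z - p))%C).
  destruct (glue_primitives UR UT g (fun z => FR z - r * L z)%C (fun z => FT z - r * L z)%C) as (G1 & A1 & B1 & D1); auto.
  { intros z H1 H2. rewrite E1 by auto. reflexivity. }
  destruct (glue_primitives (fun z => UR z \/ UT z) UL g G1 (fun z => FL z - r * LL z)%C) as (G2 & A2 & B2 & D2); auto.
  { now apply Copen_or. }
  { intros z [H1|H1] H2. destruct H1, H2; lra.
    rewrite B1 by auto. rewrite E2 by auto. replace (L z) with (LL z). reflexivity. unfold L, LL.
    apply Clog_opp_upper. destruct H1, z, p; simpl in *; lra. }
  destruct (glue_primitives (fun z => (UR z \/ UT z) \/ UL z) UB g G2 (fun z => FB z - r * LB z)%C) as (G3 & A3 & B3 & D3); auto.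
  { apply Copen_or; auto. now apply Copen_or. }
  { intros z [[H1|H1]|H1] H2.
    - rewrite A2 by auto. rewrite A1 by auto. rewrite E4 by auto. unfold LB, L, r. field. auto.
    - destruct H1, H2; lra.
    - rewrite B2 by auto. rewrite E3 by auto. replace (LL z) with (LB z). reflexivity. unfold LL, LB, P. symmetry.
      apply Clog_opp_lower. destruct H2, z, p; simpl in *; lra. }
  exists G3. intros z [HU Hz]. apply D3. unfold UR, UT, UL, UB.
  destruct (Rtotal_order (Re z) (Re p)) as [Q|[Q|Q]]; auto.
  destruct (Rtotal_order (Im z) (Im p)) as [Q'|[Q'|Q']]; auto.
  exfalso. apply Hz. destruct z, p; simpl in *; subst; auto.
Qed.

(** The sum of [r / (s - p)] over a list of pairs (pole, residue). *)
Fixpoint principal_part (rs : list (C * C)) (s : C) : C :=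
  match rs with
  | nil => RtoC 0
  | (p, r) :: rs' => (r / (s - p) + principal_part rs' s)%C
  end.

Lemma principal_part_app rs rs' s :
  principal_part (rs ++ rs') s = (principal_part rs s + principal_part rs' s)%C.
Proof.
  induction rs as [|[p r] rs IH]; simpl. ring. rewrite IH. apply Cplus_assoc.
Qed.

Lemma hol_principal_part D rs : (forall z pr, D z -> In pr rs -> z <> fst pr) -> hol D (principal_part rs).
Proof.
  induction rs as [|[p r] rs IH]; intros H; simpl.
  - apply hol_const.
  - apply (hol_plus D (fun s => r / (s - p))%C).
    + apply (hol_mult D (fun _ => r)). apply hol_const. apply hol_inv_sub.
      intros z Hz. apply (H z (p, r)); simpl; auto.
    + apply IH. intros z pr Hz Hi. apply (H z pr); simpl; auto.
Qed.

(** The values of [g] on a finite list leave a gap above [x]. *)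
Lemma next_value (g : C -> R) (l : list C) x y : In y l -> x < g y ->
  exists M, x < M <= g y /\ (forall z, In z l -> g z <= x \/ M <= g z).
Proof.
  revert y. induction l as [|a l IH]; intros y Hy Hxy; [contradiction|].
  destruct (classic (exists y', In y' l /\ x < g y')) as [(y' & Hy' & Hx)|N].
  - destruct (IH y' Hy' Hx) as (M & HM & HMl).
    destruct (Rle_lt_dec (g a) x) as [L|L].
    + destruct Hy as [->|Hy]; [lra|].
      exists M. destruct (HMl y Hy); [lra|]. split; [lra|]. intros z [->|Hz]; auto.
    + exists (Rmin M (g a)). split.
      * split. apply Rmin_glb_lt; lra. destruct Hy as [->|Hy]. apply Rmin_r.
        destruct (HMl y Hy); [lra|]. eapply Rle_trans; [apply Rmin_l|auto].
      * intros z [->|Hz]. right; apply Rmin_r. destruct (HMl z Hz); auto. right. eapply Rle_trans; [apply Rmin_l|auto].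
  - destruct Hy as [->|Hy].
    + exists (g y). split. lra. intros z [->|Hz]. right; lra. left. apply Rnot_lt_le. intros H. apply N; eauto.
    + exfalso; eauto.
Qed.

Lemma filter_length_lt {T} (f : T -> bool) l a : In a l -> f a = false -> (length (filter f l) < length l)%nat.
Proof.
  induction l as [|b l IH]; intros Hi Hf; [contradiction|]. simpl.
  assert (Q := filter_length_le f l). destruct Hi as [->|Hi].
  - rewrite Hf. lia.
  - specialize (IH Hi Hf). destruct (f b); simpl; lia.
Qed.

Definition Rleb (x y : R) : bool := if Rle_dec x y then true else false.
Lemma Rleb_true x y : Rleb x y = true <-> x <= y.
Proof. unfold Rleb. destruct (Rle_dec x y); split; intros; try discriminate; auto; lra. Qed.
Lemma Rleb_false x y : Rleb x y = false <-> y < x.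
Proof. unfold Rleb. destruct (Rle_dec x y); split; intros; try discriminate; auto; lra. Qed.

(** On a convex open set with finitely many points removed, a holomorphic function
    is the sum of simple fractions and of a derivative. By induction on the number
    of points: the set is cut, horizontally or vertically, into two convex sets that
    overlap in a strip without points, and the primitives are glued. *)
Theorem residue_decomposition (l : list C) : forall U f, Copen U -> Cconvex U ->
  hol (fun z => U z /\ ~ In z l) f ->
  exists rs, (forall pr, In pr rs -> In (fst pr) l) /\
    has_prim (fun z => U z /\ ~ In z l) (fun z => (f z - principal_part rs z)%C).
Proof.
  remember (length l) as n eqn:En. revert l En.
  induction n as [n IH] using lt_wf_ind. intros l -> U f OU CU Hf.
  destruct l as [|p l0] eqn:El.
  - exists nil. split. contradiction.
    destruct (convex_hol_primitive _ U f Hf) as (F & DF); auto.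
    exists F. intros z [Hz _]. eapply Cderiv_eq. now apply DF. simpl. ring.
  - rewrite <- El in *.
    destruct (classic (forall q, In q l -> q = p)) as [Hall|Hne].
    + assert (Eq : forall z, In z l <-> z = p). { intros z; split. apply Hall. intros ->. rewrite El; now left. }
      destruct (residue_one_pole U f p OU CU) as (r & F & DF).
      { eapply hol_sub; [|apply Hf]. intros z [H1 H2]. split; auto; now rewrite Eq. }
      exists ((p, r) :: nil). split.
      * intros pr [<-|[]]. rewrite El; now left.
      * exists F. intros z [H1 H2]. rewrite Eq in H2. eapply Cderiv_eq. apply DF. auto. simpl. ring.
    + assert (Hcut : exists (g : C -> R) (x y : C), is_part g /\ In x l /\ In y l /\ g x < g y).
      { apply not_all_ex_not in Hne. destruct Hne as (q & Hq). apply imply_to_and in Hq. destruct Hq as [Hq Nq].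
        assert (Hp : In p l) by (rewrite El; now left).
        destruct (Rtotal_order (Re p) (Re q)) as [Q|[Q|Q]].
        exists Re, p, q. auto using part_Re.
        destruct (Rtotal_order (Im p) (Im q)) as [Q'|[Q'|Q']].
        exists Im, p, q. auto using part_Im.
        exfalso. apply Nq. destruct p, q; simpl in *; subst; auto.
        exists Im, q, p. auto using part_Im.
        exists Re, q, p. auto using part_Re. }
      clear Hne. destruct Hcut as (g & px & py & Hg & Hx & Hy & Hxy).
      destruct (next_value g l (g px) py Hy Hxy) as (M & HM & Hgap).
      set (x := g px) in *.
      set (l1 := filter (fun z => Rleb (g z) x) l). set (l2 := filter (fun z => Rleb M (g z)) l).
      set (U1 := fun z => U z /\ g z < M). set (U2 := fun z => U z /\ x < g z).
      assert (O1 : Copen U1) by (apply Copen_and; auto; now apply open_part_lt).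
      assert (O2 : Copen U2) by (apply Copen_and; auto; now apply open_part_gt).
      assert (C1 : Cconvex U1) by (apply Cconvex_and; auto; now apply convex_part_lt).
      assert (C2 : Cconvex U2) by (apply Cconvex_and; auto; now apply convex_part_gt).
      assert (I1 : forall z, In z l1 <-> In z l /\ g z <= x).
      { intros z. unfold l1. rewrite filter_In, Rleb_true. tauto. }
      assert (I2 : forall z, In z l2 <-> In z l /\ M <= g z).
      { intros z. unfold l2. rewrite filter_In, Rleb_true. tauto. }
      assert (N1 : forall z, U1 z -> ~ In z l1 -> ~ In z l).
      { intros z [_ Hz] H1 H2. apply H1. apply I1. split; auto. destruct (Hgap z H2); lra. }
      assert (N2 : forall z, U2 z -> ~ In z l2 -> ~ In z l).
      { intros z [_ Hz] H1 H2. apply H1. apply I2. split; auto. destruct (Hgap z H2); lra. }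
      destruct (IH (length l1)) with (l := l1) (U := U1) (f := f) as (rs1 & R1 & F1 & D1); auto.
      { apply filter_length_lt with py; auto. apply Rleb_false. auto. }
      { eapply hol_sub; [|apply Hf]. intros z [H1 H2]. split. apply H1. now apply N1. }
      destruct (IH (length l2)) with (l := l2) (U := U2) (f := f) as (rs2 & R2 & F2 & D2); auto.
      { apply filter_length_lt with px; auto. apply Rleb_false. unfold x in *. lra. }
      { eapply hol_sub; [|apply Hf]. intros z [H1 H2]. split. apply H1. now apply N2. }
      destruct (convex_primitive U1 (principal_part rs2) O1 C1) as (P2 & DP2).
      { apply hol_principal_part. intros z pr [_ Hz] Hi ->. apply R2, I2 in Hi. lra. }
      destruct (convex_primitive U2 (principal_part rs1) O2 C2) as (P1 & DP1).
      { apply hol_principal_part. intros z pr [_ Hz] Hi ->. apply R1, I1 in Hi. lra. }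
      exists (rs1 ++ rs2). split.
      { intros pr Hi. apply in_app_or in Hi. destruct Hi as [Hi|Hi].
        apply R1, I1 in Hi; tauto. apply R2, I2 in Hi; tauto. }
      set (h := fun z => (f z - principal_part (rs1 ++ rs2) z)%C).
      set (V1 := fun z => U1 z /\ ~ In z l1). set (V2 := fun z => U2 z /\ ~ In z l2).
      assert (DG1 : forall z, V1 z -> Cderiv (fun y => F1 y - P2 y)%C z (h z)).
      { intros z Hz. eapply Cderiv_eq. apply Cderiv_minus. apply D1, Hz. apply DP2, Hz.
        unfold h. rewrite principal_part_app. ring. }
      assert (DG2 : forall z, V2 z -> Cderiv (fun y => F2 y - P1 y)%C z (h z)).
      { intros z Hz. eapply Cderiv_eq. apply Cderiv_minus. apply D2, Hz. apply DP1, Hz.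
        unfold h. rewrite principal_part_app. ring. }
      assert (V12 : forall z, U1 z -> U2 z -> V1 z /\ V2 z).
      { intros z H1 H2. split; split; auto; intros Hi.
        apply I1 in Hi. destruct H2; lra. apply I2 in Hi. destruct H1; lra. }
      destruct (primitives_differ_by_constant (fun z => U1 z /\ U2 z) h (fun y => F1 y - P2 y)%C (fun y => F2 y - P1 y)%C) as (c & Hc).
      { now apply Cconvex_and. }
      { intros z []; apply DG1, V12; auto. } { intros z []; apply DG2, V12; auto. }
      destruct (glue_primitives V1 V2 h (fun y => F1 y - P2 y)%C (fun y => F2 y - P1 y + c)%C) as (G & _ & _ & DG); auto.
      { apply Copen_and; auto. apply open_compl_list. } { apply Copen_and; auto. apply open_compl_list. }
      { intros z Hz. eapply Cderiv_eq. apply Cderiv_plus; [apply DG2, Hz|apply Cderiv_const]. ring. }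
      { intros z [H1 _] [H2 _]. apply Hc; auto. }
      exists G. intros z [Hz Hi]. apply DG. unfold V1, V2, U1, U2.
      destruct (Rlt_le_dec x (g z)) as [L|L].
      * right. repeat split; auto. rewrite I2. tauto.
      * left. repeat split; auto. lra. rewrite I1. tauto.
Qed.

(** * Limits of complex sequences *)

(** Convergence of a complex sequence. *)
Definition Cconv (u : nat -> C) (l : C) : Prop :=
  forall eps, 0 < eps -> exists N, forall n, (N <= n)%nat -> Cmod (u n - l)%C <= eps.

Lemma Cconv_Clim_seq u l : Cconv u l -> Clim_seq u = l.
Proof.
  intros H.
  assert (A : forall p, is_part p -> Lim_seq (fun n => p (u n)) = p l).
  { intros p Hp. apply is_lim_seq_unique, is_lim_seq_spec. intros [eps He]. simpl.
    destruct (H (eps/2)) as (N & HN). lra. exists N. intros n Hn.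
    rewrite <- part_sub by auto. eapply Rle_lt_trans; [apply part_le; auto|].
    specialize (HN n Hn). lra. }
  unfold Clim_seq. rewrite (A Re part_Re), (A Im part_Im). destruct l; reflexivity.
Qed.

Lemma Cconv_shift u l k : Cconv (fun n => u (k + n)%nat) l -> Cconv u l.
Proof.
  intros H eps He. destruct (H eps He) as (N & HN). exists (k + N)%nat. intros n Hn.
  replace n with (k + (n - k))%nat by lia. apply HN. lia.
Qed.

Lemma Cconv_ext u v l : (forall n, u n = v n) -> Cconv u l -> Cconv v l.
Proof. intros E H eps He. destruct (H eps He) as (N & HN). exists N. intros n Hn. rewrite <- E. auto. Qed.

Lemma Cconv_cont f u l : Ccont f l -> Cconv u l -> Cconv (fun n => f (u n)) (f l).
Proof.
  intros Hf H eps He. destruct (Hf eps He) as (d & Hd & Hh).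
  destruct (H (d/2)) as (N & HN). lra. exists N. intros n Hn. specialize (HN n Hn).
  replace (u n) with (l + (u n - l))%C by ring. apply Hh. lra.
Qed.

Lemma Cconv_minus u v l m : Cconv u l -> Cconv v m -> Cconv (fun n => (u n - v n)%C) (l - m)%C.
Proof.
  intros H H' eps He. destruct (H (eps/2)) as (N & HN). lra. destruct (H' (eps/2)) as (N' & HN'). lra.
  exists (N + N')%nat. intros n Hn.
  replace (u n - v n - (l - m))%C with ((u n - l) - (v n - m))%C by ring.
  eapply Rle_trans; [apply Cmod_triangle_sub|].
  assert (A := HN n ltac:(lia)). assert (B := HN' n ltac:(lia)). lra.
Qed.

Lemma Cconv_scal c u l : Cconv u l -> Cconv (fun n => (c * u n)%C) (c * l)%C.
Proof.
  intros H. apply (Cconv_cont (fun x => c * x)%C); auto.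
  apply (Ccont_mult (fun _ => c) (fun x => x)). apply Ccont_const. eapply Cderiv_cont, Cderiv_id.
Qed.

Lemma Cconv_le u l M : Cconv u l -> (forall n, Cmod (u n) <= M) -> Cmod l <= M.
Proof.
  intros H HM. apply le_epsilon. intros eps He. destruct (H eps He) as (N & HN).
  specialize (HN N (Nat.le_refl N)). rewrite Cmod_sub_comm in HN.
  assert (Q := Cmod_triangle (u N) (l - u N)%C). replace (u N + (l - u N))%C with l in Q by ring.
  specialize (HM N). lra.
Qed.

(** Completeness, for sequences with a rate of order [1 / n]. *)
Lemma Cconv_of_rate (u : nat -> C) (K : R) :
  (forall n m, (n <= m)%nat -> Cmod (u m - u n)%C <= K / INR (S n)) -> exists l, Cconv u l.
Proof.
  intros H.
  assert (HK : 0 <= K).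
  { assert (Q := H 0%nat 0%nat (Nat.le_refl 0)). assert (Q2 := Cmod_ge_0 (u 0%nat - u 0%nat)%C).
    simpl INR in Q. unfold Rdiv in Q. rewrite Rinv_1 in Q. lra. }
  assert (A : forall p, is_part p -> { x | Un_cv (fun n => p (u n)) x }).
  { intros p Hp. apply Rcomplete.R_complete. intros eps He.
    destruct (archimed_cor1 (eps / (2 * K + 1))) as (N & HN & HN0). apply Rdiv_lt_0_compat; lra.
    exists N. 
    assert (S1 : forall n, (n >= N)%nat -> Rabs (p (u n) - p (u N)) <= K * / INR N).
    { intros n Hn. rewrite <- part_sub by auto. eapply Rle_trans; [apply part_le; auto|].
      eapply Rle_trans; [apply H; lia|]. apply Rmult_le_compat_l; auto.
      apply Rinv_le_contravar. apply lt_0_INR; lia. apply le_INR; lia. }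
    intros n m Hn Hm. unfold R_dist.
    replace (p (u n) - p (u m)) with ((p (u n) - p (u N)) - (p (u m) - p (u N))) by ring.
    eapply Rle_lt_trans; [apply Rabs_triang|]. rewrite Rabs_Ropp.
    assert (Q1 := S1 n Hn). assert (Q2 := S1 m Hm).
    apply Rle_lt_trans with (2 * K * / INR N). lra.
    apply Rle_lt_trans with (2 * K * (eps / (2 * K + 1))). apply Rmult_le_compat_l; lra.
    apply Rlt_le_trans with ((2 * K + 1) * (eps / (2 * K + 1))).
    apply Rmult_lt_compat_r. apply Rdiv_lt_0_compat; lra. lra. right; field; lra. }
  destruct (A Re part_Re) as (x & Hx). destruct (A Im part_Im) as (y & Hy).
  exists (x, y). intros eps He.
  destruct (Hx (eps/2)) as (N & HN). lra. destruct (Hy (eps/2)) as (N' & HN'). lra.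
  exists (N + N')%nat. intros n Hn. eapply Rle_trans; [apply Cmod_le_add|].
  assert (B := HN n ltac:(lia)). assert (B' := HN' n ltac:(lia)). unfold R_dist in *.
  simpl. unfold Re, Im in *. unfold Rminus in *. lra.
Qed.

(** * Sums and products over squares of indices *)

(** The indices [(k, l)] with [0 <= k, l < n], as in the definition of the product. *)
Definition square (n : nat) : list (nat * nat) := list_prod (seq 0 n) (seq 0 n).

(** The indices added in passing from the square of size [n] to that of size [n + 1]:
    those with [max (k, l) = n]. *)
Definition shell (n : nat) : list (nat * nat) :=
  map (fun k => (k, n)) (seq 0 n) ++ map (fun l => (n, l)) (seq 0 (S n)).

Lemma list_prod_snoc (l : list nat) (l' : list nat) x :
  Permutation (list_prod l (l' ++ x :: nil)) (list_prod l l' ++ map (fun k => (k, x)) l).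
Proof.
  induction l as [|a l IH]; simpl; auto.
  rewrite map_app, <- !app_assoc. apply Permutation_app_head. simpl.
  rewrite (Permutation_cons_app _ _ _ IH). reflexivity.
Qed.

Lemma square_succ n : Permutation (square (S n)) (square n ++ shell n).
Proof.
  unfold square, shell. rewrite !seq_S at 1. simpl plus.
  assert (E : forall (l1 l2 l' : list nat), list_prod (l1 ++ l2) l' = list_prod l1 l' ++ list_prod l2 l').
  { intros l1 l2 l'. induction l1; simpl; auto. rewrite IHl1, app_assoc. reflexivity. }
  rewrite E. simpl. rewrite app_nil_r. rewrite list_prod_snoc, <- app_assoc.
  repeat apply Permutation_app_head. reflexivity.
Qed.

(** The sum of a list. *)
Definition Rsum (l : list R) : R := fold_right Rplus 0 l.
Definition Csum (l : list C) : C := fold_right Cplus (RtoC 0) l.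

Lemma Rsum_app l l' : Rsum (l ++ l') = Rsum l + Rsum l'.
Proof. induction l; simpl. lra. rewrite IHl. ring. Qed.

Lemma Cprod_app l l' : Cprod (l ++ l') = (Cprod l * Cprod l')%C.
Proof. induction l; simpl. symmetry; apply Cmult_1_l. rewrite IHl. apply Cmult_assoc. Qed.

Lemma Rsum_perm l l' : Permutation l l' -> Rsum l = Rsum l'.
Proof. induction 1; simpl; lra. Qed.

Lemma Cprod_perm l l' : Permutation l l' -> Cprod l = Cprod l'.
Proof. induction 1; simpl; auto. now rewrite IHPermutation. ring. congruence. Qed.

Lemma Rsum_square_succ (g : nat * nat -> R) n :
  Rsum (map g (square (S n))) = Rsum (map g (square n)) + Rsum (map g (shell n)).
Proof. rewrite (Rsum_perm _ _ (Permutation_map g (square_succ n))), map_app, Rsum_app. reflexivity. Qed.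

Lemma Cprod_square_succ (g : nat * nat -> C) n :
  Cprod (map g (square (S n))) = (Cprod (map g (square n)) * Cprod (map g (shell n)))%C.
Proof. rewrite (Cprod_perm _ _ (Permutation_map g (square_succ n))), map_app, Cprod_app. reflexivity. Qed.

Lemma Rsum_le {T} (f g : T -> R) l : (forall x, In x l -> f x <= g x) -> Rsum (map f l) <= Rsum (map g l).
Proof. induction l; simpl; intros H. lra. assert (Q := H a (or_introl eq_refl)). specialize (IHl (fun x Hx => H x (or_intror Hx))). lra. Qed.

Lemma Rsum_const {T} c (l : list T) : Rsum (map (fun _ => c) l) = INR (length l) * c.
Proof. induction l; [simpl; ring|]. change (length (a :: l)) with (S (length l)). rewrite S_INR. simpl map. simpl Rsum. rewrite IHl. ring. Qed.

Lemma Rsum_scal {T} c (f : T -> R) l : Rsum (map (fun x => c * f x) l) = c * Rsum (map f l).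
Proof. induction l; simpl; [|rewrite IHl]; ring. Qed.

Lemma Cmod_Csum_le {T} (f : T -> C) (g : T -> R) l : (forall x, In x l -> Cmod (f x) <= g x) ->
  Cmod (Csum (map f l)) <= Rsum (map g l).
Proof.
  induction l; simpl; intros H. rewrite Cmod_0; lra.
  eapply Rle_trans; [apply Cmod_triangle|]. apply Rplus_le_compat; auto.
Qed.

Lemma shell_length n : length (shell n) = (2 * n + 1)%nat.
Proof. unfold shell. rewrite length_app, !length_map, !length_seq. lia. Qed.

Lemma In_shell kl n : In kl (shell n) -> (fst kl = n /\ snd kl <= n)%nat \/ (snd kl = n /\ fst kl < n)%nat.
Proof.
  unfold shell. rewrite in_app_iff, !in_map_iff.
  intros [(k & <- & H)|(k & <- & H)]; apply in_seq in H; simpl; [right|left]; split; lia.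
Qed.

Section Lattice.
Variable tau : R.
Hypothesis Htau : 0 < tau.
Let c := Rmin tau 1.

Lemma lattice_min_pos : 0 < c.
Proof. apply Rmin_pos; lra. Qed.

(** On the shell of size [n] the lattice points are of order [n], and the shell has
    [2 n + 1] points; hence the bounds on the sums over shells. *)
Lemma lattice_shell_ge kl n : In kl (shell n) -> c * INR n <= lattice tau kl.
Proof.
  intros H. unfold lattice. assert (P1 := pos_INR (fst kl)). assert (P2 := pos_INR (snd kl)).
  assert (Q1 : c <= tau) by apply Rmin_l. assert (Q2 : c <= 1) by apply Rmin_r.
  destruct (In_shell _ _ H) as [[E _]|[E _]]; rewrite <- E; nra.
Qed.

Lemma shell_sum_inv_cube_le n : (1 <= n)%nat ->
  Rsum (map (fun kl => / (lattice tau kl ^ 3)) (shell n)) <= 3 / (c ^ 3 * INR n ^ 2).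
Proof.
  intros Hn. assert (P := lattice_min_pos). assert (Hn' : 1 <= INR n) by (apply (le_INR 1); auto).
  apply Rle_trans with (Rsum (map (fun _ => / ((c * INR n) ^ 3)) (shell n))).
  - apply Rsum_le. intros kl H. apply Rinv_le_contravar. apply pow_lt, Rmult_lt_0_compat; lra.
    apply pow_incr. split. apply Rmult_le_pos; lra. now apply lattice_shell_ge.
  - rewrite Rsum_const, shell_length, plus_INR, mult_INR. simpl (INR 2). simpl (INR 1).
    apply Rle_trans with ((3 * INR n) * / (c * INR n) ^ 3).
    apply Rmult_le_compat_r. apply Rlt_le, Rinv_0_lt_compat, pow_lt, Rmult_lt_0_compat; lra. lra.
    right. field. lra.
Qed.

Lemma shell_sum_inv_le n : (1 <= n)%nat ->
  Rsum (map (fun kl => / lattice tau kl) (shell n)) <= 3 / c.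
Proof.
  intros Hn. assert (P := lattice_min_pos). assert (Hn' : 1 <= INR n) by (apply (le_INR 1); auto).
  apply Rle_trans with (Rsum (map (fun _ => / (c * INR n)) (shell n))).
  - apply Rsum_le. intros kl H. apply Rinv_le_contravar. apply Rmult_lt_0_compat; lra. now apply lattice_shell_ge.
  - rewrite Rsum_const, shell_length, plus_INR, mult_INR. simpl (INR 2). simpl (INR 1).
    apply Rle_trans with ((3 * INR n) * / (c * INR n)).
    apply Rmult_le_compat_r. apply Rlt_le, Rinv_0_lt_compat, Rmult_lt_0_compat; lra. lra.
    right. field. lra.
Qed.

(** * The tail of the double product *)

(** The logarithm of the primary factor [(1 + u) exp (- u + u^2 / 2)]; it is of
    order [u^3]. *)
Definition log_factor (u : C) : C := (Clog (1 + u) - u + u * u / 2)%C.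

Lemma Re_1_plus_pos u : Cmod u <= 1 / 2 -> / 2 <= Re (1 + u)%C.
Proof. intros H. assert (Q := re_le_Cmod u). apply Rabs_le_between in Q. destruct u; simpl in *; lra. Qed.

Lemma Cmod_1_plus_ge u : Cmod u <= 1 / 2 -> / 2 <= Cmod (1 + u)%C.
Proof. intros H. assert (Q := Cmod_triangle_rev (RtoC 1) u). rewrite Cmod_1 in Q. lra. Qed.

Lemma Cexp_log_factor u : Cmod u <= 1 / 2 -> Cexp (log_factor u) = ((1 + u) * Cexp (- u + u * u / 2))%C.
Proof.
  intros H. assert (Q := Re_1_plus_pos u H). unfold log_factor.
  replace (Clog (1 + u) - u + u * u / 2)%C with (Clog (1 + u) + (- u + u * u / 2))%C by ring.
  rewrite Cexp_add, Cexp_Clog by lra. reflexivity.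
Qed.

Lemma log_factor_deriv u : Cmod u <= 1 / 2 -> Cderiv log_factor u (u * u / (1 + u))%C.
Proof.
  intros H. assert (Q := Re_1_plus_pos u H).
  assert (N : (1 + u)%C <> RtoC 0) by (apply neq_0_of_Re; lra).
  unfold log_factor. eapply Cderiv_eq.
  - apply (Cderiv_plus (fun v => Clog (1 + v) - v)%C (fun v => v * v / 2)%C).
    + apply (Cderiv_minus (fun v => Clog (1 + v))%C (fun v => v)); [|apply Cderiv_id].
      apply (Cderiv_comp Clog (fun v => 1 + v)%C). apply Cderiv_plus. apply Cderiv_const. apply Cderiv_id.
      apply Clog_deriv. right; lra.
    + apply (Cderiv_mult (fun v => v * v)%C (fun _ => / 2)%C). apply (Cderiv_mult (fun v => v) (fun v => v)); apply Cderiv_id. apply Cderiv_const.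
  - cbv beta. field. auto.
Qed.

Lemma Cmod_scal_le t u : 0 <= t <= 1 -> Cmod (RtoC t * u)%C <= Cmod u.
Proof. intros H. rewrite Cmod_mult, Cmod_R, Rabs_pos_eq by lra. assert (Q := Cmod_ge_0 u). nra. Qed.

Lemma log_factor_0 : log_factor (RtoC 0) = RtoC 0.
Proof. unfold log_factor. replace (1 + RtoC 0)%C with (RtoC 1) by ring. rewrite Clog_1. field. Qed.

Lemma log_factor_le u : Cmod u <= 1 / 2 -> Cmod (log_factor u) <= 4 * Cmod u ^ 3.
Proof.
  intros H. assert (Q := Cderiv_mean_value log_factor (fun u => u * u / (1 + u))%C (RtoC 0) u (RtoC 0) (2 * Cmod u ^ 2)).
  assert (P := Cmod_ge_0 u).
  replace (log_factor u) with (log_factor (RtoC 0 + u) - log_factor (RtoC 0) - RtoC 0 * u)%C.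
  2:{ rewrite log_factor_0. replace (RtoC 0 + u)%C with u by ring. ring. }
  eapply Rle_trans; [apply Q|right; ring].
  - intros t Ht. replace (RtoC 0 + RtoC t * u)%C with (RtoC t * u)%C by ring.
    apply log_factor_deriv. assert (Q2 := Cmod_scal_le t u Ht). lra.
  - intros t Ht. replace (RtoC 0 + RtoC t * u)%C with (RtoC t * u)%C by ring.
    assert (Q2 := Cmod_scal_le t u Ht). assert (Q3 := Cmod_ge_0 (RtoC t * u)%C).
    set (v := (RtoC t * u)%C) in *. assert (Q4 := Cmod_1_plus_ge v ltac:(lra)).
    replace (v * v / (1 + v) - RtoC 0)%C with (v * v / (1 + v))%C by ring.
    rewrite Cmod_div, Cmod_mult by (apply neq_0_of_Cmod; lra).
    apply Rle_trans with (Cmod u ^ 2 * / / 2). 2: rewrite Rinv_inv; lra.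
    apply Rmult_le_compat. nra. apply Rlt_le, Rinv_0_lt_compat; lra. nra.
    apply Rinv_le_contravar; lra.
Qed.

(** Since [u^2 / (1 + u) = u - 1 + 1 / (1 + u)], the difference factors through [u - v]. *)
Lemma log_factor_deriv_lip u v r : Cmod u <= r -> Cmod v <= r -> r <= 1 / 2 ->
  Cmod (u * u / (1 + u) - v * v / (1 + v))%C <= 10 * r * Cmod (u - v)%C.
Proof.
  intros Hu Hv Hr.
  assert (Q1 := Cmod_1_plus_ge u ltac:(lra)). assert (Q2 := Cmod_1_plus_ge v ltac:(lra)).
  assert (N1 : (1 + u)%C <> RtoC 0) by (apply neq_0_of_Cmod; lra).
  assert (N2 : (1 + v)%C <> RtoC 0) by (apply neq_0_of_Cmod; lra).
  assert (P1 := Cmod_ge_0 u). assert (P2 := Cmod_ge_0 v). assert (P3 := Cmod_ge_0 (u - v)%C).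
  replace (u * u / (1 + u) - v * v / (1 + v))%C with ((u - v) * ((u + v + u * v) / ((1 + u) * (1 + v))))%C by (field; auto).
  rewrite Cmod_mult, Rmult_comm. apply Rmult_le_compat_r; auto.
  rewrite Cmod_div, Cmod_mult by (apply Cmult_neq_0; auto).
  assert (T : Cmod (u + v + u * v)%C <= 5 / 2 * r).
  { eapply Rle_trans; [apply Cmod_triangle|]. rewrite Cmod_mult.
    assert (Q := Cmod_triangle u v). nra. }
  apply Rle_trans with (5 / 2 * r * / (/ 2 * / 2)). 2: right; field.
  apply Rmult_le_compat; auto. apply Cmod_ge_0. apply Rlt_le, Rinv_0_lt_compat. nra.
  apply Rinv_le_contravar; nra.
Qed.

Lemma barnes_factor_eq z kl : kl <> (0, 0)%nat ->
  barnes_factor tau z kl = ((1 + z / RtoC (lattice tau kl)) * Cexp (- (z / RtoC (lattice tau kl))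
    + (z / RtoC (lattice tau kl)) * (z / RtoC (lattice tau kl)) / 2))%C.
Proof.
  intros H. assert (P : RtoC (lattice tau kl) <> RtoC 0).
  { intros E. apply RtoC_inj in E. unfold lattice in E. destruct kl as [k l]; simpl in E.
    assert (P1 := pos_INR k). assert (P2 := pos_INR l).
    destruct k as [|k]; [destruct l as [|l]; [tauto|]|].
    rewrite S_INR in E. assert (P3 := pos_INR l). simpl in E. lra.
    rewrite S_INR in *. assert (P3 := pos_INR k). nra. }
  assert (E : (z * z / (2 * (RtoC (lattice tau kl) * RtoC (lattice tau kl))) =
     z / RtoC (lattice tau kl) * (z / RtoC (lattice tau kl)) / 2)%C) by (field; auto).
  destruct kl as [[|k] [|l]]; [tauto| | |]; unfold barnes_factor; rewrite E; reflexivity.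
Qed.
End Lattice.

(** The sum of the first [N] terms. *)
Fixpoint partial_sum (b : nat -> C) (N : nat) : C :=
  match N with O => RtoC 0 | S N' => (partial_sum b N' + b N')%C end.

(** Terms of order [1 / n^2], compared with [1 / n - 1 / (n + 1)]. *)
Lemma partial_sum_rate (b : nat -> C) (K : R) (n0 : nat) : (1 <= n0)%nat -> 0 <= K ->
  (forall i, Cmod (b i) <= K / INR (n0 + i) ^ 2) ->
  forall n m, (n <= m)%nat -> Cmod (partial_sum b m - partial_sum b n)%C <= 2 * K / INR (n0 + n).
Proof.
  intros H0 HK Hb.
  assert (A : forall n m, (n <= m)%nat ->
    Cmod (partial_sum b m - partial_sum b n)%C <= 2 * K * (/ INR (n0 + n) - / INR (n0 + m))).
  { intros n m Hnm. induction Hnm as [|m Hnm IH].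
    - replace (partial_sum b n - partial_sum b n)%C with (RtoC 0) by ring. rewrite Cmod_0. lra.
    - simpl. replace (partial_sum b m + b m - partial_sum b n)%C with ((partial_sum b m - partial_sum b n) + b m)%C by ring.
      eapply Rle_trans; [apply Cmod_triangle|].
      assert (Q : 1 <= INR (n0 + m)) by (apply (le_INR 1); lia).
      apply Rle_trans with (2 * K * (/ INR (n0 + n) - / INR (n0 + m)) + 2 * K * (/ INR (n0 + m) - / INR (n0 + S m))).
      2: right; ring.
      apply Rplus_le_compat; auto. eapply Rle_trans; [apply Hb|].
      replace (n0 + S m)%nat with (S (n0 + m)) by lia. rewrite S_INR. set (x := INR (n0 + m)) in *.
      replace (2 * K * (/ x - / (x + 1))) with (K * (2 / (x * (x + 1)))) by (field; lra).
      unfold Rdiv. apply Rmult_le_compat_l; auto.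
      apply Rle_trans with (2 * / (2 * x ^ 2)). right; field; lra.
      apply Rmult_le_compat_l. lra. apply Rinv_le_contravar; nra. }
  intros n m Hnm. eapply Rle_trans; [apply A; auto|]. unfold Rdiv.
  apply Rmult_le_compat_l. lra.
  assert (0 < / INR (n0 + m)). { apply Rinv_0_lt_compat, lt_0_INR. lia. } lra.
Qed.

Lemma partial_sum_conv (b : nat -> C) (K : R) (n0 : nat) : (1 <= n0)%nat -> 0 <= K ->
  (forall i, Cmod (b i) <= K / INR (n0 + i) ^ 2) ->
  exists l, Cconv (partial_sum b) l /\ Cmod l <= 2 * K / INR n0.
Proof.
  intros H0 HK Hb. assert (A := partial_sum_rate b K n0 H0 HK Hb).
  destruct (Cconv_of_rate (partial_sum b) (2 * K)) as (l & Hl).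
  - intros n m Hnm. eapply Rle_trans; [apply A; auto|]. apply Rmult_le_compat_l. lra.
    apply Rinv_le_contravar. apply lt_0_INR; lia. apply le_INR; lia.
  - exists l. split; auto. apply Cconv_le with (partial_sum b); auto.
    intros n. assert (Q := A 0%nat n ltac:(lia)). rewrite Nat.add_0_r in Q. simpl in Q.
    replace (partial_sum b n - RtoC 0)%C with (partial_sum b n) in Q by ring. auto.
Qed.

Lemma partial_sum_minus b b' N :
  (partial_sum b N - partial_sum b' N)%C = partial_sum (fun i => (b i - b' i)%C) N.
Proof. induction N; simpl. ring. rewrite <- IHN. ring. Qed.

Lemma partial_sum_scal c b N : (c * partial_sum b N)%C = partial_sum (fun i => (c * b i)%C) N.
Proof. induction N; simpl. ring. rewrite <- IHN. ring. Qed.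

Lemma Csum_minus {T} (f g : T -> C) l : (Csum (map f l) - Csum (map g l))%C = Csum (map (fun x => (f x - g x)%C) l).
Proof. induction l; simpl. ring. rewrite <- IHl. ring. Qed.

Lemma Csum_scal {T} k (f : T -> C) l : (k * Csum (map f l))%C = Csum (map (fun x => (k * f x)%C) l).
Proof. induction l; simpl. ring. rewrite <- IHl. ring. Qed.

Lemma Cprod_Cexp {T} (f : T -> C) l : Cprod (map (fun x => Cexp (f x)) l) = Cexp (Csum (map f l)).
Proof. induction l; simpl. symmetry; apply Cexp_0. rewrite IHl, Cexp_add. reflexivity. Qed.

Section Tail.
Variables (tau R0 : R) (n0 : nat).
Let c := Rmin tau 1.
Hypotheses (Htau : 0 < tau) (HR : 0 < R0) (Hn0 : (1 <= n0)%nat) (Hbig : 2 * R0 <= c * INR n0).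

Let c_pos : 0 < c := lattice_min_pos tau Htau.

(** The logarithm of the product over one shell, and its derivative. *)
Definition tail_term (i : nat) (z : C) : C :=
  Csum (map (fun kl => log_factor (z / RtoC (lattice tau kl))) (shell (n0 + i))).

Definition tail_deriv_term (i : nat) (z : C) : C :=
  Csum (map (fun kl => let u := (z / RtoC (lattice tau kl))%C in
    (u * u / (1 + u) * / RtoC (lattice tau kl))%C) (shell (n0 + i))).

Let tail_lattice kl i : In kl (shell (n0 + i)) -> 2 * R0 <= lattice tau kl /\ 0 < lattice tau kl.
Proof.
  intros H. assert (Q := lattice_shell_ge tau Htau kl _ H). fold c in Q.
  assert (P := c_pos). rewrite plus_INR in Q. assert (P2 := pos_INR i).
  assert (c * INR n0 <= lattice tau kl). { eapply Rle_trans; [|apply Q]. nra. } lra.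
Qed.

Let tail_div kl i z : In kl (shell (n0 + i)) ->
  Cmod (z / RtoC (lattice tau kl))%C = Cmod z * / lattice tau kl.
Proof.
  intros H. destruct (tail_lattice kl i H) as [_ P].
  rewrite Cmod_div, Cmod_R, Rabs_pos_eq by (try (intros E; apply RtoC_inj in E); lra). reflexivity.
Qed.

Let tail_half kl i z : In kl (shell (n0 + i)) -> Cmod z <= R0 ->
  Cmod (z / RtoC (lattice tau kl))%C <= R0 * / lattice tau kl /\ R0 * / lattice tau kl <= 1 / 2.
Proof.
  intros H Hz. destruct (tail_lattice kl i H) as [Q P]. rewrite (tail_div kl i z H). split.
  apply Rmult_le_compat_r; auto. left; now apply Rinv_0_lt_compat.
  apply Rmult_le_reg_r with (lattice tau kl); auto. rewrite Rmult_assoc, Rinv_l by lra. lra.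
Qed.

(* All terms of the tail are bounded by a multiple of the inverse cube of the
   lattice point. *)
Let sum_bound (f : nat * nat -> C) (K : R) i : 0 <= K ->
  (forall kl, In kl (shell (n0 + i)) -> Cmod (f kl) <= K * / lattice tau kl ^ 3) ->
  Cmod (Csum (map f (shell (n0 + i)))) <= (3 * K / c ^ 3) / INR (n0 + i) ^ 2.
Proof.
  intros HK H. assert (P := c_pos). assert (Q : 1 <= INR (n0 + i)) by (apply (le_INR 1); lia).
  eapply Rle_trans; [apply Cmod_Csum_le; apply H|].
  rewrite Rsum_scal. apply Rle_trans with (K * (3 / (c ^ 3 * INR (n0 + i) ^ 2))).
  apply Rmult_le_compat_l; auto. apply shell_sum_inv_cube_le; auto. lia.
  right. field. lra.
Qed.

Lemma tail_term_le i z : Cmod z <= R0 -> Cmod (tail_term i z) <= (3 * (4 * R0 ^ 3) / c ^ 3) / INR (n0 + i) ^ 2.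
Proof.
  intros Hz. apply sum_bound. assert (0 < R0 ^ 3) by (apply pow_lt; lra). lra.
  intros kl H. destruct (tail_half kl i z H Hz) as [A B]. destruct (tail_lattice kl i H) as [_ P].
  eapply Rle_trans; [apply log_factor_le; lra|]. assert (Q := Cmod_ge_0 (z / RtoC (lattice tau kl))%C).
  apply Rle_trans with (4 * (R0 * / lattice tau kl) ^ 3).
  apply Rmult_le_compat_l. lra. apply pow_incr. lra. right. field. lra.
Qed.

Lemma tail_deriv_term_lip i z z' : Cmod z <= R0 -> Cmod z' <= R0 ->
  Cmod (tail_deriv_term i z - tail_deriv_term i z')%C <=
  (3 * (10 * R0 * Cmod (z - z')%C) / c ^ 3) / INR (n0 + i) ^ 2.
Proof.
  intros Hz Hz'. unfold tail_deriv_term. rewrite Csum_minus. apply sum_bound.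
  assert (Q := Cmod_ge_0 (z - z')%C). nra.
  intros kl H. cbv zeta. destruct (tail_half kl i z H Hz) as [A B]. destruct (tail_half kl i z' H Hz') as [A' B'].
  destruct (tail_lattice kl i H) as [_ P].
  set (w := RtoC (lattice tau kl)) in *.
  assert (Nw : w <> RtoC 0). { intros E. apply RtoC_inj in E. lra. }
  replace (z / w * (z / w) / (1 + z / w) * / w - z' / w * (z' / w) / (1 + z' / w) * / w)%C with
    ((z / w * (z / w) / (1 + z / w) - z' / w * (z' / w) / (1 + z' / w)) * / w)%C by ring.
  assert (Ew : Cmod w = lattice tau kl) by (unfold w; rewrite Cmod_R, Rabs_pos_eq; lra).
  rewrite Cmod_mult, Cmod_inv, Ew by auto.
  assert (L := log_factor_deriv_lip _ _ _ A A' B).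
  replace (z / w - z' / w)%C with ((z - z') / w)%C in L by (field; auto).
  assert (Td := tail_div kl i (z - z')%C H). fold w in Td. rewrite Td in L.
  apply Rle_trans with (10 * (R0 * / lattice tau kl) * (Cmod (z - z')%C * / lattice tau kl) * / lattice tau kl).
  apply Rmult_le_compat_r; auto. left; now apply Rinv_0_lt_compat. right; field; lra.
Qed.

Lemma tail_deriv_term_0 i : tail_deriv_term i (RtoC 0) = RtoC 0.
Proof.
  unfold tail_deriv_term. induction (shell (n0 + i)) as [|kl l IH]; simpl; auto.
  rewrite IH. unfold Cdiv. ring.
Qed.

Lemma tail_deriv_term_le i z : Cmod z <= R0 ->
  Cmod (tail_deriv_term i z) <= (3 * (10 * R0 * R0) / c ^ 3) / INR (n0 + i) ^ 2.
Proof.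
  intros Hz. assert (Q := tail_deriv_term_lip i z (RtoC 0) Hz). rewrite Cmod_0, tail_deriv_term_0 in Q.
  replace (tail_deriv_term i z - RtoC 0)%C with (tail_deriv_term i z) in Q by ring.
  replace (z - RtoC 0)%C with z in Q by ring. eapply Rle_trans; [apply Q; lra|].
  assert (P := c_pos). assert (P1 : 1 <= INR (n0 + i)) by (apply (le_INR 1); lia).
  unfold Rdiv. apply Rmult_le_compat_r. apply Rlt_le, Rinv_0_lt_compat, pow_lt; lra.
  apply Rmult_le_compat_r. apply Rlt_le, Rinv_0_lt_compat, pow_lt; lra. nra.
Qed.

Lemma tail_term_taylor i z h : Cmod z <= R0 -> Cmod (z + h)%C <= R0 ->
  Cmod (tail_term i (z + h) - tail_term i z - tail_deriv_term i z * h)%C <=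
  (3 * (20 * R0 * Cmod h ^ 2) / c ^ 3) / INR (n0 + i) ^ 2.
Proof.
  intros Hz Hzh.
  assert (Q := Cmod_ge_0 h).
  unfold tail_term, tail_deriv_term. rewrite Csum_minus. rewrite Cmult_comm, Csum_scal, Csum_minus.
  apply sum_bound. apply Rmult_le_pos. lra. nra.
  intros kl H. cbv zeta.
  destruct (tail_lattice kl i H) as [_ P].
  set (w := RtoC (lattice tau kl)) in *.
  assert (Nw : w <> RtoC 0). { intros E. apply RtoC_inj in E. lra. }
  assert (Seg : forall t, 0 <= t <= 1 -> Cmod (z + RtoC t * h)%C <= R0).
  { intros t Ht. replace (z + RtoC t * h)%C with (RtoC (1 - t) * z + RtoC t * (z + h))%C by (rewrite RtoC_minus; ring).
    eapply Rle_trans; [apply Cmod_triangle|]. rewrite !Cmod_mult, !Cmod_R, !Rabs_pos_eq by lra. nra. }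
  set (k := (h / w)%C).
  assert (Ek : forall t, (z / w + RtoC t * k = (z + RtoC t * h) / w)%C) by (intros t; unfold k; field; auto).
  assert (MV := Cderiv_mean_value log_factor (fun u => u * u / (1 + u))%C (z / w)%C k (z / w * (z / w) / (1 + z / w))%C
    (10 * (R0 * / lattice tau kl) * Cmod k)).
  replace ((z + h) / w)%C with (z / w + k)%C by (unfold k; field; auto).
  replace (h * (z / w * (z / w) / (1 + z / w) * / w))%C with (z / w * (z / w) / (1 + z / w) * k)%C by (unfold k; unfold Cdiv; ring).
  eapply Rle_trans; [apply MV|].
  - intros t Ht. rewrite Ek. apply log_factor_deriv. destruct (tail_half kl i _ H (Seg t Ht)) as [A B]. fold w in A. lra.
  - intros t Ht. rewrite Ek. destruct (tail_half kl i _ H (Seg t Ht)) as [A B]. destruct (tail_half kl i z H Hz) as [A' B'].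
    eapply Rle_trans; [apply (log_factor_deriv_lip _ _ _ A A' B)|].
    replace ((z + RtoC t * h) / RtoC (lattice tau kl) - z / RtoC (lattice tau kl))%C with (RtoC t * k)%C.
    2:{ unfold k. fold w. field. auto. }
    apply Rmult_le_compat_l. apply Rmult_le_pos. lra. apply Rmult_le_pos. lra. left; now apply Rinv_0_lt_compat.
    now apply Cmod_scal_le.
  - assert (Td := tail_div kl i h H). fold w in Td. unfold k. rewrite Td. right. field. lra.
Qed.

(** The logarithm of the product outside the square of size [n0], and its derivative;
    both are meaningful on the disc of radius [R0]. *)
Definition tail_sum (z : C) : C := Clim_seq (partial_sum (fun i => tail_term i z)).
Definition tail_deriv (z : C) : C := Clim_seq (partial_sum (fun i => tail_deriv_term i z)).

Let const_pos K : 0 <= K -> 0 <= 3 * K / c ^ 3.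
Proof. intros H. assert (P := c_pos). apply Rmult_le_pos. lra. apply Rlt_le, Rinv_0_lt_compat, pow_lt; lra. Qed.

Lemma tail_sum_conv z : Cmod z <= R0 -> Cconv (partial_sum (fun i => tail_term i z)) (tail_sum z) /\
  Cmod (tail_sum z) <= 2 * (3 * (4 * R0 ^ 3) / c ^ 3) / INR n0.
Proof.
  intros Hz. destruct (partial_sum_conv (fun i => tail_term i z) (3 * (4 * R0 ^ 3) / c ^ 3) n0) as (l & Hl & Hle); auto.
  apply const_pos. assert (0 < R0 ^ 3) by (apply pow_lt; lra). lra.
  intros i. now apply tail_term_le.
  unfold tail_sum. rewrite (Cconv_Clim_seq _ _ Hl). auto.
Qed.

Lemma tail_deriv_conv z : Cmod z <= R0 -> Cconv (partial_sum (fun i => tail_deriv_term i z)) (tail_deriv z).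
Proof.
  intros Hz. destruct (partial_sum_conv (fun i => tail_deriv_term i z) (3 * (10 * R0 * R0) / c ^ 3) n0) as (l & Hl & Hle); auto.
  apply const_pos. nra.
  intros i. now apply tail_deriv_term_le.
  unfold tail_deriv. rewrite (Cconv_Clim_seq _ _ Hl). auto.
Qed.

Lemma tail_sum_taylor z h : Cmod z <= R0 -> Cmod (z + h)%C <= R0 ->
  Cmod (tail_sum (z + h) - tail_sum z - tail_deriv z * h)%C <= 2 * (3 * (20 * R0 * Cmod h ^ 2) / c ^ 3) / INR n0.
Proof.
  intros Hz Hzh.
  destruct (partial_sum_conv (fun i => tail_term i (z + h) - tail_term i z - h * tail_deriv_term i z)%C (3 * (20 * R0 * Cmod h ^ 2) / c ^ 3) n0) as (l & Hl & Hle); auto.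
  - apply const_pos. assert (0 <= Cmod h ^ 2) by (apply pow2_ge_0). nra.
  - intros i. rewrite (Cmult_comm h). now apply tail_term_taylor.
  - replace (tail_sum (z + h) - tail_sum z - tail_deriv z * h)%C with l; auto.
    rewrite <- (Cconv_Clim_seq _ _ Hl). apply Cconv_Clim_seq.
    apply Cconv_ext with (fun N => partial_sum (fun i => tail_term i (z + h)) N - partial_sum (fun i => tail_term i z) N
       - h * partial_sum (fun i => tail_deriv_term i z) N)%C.
    intros N. now rewrite partial_sum_scal, !partial_sum_minus.
    rewrite (Cmult_comm _ h).
    apply Cconv_minus. apply Cconv_minus; now apply tail_sum_conv. apply Cconv_scal. now apply tail_deriv_conv.
Qed.

Lemma tail_deriv_lip z z' : Cmod z <= R0 -> Cmod z' <= R0 ->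
  Cmod (tail_deriv z - tail_deriv z')%C <= 2 * (3 * (10 * R0 * Cmod (z - z')%C) / c ^ 3) / INR n0.
Proof.
  intros Hz Hz'.
  destruct (partial_sum_conv (fun i => tail_deriv_term i z - tail_deriv_term i z')%C (3 * (10 * R0 * Cmod (z - z')%C) / c ^ 3) n0) as (l & Hl & Hle); auto.
  - apply const_pos. assert (Q := Cmod_ge_0 (z - z')%C). nra.
  - intros i. now apply tail_deriv_term_lip.
  - replace (tail_deriv z - tail_deriv z')%C with l; auto.
    rewrite <- (Cconv_Clim_seq _ _ Hl). apply Cconv_Clim_seq.
    apply Cconv_ext with (fun N => partial_sum (fun i => tail_deriv_term i z) N - partial_sum (fun i => tail_deriv_term i z') N)%C.
    intros N. now rewrite partial_sum_minus.
    apply Cconv_minus; now apply tail_deriv_conv.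
Qed.

(** The second order Taylor estimate, being uniform in the partial sums, passes to
    the limit and gives the derivative of the sum without any theorem on uniform
    convergence. *)
Lemma hol_tail_sum : hol (fun z => Cmod z < R0) tail_sum.
Proof.
  assert (P := c_pos). assert (Pn : 1 <= INR n0) by (apply (le_INR 1); lia).
  exists tail_deriv. intros z Hz.
  set (K := 2 * (3 * (20 * R0) / c ^ 3) / INR n0).
  assert (HK : 0 < K). { unfold K. apply Rdiv_lt_0_compat; [|lra]. apply Rmult_lt_0_compat. lra. apply Rdiv_lt_0_compat; [lra|apply pow_lt; lra]. }
  assert (In : forall h, Cmod h < R0 - Cmod z -> Cmod (z + h)%C <= R0).
  { intros h Hh. eapply Rle_trans; [apply Cmod_triangle|]. lra. }
  split; intros eps He.
  - exists (Rmin (R0 - Cmod z) (eps / K)). split. apply Rmin_pos. lra. apply Rdiv_lt_0_compat; lra.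
    intros h Hh.
    assert (L1 : Cmod h < R0 - Cmod z) by (eapply Rlt_le_trans; [apply Hh|apply Rmin_l]).
    assert (L2 : Cmod h < eps / K) by (eapply Rlt_le_trans; [apply Hh|apply Rmin_r]).
    eapply Rle_trans; [apply tail_sum_taylor; [lra|auto]|].
    replace (2 * (3 * (20 * R0 * Cmod h ^ 2) / c ^ 3) / INR n0) with (K * Cmod h * Cmod h) by (unfold K; field; lra).
    apply Rmult_le_compat_r. apply Cmod_ge_0.
    apply Rle_trans with (K * (eps / K)). apply Rmult_le_compat_l; lra. right; field; lra.
  - exists (Rmin (R0 - Cmod z) (eps / K)). split. apply Rmin_pos. lra. apply Rdiv_lt_0_compat; lra.
    intros h Hh.
    assert (L1 : Cmod h < R0 - Cmod z) by (eapply Rlt_le_trans; [apply Hh|apply Rmin_l]).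
    assert (L2 : Cmod h < eps / K) by (eapply Rlt_le_trans; [apply Hh|apply Rmin_r]).
    eapply Rle_trans; [apply tail_deriv_lip; [auto|lra]|].
    replace (z + h - z)%C with h by ring.
    apply Rle_trans with (K * Cmod h).
    + apply Rle_trans with (/2 * (K * Cmod h)). right. unfold K; field; lra.
      assert (Q := Cmod_ge_0 h). assert (0 <= K * Cmod h) by (apply Rmult_le_pos; lra). lra.
    + apply Rle_trans with (K * (eps / K)). apply Rmult_le_compat_l; lra. right; field; lra.
Qed.

Lemma shell_product i z : Cmod z <= R0 ->
  Cprod (map (barnes_factor tau z) (shell (n0 + i))) = Cexp (tail_term i z).
Proof.
  intros Hz. unfold tail_term. rewrite <- Cprod_Cexp. f_equal. apply map_ext_in. intros kl H.
  destruct (tail_half kl i z H Hz) as [A B].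
  rewrite Cexp_log_factor by lra. apply barnes_factor_eq; auto.
  intros ->. destruct (In_shell _ _ H) as [[E _]|[E _]]; simpl in E; lia.
Qed.

(** On the disc of radius [R0] the double product is a finite product times the
    exponential of the tail. *)
Theorem barnes_product_eq z : Cmod z <= R0 ->
  barnes_product tau z = (Cprod (map (barnes_factor tau z) (square n0)) * Cexp (tail_sum z))%C.
Proof.
  intros Hz. apply Cconv_Clim_seq. apply Cconv_shift with n0.
  apply Cconv_ext with (fun N => Cprod (map (barnes_factor tau z) (square n0)) * Cexp (partial_sum (fun i => tail_term i z) N))%C.
  - intros N. fold (square (n0 + N)). induction N; simpl.
    + rewrite Nat.add_0_r, Cexp_0. ring.
    + rewrite Nat.add_succ_r, Cprod_square_succ, <- IHN, shell_product, Cexp_add by auto. ring.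
  - apply Cconv_scal. apply (Cconv_cont Cexp). eapply Cderiv_cont, Cderiv_Cexp. now apply tail_sum_conv.
Qed.

End Tail.

(** Holomorphy is local; the local derivatives are patched by choice. *)
Lemma hol_local D f : (forall z, D z -> exists V, Copen V /\ V z /\ hol V f) -> hol D f.
Proof.
  intros H. exists (fun z => epsilon (inhabits (RtoC 0)) (fun l => Cderiv f z l)).
  assert (E : forall V f', (forall z, V z -> Cderiv f z (f' z) /\ Ccont f' z) ->
    forall y, V y -> f' y = epsilon (inhabits (RtoC 0)) (fun l => Cderiv f y l)).
  { intros V f' Hf' y Hy. apply Cderiv_unique with f y. now apply Hf'.
    apply (epsilon_spec (inhabits (RtoC 0)) (fun l => Cderiv f y l)). eexists. now apply Hf'. }
  intros z Hz. destruct (H z Hz) as (V & OV & Vz & f' & Hf').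
  destruct (OV z Vz) as (r & Hr & HrV). split.
  - rewrite <- (E V f' Hf' z Vz). now apply Hf'.
  - apply Ccont_ext_loc with f' r; auto. intros y Hy. apply E with V; auto. now apply Hf'.
Qed.

Lemma hol_ext_on D f g : Copen D -> (forall z, D z -> f z = g z) -> hol D f -> hol D g.
Proof.
  intros OD E (f' & H). exists f'. intros z Hz. destruct (H z Hz) as [A B]. split; auto.
  destruct (OD z Hz) as (r & Hr & HrD). apply Cderiv_ext_loc with f r; auto.
Qed.

Lemma Copen_ball z0 r : Copen (fun z => Cmod (z - z0)%C < r).
Proof.
  intros z Hz. exists (r - Cmod (z - z0)%C). split. lra. intros y Hy.
  replace (y - z0)%C with ((y - z) + (z - z0))%C by ring.
  eapply Rle_lt_trans; [apply Cmod_triangle|]. lra.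
Qed.

Lemma Copen_disc r : Copen (fun z => Cmod z < r).
Proof.
  apply Copen_ext with (fun z => Cmod (z - RtoC 0)%C < r). 2: apply Copen_ball.
  intros z. replace (z - RtoC 0)%C with z by ring. tauto.
Qed.

Lemma Cconvex_disc r : Cconvex (fun z => Cmod z < r).
Proof.
  intros z w t Hz Hw Ht.
  replace (z + RtoC t * (w - z))%C with (RtoC (1 - t) * z + RtoC t * w)%C by (rewrite RtoC_minus; ring).
  eapply Rle_lt_trans; [apply Cmod_triangle|]. rewrite !Cmod_mult, !Cmod_R, !Rabs_pos_eq by lra.
  destruct (Req_dec t 0); nra.
Qed.

Section Barnes.
Variable tau : R.
Hypothesis Htau : 0 < tau.
Let c := Rmin tau 1.
Let c_pos : 0 < c := lattice_min_pos tau Htau.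

(* A size of square adapted to the disc of radius [r]: outside this square
   [|z| <= w / 2], and the size is still of order [r]. *)
Let square_size r : 0 < r -> exists n, (1 <= n)%nat /\ 2 * r <= c * INR n /\ INR n <= 2 * r / c + 1.
Proof.
  intros Hr. assert (P := c_pos). assert (0 < 2 * r / c) by (apply Rdiv_lt_0_compat; lra).
  destruct (nfloor_ex (2 * r / c)) as (n & Hn). lra.
  exists (S n). rewrite S_INR. repeat split. lia. 2: lra.
  apply Rle_trans with (c * (2 * r / c)). right; field; lra. apply Rmult_le_compat_l; lra.
Qed.

Lemma hol_barnes_factor D kl : hol D (fun z => barnes_factor tau z kl).
Proof.
  destruct (classic (kl = (0, 0)%nat)) as [->|N].
  - simpl. apply hol_const.
  - apply hol_ext with (fun z => ((1 + z * / RtoC (lattice tau kl)) * Cexp (- (z * / RtoC (lattice tau kl))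
    + (z * / RtoC (lattice tau kl)) * (z * / RtoC (lattice tau kl)) * / 2))%C).
    { intros z. rewrite barnes_factor_eq; auto. }
    assert (H : hol D (fun z => (z * / RtoC (lattice tau kl))%C)).
    { apply hol_mult. apply hol_id. apply hol_const. }
    apply (hol_mult D (fun z => 1 + z * / RtoC (lattice tau kl))%C).
    + apply (hol_plus D (fun _ => RtoC 1)); auto. apply hol_const.
    + apply hol_Cexp. apply hol_plus. now apply hol_opp.
      apply (hol_mult D (fun z => z * / RtoC (lattice tau kl) * (z * / RtoC (lattice tau kl)))%C (fun _ => / 2)%C).
      now apply hol_mult. apply hol_const.
Qed.

Lemma hol_Cprod {T} D (f : T -> C -> C) l : (forall x, In x l -> hol D (f x)) -> hol D (fun z => Cprod (map (fun x => f x z) l)).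
Proof.
  induction l as [|x l IH]; simpl; intros H. apply hol_const.
  apply (hol_mult D (f x)); auto.
Qed.

Lemma hol_barnes_product D : hol D (barnes_product tau).
Proof.
  apply hol_local. intros z _.
  set (r := Cmod z + 1). assert (Hr : 0 < r) by (assert (Q := Cmod_ge_0 z); unfold r; lra).
  destruct (square_size r Hr) as (n & H1 & H2 & _).
  exists (fun y => Cmod y < r). repeat split. apply Copen_disc. unfold r; lra.
  apply hol_ext_on with (fun z => Cprod (map (barnes_factor tau z) (square n)) * Cexp (tail_sum tau n z))%C.
  apply Copen_disc.
  - intros y Hy. symmetry. apply barnes_product_eq with r; auto. lra.
  - apply hol_mult. apply (hol_Cprod _ (fun kl z => barnes_factor tau z kl)). intros; apply hol_barnes_factor.
    apply hol_Cexp. apply hol_tail_sum; auto.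
Qed.

Lemma hol_double_gamma D : hol D (double_gamma tau).
Proof.
  unfold double_gamma, barnes_form. destruct (barnes_constants tau) as [c1 c2]. simpl fst; simpl snd.
  apply (hol_mult D (fun z => z / RtoC tau * Cexp (RtoC c1 * z / RtoC tau + RtoC c2 * (z * z) / RtoC (2 * tau ^ 2)))%C);
    [|apply hol_barnes_product].
  apply (hol_mult D (fun z => z / RtoC tau)%C). apply (hol_mult D (fun z => z)). apply hol_id. apply hol_const.
  apply hol_Cexp. apply (hol_plus D (fun z => RtoC c1 * z / RtoC tau)%C).
  - apply (hol_mult D (fun z => RtoC c1 * z)%C). apply (hol_mult D (fun _ => RtoC c1)). apply hol_const. apply hol_id. apply hol_const.
  - apply (hol_mult D (fun z => RtoC c2 * (z * z))%C). apply (hol_mult D (fun _ => RtoC c2)). apply hol_const.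
    apply (hol_mult D (fun z => z)); apply hol_id. apply hol_const.
Qed.

Lemma lattice_pos kl : kl <> (0, 0)%nat -> 0 < lattice tau kl.
Proof.
  destruct kl as [k l]. unfold lattice; simpl. intros N. assert (P1 := pos_INR k). assert (P2 := pos_INR l).
  destruct k as [|k]. destruct l as [|l]. tauto. rewrite S_INR. assert (Q := pos_INR l). simpl. lra.
  rewrite S_INR. assert (Q := pos_INR k). nra.
Qed.

Lemma barnes_factor_neq_0 z kl : (kl <> (0, 0)%nat -> z <> RtoC (- lattice tau kl)) -> barnes_factor tau z kl <> RtoC 0.
Proof.
  intros H. destruct (classic (kl = (0, 0)%nat)) as [->|N].
  - simpl. intros E. apply RtoC_inj in E. lra.
  - rewrite barnes_factor_eq by auto. apply Cmult_neq_0; [|apply Cexp_neq_0].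
    assert (P := lattice_pos kl N). assert (Nw : RtoC (lattice tau kl) <> RtoC 0) by (intros E; apply RtoC_inj in E; lra).
    intros E. apply (H N). rewrite RtoC_opp.
    replace z with (- RtoC (lattice tau kl) + (1 + z / RtoC (lattice tau kl)) * RtoC (lattice tau kl))%C by (field; auto).
    rewrite E. ring.
Qed.

Lemma Cprod_neq_0 {T} (f : T -> C) l : (forall x, In x l -> f x <> RtoC 0) -> Cprod (map f l) <> RtoC 0.
Proof.
  induction l; simpl; intros H. intros E; apply RtoC_inj in E; lra. apply Cmult_neq_0; auto.
Qed.

(** The zeros of the double gamma function are at most the points [- (k tau + l)]. *)
Lemma double_gamma_neq_0 z : (forall k l : nat, z <> RtoC (- (INR k * tau + INR l))) -> double_gamma tau z <> RtoC 0.
Proof.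
  intros H. unfold double_gamma, barnes_form.
  assert (Hr : 0 < Cmod z + 1) by (assert (Q := Cmod_ge_0 z); lra).
  destruct (square_size _ Hr) as (n & H1 & H2 & _).
  rewrite (barnes_product_eq tau (Cmod z + 1) n) by (auto; lra).
  repeat apply Cmult_neq_0; try apply Cexp_neq_0.
  - specialize (H 0%nat 0%nat). simpl in H. replace (- (0 * tau + 0)) with 0 in H by ring. auto.
  - intros E. assert (RtoC tau * / RtoC tau = RtoC 0)%C by (rewrite E; ring).
    rewrite Cinv_r in H0. apply RtoC_inj in H0; lra. intros E'. apply RtoC_inj in E'. lra.
  - apply Cprod_neq_0. intros [k l] _. apply barnes_factor_neq_0. intros _. apply H.
Qed.

(** * Growth of the double gamma function *)

Lemma Rsum_seq_succ (f : nat -> R) m : Rsum (map f (seq 0 (S m))) = Rsum (map f (seq 0 m)) + f m.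
Proof. rewrite seq_S, map_app, Rsum_app. simpl. ring. Qed.

(** Comparison with the telescoping sum of [1 / (x (x + d))] over [x = k d + x0]. *)
Lemma sum_inv_square_progression (d x0 : R) (m : nat) : 0 < d -> 0 < x0 ->
  Rabs (Rsum (map (fun k => / (INR k * d + x0) ^ 2) (seq 0 m)) - / d * (/ x0 - / (INR m * d + x0))) <= INR m * (d / x0 ^ 3).
Proof.
  intros Hd Hx. induction m as [|m IH].
  - simpl. replace (0 * d + x0) with x0 by ring. replace (0 - / d * (/ x0 - / x0)) with 0 by ring. rewrite Rabs_R0. lra.
  - rewrite Rsum_seq_succ, S_INR.
    set (x := INR m * d + x0) in *. assert (P := pos_INR m). assert (Hxx : x0 <= x) by (unfold x; nra).
    replace ((INR m + 1) * d + x0) with (x + d) by (unfold x; ring).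
    replace (Rsum (map (fun k => / (INR k * d + x0) ^ 2) (seq 0 m)) + / x ^ 2 - / d * (/ x0 - / (x + d)))
      with ((Rsum (map (fun k => / (INR k * d + x0) ^ 2) (seq 0 m)) - / d * (/ x0 - / x)) + d * / (x ^ 2 * (x + d))).
    2:{ replace (/ x ^ 2) with (/ d * (/ x - / (x + d)) + d * / (x ^ 2 * (x + d))). ring. field. lra. }
    eapply Rle_trans; [apply Rabs_triang|].
    replace ((INR m + 1) * (d / x0 ^ 3)) with (INR m * (d / x0 ^ 3) + d * / x0 ^ 3) by (field; lra).
    apply Rplus_le_compat; auto. rewrite Rabs_pos_eq.
    + apply Rmult_le_compat_l. lra. apply Rinv_le_contravar. apply pow_lt; lra.
      apply Rle_trans with (x ^ 3). apply pow_incr; lra.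
      assert (0 <= x ^ 2) by apply pow2_ge_0. nra.
    + apply Rmult_le_pos. lra. apply Rlt_le, Rinv_0_lt_compat. apply Rmult_lt_0_compat. apply pow_lt; lra. lra.
Qed.

Let KS := tau + / tau ^ 3 + 1.

(** The two sides of the shell contribute [1 / ((1 + tau) j)] and
    [1 / (tau (1 + tau) j)], whose sum is [1 / (tau j)]. *)
Lemma shell_sum_inv_square j : (1 <= j)%nat ->
  Rabs (Rsum (map (fun kl => / lattice tau kl ^ 2) (shell j)) - / (tau * INR j)) <= KS / INR j ^ 2.
Proof.
  intros Hj. assert (Q : 1 <= INR j) by (apply (le_INR 1); auto). set (x := INR j) in *.
  unfold shell. rewrite map_app, Rsum_app, !map_map, (Rsum_seq_succ (fun l => / lattice tau (j, l) ^ 2)).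
  rewrite (map_ext (fun k => / lattice tau (k, j) ^ 2) (fun k => / (INR k * tau + x) ^ 2)) by (intros; reflexivity).
  rewrite (map_ext (fun l => / lattice tau (j, l) ^ 2) (fun k => / (INR k * 1 + x * tau) ^ 2)).
  2:{ intros l. unfold lattice. simpl fst; simpl snd. f_equal. f_equal. fold x. ring. }
  assert (Hxt : 0 < x * tau) by nra.
  assert (A1 := sum_inv_square_progression tau x j Htau ltac:(lra)).
  assert (A2 := sum_inv_square_progression 1 (x * tau) j ltac:(lra) Hxt). fold x in A1, A2.
  set (S1 := Rsum (map (fun k => / (INR k * tau + x) ^ 2) (seq 0 j))) in *.
  set (S2 := Rsum (map (fun k => / (INR k * 1 + x * tau) ^ 2) (seq 0 j))) in *.
  set (T := / lattice tau (j, j) ^ 2).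
  assert (HT : 0 <= T <= / x ^ 2).
  { unfold T, lattice. simpl fst; simpl snd. fold x. assert (E : x <= x * tau + x) by nra. split.
    apply Rlt_le, Rinv_0_lt_compat. nra.
    apply Rinv_le_contravar; nra. }
  replace (S1 + (S2 + T) - / (tau * x)) with
    ((S1 - / tau * (/ x - / (x * tau + x))) + (S2 - / 1 * (/ (x * tau) - / (x * 1 + x * tau))) + T) by (field; lra).
  eapply Rle_trans; [apply Rabs_triang|]. eapply Rle_trans; [apply Rplus_le_compat_r, Rabs_triang|].
  rewrite (Rabs_pos_eq T) by lra.
  replace (KS / x ^ 2) with (x * (tau / x ^ 3) + x * (1 / (x * tau) ^ 3) + / x ^ 2) by (unfold KS; field; lra).
  lra.
Qed.

Lemma square_1 (g : nat * nat -> R) : Rsum (map g (square 1)) = g (0, 0)%nat.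
Proof. simpl. ring. Qed.

Lemma lattice_00 : lattice tau (0, 0)%nat = 0.
Proof. unfold lattice; simpl; ring. Qed.

(** The index [(0, 0)] contributes [/ 0 = 0]. *)
Lemma square_sum_inv n : (1 <= n)%nat -> Rsum (map (fun kl => / lattice tau kl) (square n)) <= 3 / c * INR n.
Proof.
  intros Hn. assert (P := c_pos). assert (P3 : 0 < 3 / c) by (apply Rdiv_lt_0_compat; lra). induction Hn as [|n Hn IH].
  - rewrite square_1, lattice_00, Rinv_0. simpl. lra.
  - rewrite Rsum_square_succ, S_INR. assert (Q := shell_sum_inv_le tau Htau n Hn). fold c in Q. lra.
Qed.

Lemma ln_succ_bounds x : 1 <= x -> / (x + 1) <= ln (x + 1) - ln x <= / x.
Proof.
  intros Hx. split.
  - assert (Q : exp (- / (x + 1)) >= x / (x + 1)).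
    { replace (x / (x + 1)) with (1 + - / (x + 1)) by (field; lra). apply Rle_ge, exp_ineq1_le. }
    assert (E : ln (x / (x + 1)) <= - / (x + 1)).
    { rewrite <- (ln_exp (- / (x + 1))). apply ln_le. apply Rdiv_lt_0_compat; lra. lra. }
    unfold Rdiv in E. rewrite ln_mult, ln_Rinv in E by (try apply Rinv_0_lt_compat; lra). lra.
  - assert (Q : x * exp (/ x) >= x + 1).
    { assert (A := exp_ineq1_le (/ x)). replace (x + 1) with (x * (1 + / x)) by (field; lra). nra. }
    assert (E : ln (x + 1) <= ln (x * exp (/ x))) by (apply ln_le; lra).
    rewrite ln_mult, ln_exp in E by (try apply exp_pos; lra). lra.
Qed.

(** The sum of the inverse squares of the lattice points is [ln n / tau + O(1)]. This
    is where the leading term of the growth of the double gamma function comes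
    from. *)
Lemma square_sum_inv_square n : (1 <= n)%nat ->
  Rabs (Rsum (map (fun kl => / lattice tau kl ^ 2) (square n)) - / tau * ln (INR n)) <= 2 * (KS + / tau) * (1 - / INR n).
Proof.
  intros Hn. assert (Pt : 0 < / tau) by now apply Rinv_0_lt_compat.
  assert (PK : 0 < KS). { unfold KS. assert (0 < / tau ^ 3) by (apply Rinv_0_lt_compat, pow_lt; auto). lra. }
  induction Hn as [|n Hn IH].
  - rewrite square_1, lattice_00. simpl (INR 1). rewrite ln_1. replace (0 ^ 2) with 0 by ring. rewrite Rinv_0, Rinv_1.
    replace (0 - / tau * 0) with 0 by ring. rewrite Rabs_R0. lra.
  - rewrite Rsum_square_succ, S_INR. assert (Q : 1 <= INR n) by (apply (le_INR 1); auto).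
    assert (A := shell_sum_inv_square n Hn). assert (B := ln_succ_bounds (INR n) Q).
    set (x := INR n) in *. set (s := Rsum (map (fun kl => / lattice tau kl ^ 2) (square n))) in *.
    set (t := Rsum (map (fun kl => / lattice tau kl ^ 2) (shell n))) in *.
    assert (E : Rabs (/ (tau * x) - / tau * (ln (x + 1) - ln x)) <= / tau * / x ^ 2).
    { replace (/ (tau * x) - / tau * (ln (x + 1) - ln x)) with (/ tau * (/ x - (ln (x + 1) - ln x))) by (field; lra).
      rewrite Rabs_mult, (Rabs_pos_eq (/ tau)) by lra. apply Rmult_le_compat_l. lra.
      rewrite Rabs_pos_eq by lra. apply Rle_trans with (/ x - / (x + 1)). lra.
      replace (/ x - / (x + 1)) with (/ (x * (x + 1))) by (field; lra). apply Rinv_le_contravar; nra. }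
    replace (s + t - / tau * ln (x + 1)) with ((s - / tau * ln x) + (t - / (tau * x)) + (/ (tau * x) - / tau * (ln (x + 1) - ln x))) by ring.
    eapply Rle_trans; [apply Rabs_triang|]. eapply Rle_trans; [apply Rplus_le_compat_r, Rabs_triang|].
    assert (F : (KS + / tau) * / x ^ 2 <= 2 * (KS + / tau) * (/ x - / (x + 1))).
    { replace (2 * (KS + / tau) * (/ x - / (x + 1))) with ((KS + / tau) * (2 * / (x * (x + 1)))) by (field; lra).
      apply Rmult_le_compat_l. lra. apply Rle_trans with (2 * / (2 * x ^ 2)). right; field; lra.
      apply Rmult_le_compat_l. lra. apply Rinv_le_contravar; nra. }
    unfold Rdiv in A. lra.
Qed.

Lemma square_length n : length (square n) = (n * n)%nat.
Proof. unfold square. now rewrite length_prod, length_seq. Qed.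

Lemma ln_ge_0 x : 1 <= x -> 0 <= ln x.
Proof. intros H. rewrite <- ln_1. apply ln_le; lra. Qed.

Lemma ln_le_sub1 x : 0 < x -> ln x <= x - 1.
Proof.
  intros H. assert (Q := exp_ineq1_le (x - 1)). rewrite <- (ln_exp (x - 1)). apply ln_le; lra.
Qed.

(** Away from the real axis [|1 + z / w|] is bounded below, so that the logarithm of a
    factor is [Re z^2 / (2 w^2)] up to a bounded multiple of [|z| / w] and a constant. *)
Lemma ln_barnes_factor z kappa kl : 0 < kappa <= 1 -> 0 < Cmod z -> kappa * Cmod z <= Rabs (Im z) ->
  0 < Cmod (barnes_factor tau z kl) /\
  Rabs (ln (Cmod (barnes_factor tau z kl)) - Re (z * z)%C / 2 * / lattice tau kl ^ 2)
    <= 2 * Cmod z * / lattice tau kl + ln (2 / kappa).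
Proof.
  intros Hk Hz Him.
  assert (HL : 0 <= ln (2 / kappa)).
  { apply ln_ge_0. apply Rmult_le_reg_r with kappa. lra. unfold Rdiv. rewrite Rmult_assoc, Rinv_l; lra. }
  destruct (classic (kl = (0, 0)%nat)) as [->|N].
  - simpl barnes_factor. rewrite Cmod_1, ln_1, lattice_00. replace (0 ^ 2) with 0 by ring. rewrite Rinv_0.
    replace (0 - Re (z * z)%C / 2 * 0) with 0 by ring. rewrite Rabs_R0. lra.
  - assert (P := lattice_pos kl N). rewrite barnes_factor_eq by auto.
    set (w := lattice tau kl) in *. assert (Nw : RtoC w <> RtoC 0) by (intros E; apply RtoC_inj in E; lra).
    set (u := (z / RtoC w)%C).
    assert (Eu : Cmod u = Cmod z * / w). { unfold u. rewrite Cmod_div, Cmod_R, Rabs_pos_eq by (auto; lra). reflexivity. }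
    assert (Lo : kappa / 2 <= Cmod (1 + u)%C).
    { destruct (Rle_lt_dec (Cmod u) (1 / 2)) as [L|L].
      - assert (Q := Cmod_1_plus_ge u L). lra.
      - eapply Rle_trans; [|apply Im_le_Cmod].
        replace (Im (1 + u)%C) with (Im z * / w).
        + rewrite Rabs_mult, (Rabs_pos_eq (/ w)) by (left; now apply Rinv_0_lt_compat).
          apply Rle_trans with (kappa * Cmod z * / w). rewrite Rmult_assoc, <- Eu. nra.
          apply Rmult_le_compat_r; auto. left; now apply Rinv_0_lt_compat.
        + unfold u. destruct z as [x y]. unfold Cdiv, Cinv, Cmult, Cplus, RtoC, Im. simpl. field. lra. }
    assert (Pos : 0 < Cmod (1 + u)%C) by lra.
    rewrite Cmod_mult, Cmod_Cexp. split. apply Rmult_lt_0_compat; auto. apply exp_pos.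
    rewrite ln_mult, ln_exp by (auto; apply exp_pos).
    replace (Re (- u + u * u / 2)%C) with (- Re u + Re (z * z)%C / 2 * / w ^ 2).
    2:{ unfold u. destruct z as [x y]. unfold Cdiv, Cinv, Cmult, Cplus, Copp, RtoC, Re. simpl. field. lra. }
    replace (ln (Cmod (1 + u)%C) + (- Re u + Re (z * z)%C / 2 * / w ^ 2) - Re (z * z)%C / 2 * / w ^ 2)
      with (ln (Cmod (1 + u)%C) - Re u) by ring.
    assert (R1 := re_le_Cmod u). apply Rabs_le_between in R1.
    assert (U1 : ln (Cmod (1 + u)%C) <= Cmod u).
    { assert (T := Cmod_triangle (RtoC 1) u). rewrite Cmod_1 in T. assert (L := ln_le_sub1 _ Pos). lra. }
    assert (U2 : - ln (2 / kappa) <= ln (Cmod (1 + u)%C)).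
    { rewrite <- ln_Rinv by (apply Rdiv_lt_0_compat; lra). apply ln_le. apply Rinv_0_lt_compat, Rdiv_lt_0_compat; lra.
      replace (/ (2 / kappa)) with (kappa / 2) by (field; lra). lra. }
    rewrite Rmult_assoc, <- Eu. assert (PU := Cmod_ge_0 u). apply Rabs_le. lra.
Qed.

Lemma ln_Cprod_le {T} (f : T -> C) (g e : T -> R) l :
  (forall x, In x l -> 0 < Cmod (f x) /\ Rabs (ln (Cmod (f x)) - g x) <= e x) ->
  0 < Cmod (Cprod (map f l)) /\ Rabs (ln (Cmod (Cprod (map f l))) - Rsum (map g l)) <= Rsum (map e l).
Proof.
  induction l as [|a l IH]; simpl; intros H.
  - rewrite Cmod_1, ln_1, Rminus_0_r, Rabs_R0. lra.
  - destruct IH as [P1 P2]; auto. destruct (H a (or_introl eq_refl)) as [Q1 Q2].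
    rewrite Cmod_mult. split. now apply Rmult_lt_0_compat. rewrite ln_mult by auto.
    replace (ln (Cmod (f a)) + ln (Cmod (Cprod (map f l))) - (g a + Rsum (map g l)))
      with ((ln (Cmod (f a)) - g a) + (ln (Cmod (Cprod (map f l))) - Rsum (map g l))) by ring.
    eapply Rle_trans; [apply Rabs_triang|]. lra.
Qed.

Lemma Rsum_plus {T} (f g : T -> R) l : Rsum (map (fun x => f x + g x) l) = Rsum (map f l) + Rsum (map g l).
Proof. induction l; simpl; [|rewrite IHl]; ring. Qed.

(** The growth of the double gamma function in a double sector around the imaginary
    axis, [ln |G z| = Re z^2 ln |z| / (2 tau) + O(|z|^2)]. The product is cut at a square
    whose size is of order [|z|]: inside, the terms [Re z^2 / (2 w^2)] sum up to the main
    term and the others to [O(|z|^2)]; the tail is [O(|z|^2)] as well. *)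
Theorem double_gamma_growth kappa : 0 < kappa ->
  exists K, 0 <= K /\ forall z, 1 <= Cmod z -> kappa * Cmod z <= Rabs (Im z) ->
    0 < Cmod (double_gamma tau z) /\
    Rabs (ln (Cmod (double_gamma tau z)) - Re (z * z)%C / (2 * tau) * ln (Cmod z)) <= K * Cmod z ^ 2.
Proof.
  intros Hk0. assert (Pc := c_pos). assert (Pc1 : c <= 1) by apply Rmin_r.
  unfold double_gamma, barnes_form. destruct (barnes_constants tau) as [c1 c2]. simpl fst; simpl snd.
  set (A := 2 / c + 1). assert (HA : 1 <= A). { unfold A. assert (0 < 2 / c) by (apply Rdiv_lt_0_compat; lra). lra. }
  set (KS2 := 2 * (KS + / tau)).
  set (K1 := 1 + Rabs (ln tau)). set (K2 := Rabs c1 / tau + Rabs c2 / (2 * tau ^ 2)).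
  set (K3 := 2 * (3 / c) * A + ln (2 / kappa) * A ^ 2). set (K4 := KS2 + / tau * ln A).
  set (K5 := 2 * (3 * 4 / c ^ 3)).
  exists (Rabs K1 + Rabs K2 + Rabs K3 + Rabs K4 + Rabs K5). split.
  { repeat apply Rplus_le_le_0_compat; apply Rabs_pos. }
  intros z Hz Him. set (r := Cmod z) in *.
  assert (Hk : kappa <= 1). { assert (Q := Im_le_Cmod z). fold r in Q. nra. }
  assert (Hr : 0 < r) by lra.
  destruct (square_size r Hr) as (n & Hn1 & Hn2 & Hn3).
  assert (Qn : 1 <= INR n) by (apply (le_INR 1); auto).
  assert (HnA : INR n <= A * r). { unfold A. eapply Rle_trans; [apply Hn3|]. unfold Rdiv. nra. }
  assert (Hnr : r <= INR n) by nra.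
  rewrite (barnes_product_eq tau r n) by (auto; unfold r; lra).
  destruct (tail_sum_conv tau r n Htau Hr Hn1 Hn2 z ltac:(unfold r; lra)) as [_ Htail].
  destruct (ln_Cprod_le (barnes_factor tau z) (fun kl => Re (z * z)%C / 2 * / lattice tau kl ^ 2)
    (fun kl => 2 * Cmod z * / lattice tau kl + ln (2 / kappa)) (square n)) as [Pp Hp].
  { intros kl _. apply ln_barnes_factor; auto. }
  rewrite Rsum_scal, Rsum_plus, Rsum_scal, Rsum_const, square_length, mult_INR in Hp. fold r in Hp.
  assert (S1 := square_sum_inv n Hn1). assert (S2 := square_sum_inv_square n Hn1).
  assert (Ntau : RtoC tau <> RtoC 0) by (intros E; apply RtoC_inj in E; lra).
  assert (Pz : 0 < Cmod (z / RtoC tau)%C).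
  { rewrite Cmod_div, Cmod_R, Rabs_pos_eq by (auto; lra). fold r. apply Rdiv_lt_0_compat; lra. }
  rewrite !Cmod_mult, !Cmod_Cexp.
  set (P := Cmod (Cprod (map (barnes_factor tau z) (square n)))) in *.
  set (q := (RtoC c1 * z / RtoC tau + RtoC c2 * (z * z) / RtoC (2 * tau ^ 2))%C).
  split. { repeat apply Rmult_lt_0_compat; auto; apply exp_pos. }
  rewrite !ln_mult, !ln_exp by (repeat apply Rmult_lt_0_compat; auto; apply exp_pos).
  assert (r2 : r <= r ^ 2) by nra.
  assert (B1 : Rabs (ln (Cmod (z / RtoC tau)%C)) <= Rabs K1 * r ^ 2).
  { rewrite Cmod_div, Cmod_R, (Rabs_pos_eq tau) by (auto; lra). fold r.
    unfold Rdiv. rewrite ln_mult, ln_Rinv by (try apply Rinv_0_lt_compat; lra).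
    assert (L := ln_le_sub1 r Hr). assert (L' := ln_ge_0 r Hz).
    eapply Rle_trans; [apply Rabs_triang|]. rewrite Rabs_Ropp, (Rabs_pos_eq (ln r)) by lra.
    assert (PP := Rabs_pos (ln tau)).
    rewrite (Rabs_pos_eq K1) by (unfold K1; lra). unfold K1. nra. }
  assert (B2 : Rabs (Re q) <= Rabs K2 * r ^ 2).
  { eapply Rle_trans; [apply re_le_Cmod|]. unfold q. eapply Rle_trans; [apply Cmod_triangle|].
    assert (N2 : 0 < 2 * tau ^ 2) by (assert (0 < tau ^ 2) by (apply pow_lt; auto); lra).
    rewrite !Cmod_div, !Cmod_mult, !Cmod_R by (try (intros E; apply RtoC_inj in E); lra). fold r.
    rewrite (Rabs_pos_eq tau), (Rabs_pos_eq (2 * tau ^ 2)) by lra.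
    assert (X1 : 0 <= Rabs c1 / tau). { apply Rmult_le_pos. apply Rabs_pos. left; now apply Rinv_0_lt_compat. }
    assert (X2 : 0 <= Rabs c2 / (2 * tau ^ 2)). { apply Rmult_le_pos. apply Rabs_pos. left; now apply Rinv_0_lt_compat. }
    rewrite (Rabs_pos_eq K2) by (unfold K2; lra). unfold K2.
    replace (Rabs c1 * r / tau) with (Rabs c1 / tau * r) by (unfold Rdiv; ring).
    replace (Rabs c2 * (r * r) / (2 * tau ^ 2)) with (Rabs c2 / (2 * tau ^ 2) * r ^ 2) by (unfold Rdiv; ring).
    nra. }
  assert (B5 : Rabs (Re (tail_sum tau n z)) <= Rabs K5 * r ^ 2).
  { eapply Rle_trans; [apply re_le_Cmod|]. eapply Rle_trans; [apply Htail|]. fold c.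
    assert (0 < / c ^ 3) by (apply Rinv_0_lt_compat, pow_lt; auto).
    rewrite (Rabs_pos_eq K5) by (unfold K5, Rdiv; nra). unfold K5.
    apply Rle_trans with (2 * (3 * (4 * r ^ 3) / c ^ 3) / r).
    - unfold Rdiv. apply Rmult_le_compat_l. assert (0 < r ^ 3) by (apply pow_lt; auto). nra. apply Rinv_le_contravar; lra.
    - right. field. lra. }
  assert (HLk : 0 <= ln (2 / kappa)).
  { apply ln_ge_0. apply Rmult_le_reg_r with kappa. lra. unfold Rdiv. rewrite Rmult_assoc, Rinv_l; lra. }
  set (S2v := Rsum (map (fun kl => / lattice tau kl ^ 2) (square n))) in *.
  assert (B3 : Rabs (ln P - Re (z * z)%C / 2 * S2v) <= Rabs K3 * r ^ 2).
  { eapply Rle_trans; [apply Hp|].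
    assert (X : 0 < 3 / c) by (apply Rdiv_lt_0_compat; lra).
    rewrite (Rabs_pos_eq K3).
    2:{ unfold K3. apply Rplus_le_le_0_compat; apply Rmult_le_pos; try apply pow2_ge_0; nra. }
    unfold K3.
    apply Rle_trans with (2 * r * (3 / c * (A * r)) + ln (2 / kappa) * (A * r) ^ 2).
    - apply Rplus_le_compat. apply Rmult_le_compat_l. lra. eapply Rle_trans; [apply S1|]. apply Rmult_le_compat_l; lra.
      rewrite Rmult_comm. apply Rmult_le_compat_l; auto. nra.
    - right; ring. }
  assert (HRe : Rabs (Re (z * z)%C) <= r ^ 2).
  { eapply Rle_trans; [apply re_le_Cmod|]. rewrite Cmod_mult. fold r. lra. }
  assert (PKS : 0 < KS). { unfold KS. assert (0 < / tau ^ 3) by (apply Rinv_0_lt_compat, pow_lt; auto). lra. }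
  assert (Pt : 0 < / tau) by now apply Rinv_0_lt_compat.
  assert (B4 : Rabs (Re (z * z)%C / 2 * S2v - Re (z * z)%C / (2 * tau) * ln r) <= Rabs K4 * r ^ 2).
  { replace (Re (z * z)%C / 2 * S2v - Re (z * z)%C / (2 * tau) * ln r) with
      (Re (z * z)%C * (/ 2 * (S2v - / tau * ln r))) by (field; lra).
    rewrite Rabs_mult, Rmult_comm. apply Rmult_le_compat; auto using Rabs_pos.
    assert (LA : 0 <= ln A) by now apply ln_ge_0.
    assert (Ln : 0 <= ln (INR n) - ln r <= ln A).
    { split. assert (ln r <= ln (INR n)) by (apply ln_le; lra). lra.
      assert (ln (INR n) <= ln (A * r)) by (apply ln_le; lra). rewrite ln_mult in H by lra. lra. }
    rewrite Rabs_mult, (Rabs_pos_eq (/ 2)) by lra.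
    replace (S2v - / tau * ln r) with ((S2v - / tau * ln (INR n)) + / tau * (ln (INR n) - ln r)) by ring.
    assert (Pn : 0 < / INR n) by (apply Rinv_0_lt_compat; lra).
    assert (T : Rabs ((S2v - / tau * ln (INR n)) + / tau * (ln (INR n) - ln r)) <= KS2 + / tau * ln A).
    { eapply Rle_trans; [apply Rabs_triang|]. rewrite (Rabs_pos_eq (/ tau * _)) by (apply Rmult_le_pos; lra).
      apply Rplus_le_compat. eapply Rle_trans; [apply S2|]. unfold KS2. nra. apply Rmult_le_compat_l; lra. }
    fold K4 in T. assert (X := Rle_abs K4). assert (Y := Rabs_pos ((S2v - / tau * ln (INR n)) + / tau * (ln (INR n) - ln r))). lra. }
  replace (ln (Cmod (z / RtoC tau)%C) + Re q + (ln P + Re (tail_sum tau n z)) - Re (z * z)%C / (2 * tau) * ln r)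
    with (ln (Cmod (z / RtoC tau)%C) + Re q + (ln P - Re (z * z)%C / 2 * S2v)
      + (Re (z * z)%C / 2 * S2v - Re (z * z)%C / (2 * tau) * ln r) + Re (tail_sum tau n z)) by ring.
  repeat (eapply Rle_trans; [apply Rabs_triang|]; rewrite ?Rmult_plus_distr_r; apply Rplus_le_compat; auto).
Qed.

End Barnes.

(** * Growth of the integrand *)

Section Phi.
Variables (tau : R) (kappa : R).
Hypotheses (Htau : 0 < tau) (Hkappa : 0 < kappa).

(** The main term of [ln |G s|]. *)
Definition main_term (s : C) : R := Re (s * s)%C / (2 * tau) * ln (Cmod s).

(** [ln |g s| = x main_term s + O(|s|^2)] at infinity, in the double sector
    [kappa |s| <= |Im s|]. *)
Definition grows_like (g : C -> C) (x : R) : Prop :=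
  exists K R0, 0 <= K /\ 1 <= R0 /\ forall s, R0 <= Cmod s -> kappa * Cmod s <= Rabs (Im s) ->
    0 < Cmod (g s) /\ Rabs (ln (Cmod (g s)) - x * main_term s) <= K * Cmod s ^ 2.

Lemma grows_like_double_gamma (b : C) (sg : R) : sg = 1 \/ sg = -1 ->
  grows_like (fun s => double_gamma tau (b + RtoC sg * s)%C) 1.
Proof.
  intros Hsg. destruct (double_gamma_growth tau Htau (kappa / 4)) as (K & HK & H). lra.
  set (B := Cmod b). assert (PB : 0 <= B) by apply Cmod_ge_0.
  exists (4 * K + 6 * B / (2 * tau) + ln 2 / (2 * tau)), (2 + 2 * B / kappa + 2 * B).
  assert (PBk : 0 <= B / kappa) by (apply Rmult_le_pos; [auto|left; now apply Rinv_0_lt_compat]).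
  assert (PBt : 0 <= 6 * B / (2 * tau)) by (apply Rmult_le_pos; [lra|left; apply Rinv_0_lt_compat; lra]).
  assert (Pl2 : 0 <= ln 2) by (apply ln_ge_0; lra).
  assert (Plt : 0 <= ln 2 / (2 * tau)) by (apply Rmult_le_pos; [lra|left; apply Rinv_0_lt_compat; lra]).
  split; [lra|]. split. { unfold Rdiv in *. lra. }
  intros s Hs Him. set (r := Cmod s) in *.
  assert (Hr : 2 <= r) by (unfold Rdiv in *; lra).
  set (z := (b + RtoC sg * s)%C).
  assert (Es : Cmod (RtoC sg * s)%C = r).
  { rewrite Cmod_mult, Cmod_R. destruct Hsg as [-> | ->]; unfold Rabs; destruct Rcase_abs; fold r; lra. }
  assert (Hz1 : Cmod z <= 2 * r). { unfold z. eapply Rle_trans; [apply Cmod_triangle|]. rewrite Es. fold B. unfold Rdiv in *; lra. }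
  assert (Hz2 : r / 2 <= Cmod z).
  { unfold z. rewrite Cplus_comm. eapply Rle_trans; [|apply Cmod_triangle_rev]. rewrite Es. fold B. unfold Rdiv in *; lra. }
  assert (Himz : kappa / 4 * Cmod z <= Rabs (Im z)).
  { apply Rle_trans with (kappa * r - B).
    - assert (2 * (B / kappa) * kappa <= r * kappa) by (apply Rmult_le_compat_r; unfold Rdiv in *; lra).
      replace (2 * (B / kappa) * kappa) with (2 * B) in H0 by (field; lra). nra.
    - replace (Im z) with (Im b + sg * Im s) by (unfold z; destruct b, s; simpl; ring).
      assert (Q := Im_le_Cmod b). fold B in Q.
      assert (T := Rabs_triang (Im b + sg * Im s) (- Im b)).
      replace (Im b + sg * Im s + - Im b) with (sg * Im s) in T by ring.
      rewrite Rabs_Ropp, Rabs_mult in T. replace (Rabs sg) with 1 in T.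
      2:{ destruct Hsg as [-> | ->]; unfold Rabs; destruct Rcase_abs; lra. } lra. }
  destruct (H z ltac:(lra) Himz) as [Hpos Hbd]. fold z. split; auto.
  assert (Pz : 0 < Cmod z) by lra.
  replace (ln (Cmod (double_gamma tau z)) - 1 * main_term s) with
    ((ln (Cmod (double_gamma tau z)) - Re (z * z)%C / (2 * tau) * ln (Cmod z))
     + (Re (z * z)%C - Re (s * s)%C) * ln (Cmod z) / (2 * tau)
     + Re (s * s)%C * (ln (Cmod z) - ln r) / (2 * tau)) by (unfold main_term; fold r; field; lra).
  eapply Rle_trans; [apply Rabs_triang|]. eapply Rle_trans; [apply Rplus_le_compat_r, Rabs_triang|].
  rewrite !Rmult_plus_distr_r.
  assert (Lz : 0 <= ln (Cmod z) <= 2 * r).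
  { split. apply ln_ge_0; lra. assert (L := ln_le_sub1 (Cmod z) Pz). lra. }
  assert (It : 0 < / (2 * tau)) by (apply Rinv_0_lt_compat; lra).
  apply Rplus_le_compat. apply Rplus_le_compat.
  - eapply Rle_trans; [apply Hbd|]. replace (4 * K * r ^ 2) with (K * (2 * r) ^ 2) by ring.
    apply Rmult_le_compat_l; auto. apply pow_incr; lra.
  - unfold Rdiv. rewrite !Rabs_mult, (Rabs_pos_eq (ln (Cmod z))), (Rabs_pos_eq (/ (2 * tau))) by lra.
    replace (6 * B * / (2 * tau) * r ^ 2) with (3 * B * r * (2 * r) * / (2 * tau)) by ring.
    apply Rmult_le_compat_r. lra. apply Rmult_le_compat; try lra. apply Rabs_pos.
    replace (Re (z * z)%C - Re (s * s)%C) with (Re (b * (z + RtoC sg * s))%C).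
    + eapply Rle_trans; [apply re_le_Cmod|]. rewrite Cmod_mult. fold B.
      assert (T := Cmod_triangle z (RtoC sg * s)%C). rewrite Es in T. nra.
    + unfold z. destruct Hsg as [-> | ->]; destruct b, s; simpl; ring.
  - unfold Rdiv. rewrite !Rabs_mult, (Rabs_pos_eq (/ (2 * tau))) by lra.
    replace (ln 2 * / (2 * tau) * r ^ 2) with (r ^ 2 * ln 2 * / (2 * tau)) by ring.
    apply Rmult_le_compat_r. lra. apply Rmult_le_compat; try apply Rabs_pos.
    + eapply Rle_trans; [apply re_le_Cmod|]. rewrite Cmod_mult. fold r. lra.
    + assert (L1 : ln (Cmod z) <= ln (2 * r)) by (apply ln_le; lra).
      assert (L2 : ln (r * / 2) <= ln (Cmod z)) by (apply ln_le; lra).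
      rewrite ln_mult in L1, L2 by lra. rewrite ln_Rinv in L2 by lra. apply Rabs_le. lra.
Qed.

Lemma grows_like_ext g g' x x' : (forall s, g s = g' s) -> x = x' -> grows_like g x -> grows_like g' x'.
Proof. intros E <- (K & R0 & HK & HR & H). exists K, R0. repeat split; auto; rewrite <- E; now apply H. Qed.

Lemma grows_like_mult g h x y : grows_like g x -> grows_like h y -> grows_like (fun s => (g s * h s)%C) (x + y).
Proof.
  intros (K & R0 & HK & HR & H) (K' & R0' & HK' & HR' & H').
  exists (K + K'), (Rmax R0 R0'). split. lra. split. eapply Rle_trans; [apply HR|apply Rmax_l].
  intros s Hs Him. destruct (H s) as [A B]; auto. eapply Rle_trans; [apply Rmax_l|apply Hs].
  destruct (H' s) as [A' B']; auto. eapply Rle_trans; [apply Rmax_r|apply Hs].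
  rewrite Cmod_mult. split. now apply Rmult_lt_0_compat. rewrite ln_mult by auto.
  replace (ln (Cmod (g s)) + ln (Cmod (h s)) - (x + y) * main_term s) with
    ((ln (Cmod (g s)) - x * main_term s) + (ln (Cmod (h s)) - y * main_term s)) by ring.
  eapply Rle_trans; [apply Rabs_triang|]. lra.
Qed.

Lemma grows_like_inv g x : grows_like g x -> grows_like (fun s => (/ g s)%C) (- x).
Proof.
  intros (K & R0 & HK & HR & H). exists K, R0. split; auto. split; auto. intros s Hs Him.
  destruct (H s Hs Him) as [A B]. rewrite Cmod_inv by now apply neq_0_of_Cmod.
  split. now apply Rinv_0_lt_compat. rewrite ln_Rinv by auto.
  replace (- ln (Cmod (g s)) - - x * main_term s) with (- (ln (Cmod (g s)) - x * main_term s)) by ring.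
  now rewrite Rabs_Ropp.
Qed.

Lemma grows_like_Cprod {T} (g : T -> C -> C) l : (forall x, grows_like (g x) 1) ->
  grows_like (fun s => Cprod (map (fun x => g x s) l)) (INR (length l)).
Proof.
  intros H. induction l as [|x l IH].
  - exists 0, 1. split; [lra|]. split; [lra|]. intros s Hs Him. simpl. rewrite Cmod_1, ln_1.
    replace (0 - 0 * main_term s) with 0 by ring. rewrite Rabs_R0. lra.
  - change (length (x :: l)) with (S (length l)). rewrite S_INR, Rplus_comm.
    apply (grows_like_mult (g x)); auto.
Qed.

Lemma grows_like_Cexp (g : C -> C) A : 0 <= A -> (forall s, 1 <= Cmod s -> Cmod (g s) <= A * Cmod s ^ 2) ->
  grows_like (fun s => Cexp (g s)) 0.
Proof.
  intros HA H. exists A, 1. split; auto. split; [lra|]. intros s Hs _. rewrite Cmod_Cexp, ln_exp.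
  split. apply exp_pos. replace (Re (g s) - 0 * main_term s) with (Re (g s)) by ring.
  eapply Rle_trans; [apply re_le_Cmod|]. auto.
Qed.

Lemma grows_like_phi p q m n (a b : list C) alpha : (m <= q)%nat -> (n <= p)%nat ->
  length a = p -> length b = q ->
  grows_like (phi tau m n a b alpha) (IZR (index_N p q m n)).
Proof.
  intros Hm Hn Ha Hb. unfold phi, calG.
  eapply grows_like_ext; [intros s; reflexivity| |apply (grows_like_mult (fun s =>
    (Cprod (map (fun bj => double_gamma tau (bj - s)) (firstn m b))
   * Cprod (map (fun aj => double_gamma tau (1 + RtoC tau - aj + s)) (firstn n a))
   / (Cprod (map (fun bj => double_gamma tau (1 + RtoC tau - bj + s)) (skipn m b))
      * Cprod (map (fun aj => double_gamma tau (aj - s)) (skipn n a))))%C))].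
  2:{ apply (grows_like_mult (fun s => Cprod (map (fun bj => double_gamma tau (bj - s)) (firstn m b))
        * Cprod (map (fun aj => double_gamma tau (1 + RtoC tau - aj + s)) (firstn n a)))%C).
      apply (grows_like_mult (fun s => Cprod (map (fun bj => double_gamma tau (bj - s)) (firstn m b)))%C).
      apply (grows_like_Cprod (fun bj s => double_gamma tau (bj - s)%C)).
      2: apply (grows_like_Cprod (fun aj s => double_gamma tau (1 + RtoC tau - aj + s)%C)).
      3:{ apply grows_like_inv.
          apply (grows_like_mult (fun s => Cprod (map (fun bj => double_gamma tau (1 + RtoC tau - bj + s)) (skipn m b)))%C).
          apply (grows_like_Cprod (fun bj s => double_gamma tau (1 + RtoC tau - bj + s)%C)).
          2: apply (grows_like_Cprod (fun aj s => double_gamma tau (aj - s)%C)).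
          all: intros x. 
          - eapply grows_like_ext; [|reflexivity|apply (grows_like_double_gamma (1 + RtoC tau - x)%C 1); auto].
            intros s. cbv beta. f_equal. ring.
          - eapply grows_like_ext; [|reflexivity|apply (grows_like_double_gamma x (-1)); auto].
            intros s. cbv beta. f_equal. destruct x, s; unfold Cminus, Cplus, Cmult, Copp, RtoC; simpl; f_equal; ring. }
      - intros x. eapply grows_like_ext; [|reflexivity|apply (grows_like_double_gamma x (-1)); auto].
            intros s. cbv beta. f_equal. destruct x, s; unfold Cminus, Cplus, Cmult, Copp, RtoC; simpl; f_equal; ring.
      - intros x. eapply grows_like_ext; [|reflexivity|apply (grows_like_double_gamma (1 + RtoC tau - x)%C 1); auto].
            intros s. cbv beta. f_equal. ring. }
  2:{ apply (grows_like_Cexp (fun s => RtoC PI * alpha * (s * s) / RtoC tau)%C (PI * Cmod alpha / tau)).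
      - apply Rmult_le_pos. apply Rmult_le_pos. left; apply PI_RGT_0. apply Cmod_ge_0. left; now apply Rinv_0_lt_compat.
      - intros s Hs. assert (Nt : RtoC tau <> RtoC 0) by (intros E; apply RtoC_inj in E; lra).
        assert (PP := PI_RGT_0). rewrite Cmod_div, !Cmod_mult, !Cmod_R by auto. rewrite !Rabs_pos_eq by lra.
        right. unfold Rdiv. ring. }
  rewrite !length_firstn, !length_skipn, Ha, Hb.
  rewrite !Nat.min_l by auto. rewrite !minus_INR by auto. unfold index_N.
  rewrite !minus_IZR, mult_IZR, plus_IZR, <- !INR_IZR_INZ. ring.
Qed.

Lemma grows_like_power_neg z : grows_like (power_neg z) 0.
Proof.
  apply (grows_like_Cexp (fun s => - (s * slog z))%C (Cmod (slog z))). apply Cmod_ge_0.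
  intros s Hs. rewrite Cmod_opp, Cmod_mult. assert (Q := Cmod_ge_0 (slog z)).
  rewrite Rmult_comm. apply Rmult_le_compat_l; auto. nra.
Qed.
End Phi.

(** Where [Re s^2] is comparable to [|s|^2], the main term, of order [|s|^2 ln |s|],
    beats every error of order [|s|^2]. *)
Lemma grows_like_decay tau kappa g x delta A : 0 < tau -> 0 < kappa -> x < 0 -> 0 < delta -> grows_like tau kappa g x ->
  exists R0, 1 <= R0 /\ forall s, R0 <= Cmod s -> kappa * Cmod s <= Rabs (Im s) ->
    delta * Cmod s ^ 2 <= Re (s * s)%C -> Cmod (g s) <= exp (- (A * Cmod s)).
Proof.
  intros Ht Hk Hx Hd (K & R1 & HK & HR1 & H).
  set (e := - x * delta / (2 * tau)). assert (He : 0 < e) by (apply Rdiv_lt_0_compat; nra).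
  set (L := (K + Rabs A) / e).
  exists (Rmax R1 (exp L)). split. eapply Rle_trans; [apply HR1|apply Rmax_l].
  intros s Hs Him Hre.
  assert (H1 : R1 <= Cmod s) by (eapply Rle_trans; [apply Rmax_l|apply Hs]).
  assert (H2 : exp L <= Cmod s) by (eapply Rle_trans; [apply Rmax_r|apply Hs]).
  destruct (H s H1 Him) as [P Q]. apply Rabs_le_between in Q. set (r := Cmod s) in *.
  rewrite <- (exp_ln (Cmod (g s))) by auto. apply exp_le_compat.
  assert (HL : L <= ln r). { rewrite <- (ln_exp L). apply ln_le; auto. apply exp_pos. }
  assert (HLp : 0 <= L). { unfold L. apply Rmult_le_pos. assert (T := Rabs_pos A). lra. left; now apply Rinv_0_lt_compat. }
  assert (M : x * main_term tau s <= - (e * r ^ 2 * ln r)).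
  { unfold main_term. fold r. replace (e * r ^ 2 * ln r) with (- x * (delta * r ^ 2 / (2 * tau) * ln r)) by (unfold e; field; lra).
    assert (delta * r ^ 2 / (2 * tau) * ln r <= Re (s * s)%C / (2 * tau) * ln r).
    { apply Rmult_le_compat_r. lra. apply Rmult_le_compat_r. left; apply Rinv_0_lt_compat; lra. auto. }
    apply (Rmult_le_compat_l (- x)) in H0; lra. }
  assert (M2 : (K + Rabs A) * r ^ 2 <= e * r ^ 2 * ln r).
  { replace (K + Rabs A) with (e * L) by (unfold L; field; lra).
    assert (0 <= r ^ 2) by apply pow2_ge_0. assert (e * L <= e * ln r) by (apply Rmult_le_compat_l; lra). nra. }
  assert (T := Rle_abs A). assert (T2 : A * r <= Rabs A * r ^ 2). {
    assert (T3 := Rabs_pos A). apply Rle_trans with (Rabs A * r). apply Rmult_le_compat_r; lra.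
    apply Rmult_le_compat_l; auto. nra. }
  lra.
Qed.

(** Where [Re s^2] is negative and comparable to [|s|^2], the same comparison gives a
    lower bound. *)
Lemma grows_like_lower tau kappa g x : 0 < tau -> 0 < kappa -> x < 0 -> grows_like tau kappa g x ->
  exists R0, 1 <= R0 /\ forall s, R0 <= Cmod s -> kappa * Cmod s <= Rabs (Im s) ->
    Re (s * s)%C <= - (Cmod s ^ 2 / 2) -> 1 <= Cmod (g s).
Proof.
  intros Ht Hk Hx (K & R1 & HK & HR1 & H).
  set (e := - x / (4 * tau)). assert (He : 0 < e) by (apply Rdiv_lt_0_compat; nra).
  set (L := K / e).
  exists (Rmax R1 (exp L)). split. eapply Rle_trans; [apply HR1|apply Rmax_l].
  intros s Hs Him Hre.
  assert (H1 : R1 <= Cmod s) by (eapply Rle_trans; [apply Rmax_l|apply Hs]).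
  assert (H2 : exp L <= Cmod s) by (eapply Rle_trans; [apply Rmax_r|apply Hs]).
  destruct (H s H1 Him) as [P Q]. apply Rabs_le_between in Q. set (r := Cmod s) in *.
  rewrite <- (exp_ln (Cmod (g s))) by auto. rewrite <- exp_0. apply exp_le_compat.
  assert (HL : L <= ln r). { rewrite <- (ln_exp L). apply ln_le; auto. apply exp_pos. }
  assert (HLp : 0 <= L). { unfold L. apply Rmult_le_pos. lra. left; now apply Rinv_0_lt_compat. }
  assert (M : e * r ^ 2 * ln r <= x * main_term tau s).
  { unfold main_term. fold r. replace (e * r ^ 2 * ln r) with (- x * ((r ^ 2 / 2) / (2 * tau) * ln r)) by (unfold e; field; lra).
    assert (Re (s * s)%C / (2 * tau) * ln r <= - (r ^ 2 / 2) / (2 * tau) * ln r).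
    { apply Rmult_le_compat_r. lra. apply Rmult_le_compat_r. left; apply Rinv_0_lt_compat; lra. auto. } 
    replace (- (r ^ 2 / 2) / (2 * tau) * ln r) with (- ((r ^ 2 / 2) / (2 * tau) * ln r)) in H0 by (field; lra).
    apply (Rmult_le_compat_l (- x)) in H0; lra. }
  assert (M2 : K * r ^ 2 <= e * r ^ 2 * ln r).
  { replace K with (e * L) by (unfold L; field; lra).
    assert (0 <= r ^ 2) by apply pow2_ge_0. assert (e * L <= e * ln r) by (apply Rmult_le_compat_l; lra). nra. }
  lra.
Qed.

(** * Holomorphy off the poles *)

Lemma hol_phi tau m n a b alpha : 0 < tau ->
  hol (fun s => ~ Lambda_plus tau n a s /\ ~ Lambda_minus tau m b s) (phi tau m n a b alpha).
Proof.
  intros Ht. set (D := fun s => ~ Lambda_plus tau n a s /\ ~ Lambda_minus tau m b s).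
  assert (G1 : forall x, hol D (fun s => double_gamma tau (x - s)%C)).
  { intros x. apply (hol_comp D (fun _ => True) (double_gamma tau) (fun s => x - s)%C); auto.
    apply hol_minus. apply hol_const. apply hol_id. now apply hol_double_gamma. }
  assert (G2 : forall x, hol D (fun s => double_gamma tau (x + s)%C)).
  { intros x. apply (hol_comp D (fun _ => True) (double_gamma tau) (fun s => x + s)%C); auto.
    apply hol_plus. apply hol_const. apply hol_id. now apply hol_double_gamma. }
  unfold phi, calG.
  apply (hol_mult D (fun s => (Cprod (map (fun bj => double_gamma tau (bj - s)) (firstn m b))
   * Cprod (map (fun aj => double_gamma tau (1 + RtoC tau - aj + s)) (firstn n a))
   / (Cprod (map (fun bj => double_gamma tau (1 + RtoC tau - bj + s)) (skipn m b))
      * Cprod (map (fun aj => double_gamma tau (aj - s)) (skipn n a))))%C)).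
  - apply (hol_div D (fun s => Cprod (map (fun bj => double_gamma tau (bj - s)) (firstn m b))
        * Cprod (map (fun aj => double_gamma tau (1 + RtoC tau - aj + s)) (firstn n a)))%C
        (fun s => Cprod (map (fun bj => double_gamma tau (1 + RtoC tau - bj + s)) (skipn m b))
      * Cprod (map (fun aj => double_gamma tau (aj - s)) (skipn n a)))%C).
    + apply (hol_mult D (fun s => Cprod (map (fun bj => double_gamma tau (bj - s)) (firstn m b)))%C).
      apply (hol_Cprod D (fun bj s => double_gamma tau (bj - s)%C)); auto.
      apply (hol_Cprod D (fun aj s => double_gamma tau (1 + RtoC tau - aj + s)%C)); auto.
    + apply (hol_mult D (fun s => Cprod (map (fun bj => double_gamma tau (1 + RtoC tau - bj + s)) (skipn m b)))%C).
      apply (hol_Cprod D (fun aj s => double_gamma tau (1 + RtoC tau - aj + s)%C)); auto.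
      apply (hol_Cprod D (fun bj s => double_gamma tau (bj - s)%C)); auto.
    + intros s [H1 H2]. apply Cmult_neq_0; apply Cprod_neq_0; intros x Hx; apply double_gamma_neq_0; auto; intros k l E.
      * apply H2. exists x, (S k), (S l). repeat split; auto; try lia. rewrite !S_INR.
        replace s with (1 + RtoC tau - x + s - (1 + RtoC tau - x))%C by ring. rewrite E.
        destruct x. unfold RtoC, Cminus, Cplus, Copp; simpl; f_equal; ring.
      * apply H1. exists x, k, l. split; auto.
        replace s with (x - (x - s))%C by ring. rewrite E.
        destruct x. unfold RtoC, Cminus, Cplus, Copp; simpl; f_equal; ring.
  - apply hol_Cexp. apply (hol_mult D (fun s => RtoC PI * alpha * (s * s))%C).
    apply (hol_mult D (fun s => RtoC PI * alpha)%C (fun s => s * s)%C). apply hol_const. apply (hol_mult D (fun s => s)); apply hol_id. apply hol_const.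
Qed.

Lemma hol_power_neg D z : hol D (power_neg z).
Proof.
  unfold power_neg. apply hol_Cexp. apply hol_opp. apply (hol_mult D (fun s => s)). apply hol_id. apply hol_const.
Qed.

(** * Integrals along piecewise smooth curves *)

(** The integral of a complex function of a real variable. *)
Definition is_Cint (f : R -> C) (a b : R) (l : C) : Prop := is_RInt (V := C_R_NormedModule) f a b l.

Lemma is_Cint_parts f a b l : is_RInt (fun t => Re (f t)) a b (Re l) -> is_RInt (fun t => Im (f t)) a b (Im l) ->
  is_Cint f a b l.
Proof.
  intros H1 H2. destruct l as [x y]. apply (is_RInt_fct_extend_pair (U := R_NormedModule) (V := R_NormedModule)); auto.
Qed.

Lemma piecewise_le g a b : piecewise_C1 g a b -> a <= b.
Proof. induction 1; lra. Qed.

(** On a smooth piece the curve agrees with a curve [g] that is smooth on the whole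
    line; its derivative agrees with that of [g] in the interior only. *)
Lemma C1_on_elim gamma a b : C1_on gamma a b -> exists g g' : R -> C,
  (forall t, curve_deriv_at g t (g' t)) /\
  (forall p t, is_part p -> continuous (fun u => p (g' u)) t) /\
  (forall t, a <= t <= b -> gamma t = g t) /\
  (forall t, a < t < b -> curve_derive gamma t = g' t).
Proof.
  intros (g & H & E). exists g, (fun t => (Derive (fun u => Re (g u)) t, Derive (fun u => Im (g u)) t)).
  assert (D : forall t, curve_deriv_at g t (Derive (fun u => Re (g u)) t, Derive (fun u => Im (g u)) t)).
  { intros t. destruct (H t) as (D1 & D2 & _). split; simpl; now apply Derive_correct. }
  split; [exact D|]. split; [|split; [exact E|]].
  - intros p t [-> | ->]; apply (H t).
  - intros t Ht. unfold curve_derive.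
    assert (L : locally t (fun u => gamma u = g u)).
    { assert (Hd : 0 < Rmin (t - a) (b - t)) by (apply Rmin_pos; lra).
      exists (mkposreal _ Hd). intros u Hu. change (Rabs (u - t) < Rmin (t - a) (b - t)) in Hu.
      assert (Q1 := Rmin_l (t - a) (b - t)). assert (Q2 := Rmin_r (t - a) (b - t)).
      apply Rabs_def2 in Hu. apply E. lra. }
    f_equal; apply Derive_ext_loc; revert L; apply filter_imp; intros u ->; reflexivity.
Qed.

Lemma piecewise_continuous gamma a b : piecewise_C1 gamma a b ->
  forall t, a <= t <= b -> forall eps, 0 < eps -> exists d, 0 < d /\
    forall u, a <= u <= b -> Rabs (u - t) < d -> Cmod (gamma u - gamma t)%C <= eps.
Proof.
  induction 1 as [a b Hab H|a b c H1 IH1 H2 IH2]; intros t Ht eps He.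
  - destruct (C1_on_elim _ _ _ H) as (g & g' & Dg & _ & Eg & _).
    assert (P := Cmod_ge_0 (g' t)).
    destruct (curve_deriv_eps _ _ _ (Dg t) 1 Rlt_0_1) as (d & Hd & Hh).
    exists (Rmin d (eps / (Cmod (g' t) + 1))). split. apply Rmin_pos; auto. apply Rdiv_lt_0_compat; lra.
    intros u Hu Hut.
    assert (L1 : Rabs (u - t) < d) by (eapply Rlt_le_trans; [apply Hut|apply Rmin_l]).
    assert (L2 : Rabs (u - t) < eps / (Cmod (g' t) + 1)) by (eapply Rlt_le_trans; [apply Hut|apply Rmin_r]).
    specialize (Hh _ L1). replace (t + (u - t)) with u in Hh by ring.
    rewrite !Eg by auto.
    replace (g u - g t)%C with ((g u - g t - g' t * RtoC (u - t)) + g' t * RtoC (u - t))%C by ring.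
    eapply Rle_trans; [apply Cmod_triangle|]. rewrite Cmod_mult, Cmod_R.
    apply Rle_trans with ((Cmod (g' t) + 1) * Rabs (u - t)). lra.
    apply Rle_trans with ((Cmod (g' t) + 1) * (eps / (Cmod (g' t) + 1))). apply Rmult_le_compat_l; lra.
    right; field; lra.
  - assert (L1 := piecewise_le _ _ _ H1). assert (L2 := piecewise_le _ _ _ H2).
    destruct (Rtotal_order t b) as [L|[L|L]].
    + destruct (IH1 t ltac:(lra) eps He) as (d & Hd & Hh). exists (Rmin d (b - t)). split. apply Rmin_pos; lra.
      intros u Hu Hut. assert (Q1 := Rmin_l d (b - t)). assert (Q2 := Rmin_r d (b - t)).
      apply Hh; [|lra]. assert (Q := Rle_abs (u - t)). lra.
    + subst t. destruct (IH1 b ltac:(lra) eps He) as (d & Hd & Hh). destruct (IH2 b ltac:(lra) eps He) as (d' & Hd' & Hh').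
      exists (Rmin d d'). split. now apply Rmin_pos. intros u Hu Hut.
      assert (Q1 := Rmin_l d d'). assert (Q2 := Rmin_r d d').
      destruct (Rle_lt_dec u b). apply Hh; lra. apply Hh'; lra.
    + destruct (IH2 t ltac:(lra) eps He) as (d & Hd & Hh). exists (Rmin d (t - b)). split. apply Rmin_pos; lra.
      intros u Hu Hut. assert (Q1 := Rmin_l d (t - b)). assert (Q2 := Rmin_r d (t - b)).
      apply Hh; [|lra]. assert (Q := Rle_abs (- (u - t))). rewrite Rabs_Ropp in Q. lra.
Qed.

Section Curve.
Variable gamma : R -> C.
Hypothesis Hsm : forall a b, a <= b -> piecewise_C1 gamma a b.

Lemma curve_cont t p : is_part p -> continuity_pt (fun u => p (gamma u)) t.
Proof.
  intros Hp eps He.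
  destruct (piecewise_continuous gamma (t - 1) (t + 1) (Hsm (t - 1) (t + 1) ltac:(lra)) t ltac:(lra) (eps / 2) ltac:(lra)) as (d & Hd & Hh).
  exists (Rmin d 1). split. apply Rmin_pos; lra. intros u [_ Hu]. simpl in *. unfold R_dist in *.
  assert (Q1 := Rmin_l d 1). assert (Q2 := Rmin_r d 1).
  rewrite <- part_sub by auto. eapply Rle_lt_trans; [apply part_le; auto|].
  apply Rle_lt_trans with (eps / 2); [|lra]. apply Hh; [|lra].
  assert (Hu' : Rabs (u - t) < 1) by lra. apply Rabs_def2 in Hu'. lra.
Qed.

Lemma continuous_part_mult (z w : R -> C) t :
  (forall p, is_part p -> continuous (fun u => p (z u)) t) -> (forall p, is_part p -> continuous (fun u => p (w u)) t) ->
  forall p, is_part p -> continuous (fun u => p (z u * w u)%C) t.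
Proof.
  intros Hz Hw p [-> | ->].
  - apply (continuous_minus (fun u => Re (z u) * Re (w u)) (fun u => Im (z u) * Im (w u)));
    apply (continuous_mult (K := R_AbsRing)); auto using part_Re, part_Im.
  - apply (continuous_plus (fun u => Re (z u) * Im (w u)) (fun u => Im (z u) * Re (w u)));
    apply (continuous_mult (K := R_AbsRing)); auto using part_Re, part_Im.
Qed.

(** The fundamental theorem of calculus along a curve. *)
Theorem contour_FTC (F f : C -> C) a b : a <= b ->
  (forall t, a <= t <= b -> Cderiv F (gamma t) (f (gamma t)) /\ Ccont f (gamma t)) ->
  is_Cint (contour_integrand f gamma) a b (F (gamma b) - F (gamma a))%C.
Proof.
  intros Hab H. generalize (Hsm a b Hab). intros HP. induction HP as [a b _ HC|a b c H1 IH1 H2 IH2].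
  - destruct (C1_on_elim _ _ _ HC) as (g & g' & Dg & Cg & Eg & Edg).
    assert (Hg : forall t, a <= t <= b -> Cderiv F (g t) (f (g t)) /\ Ccont f (g t)).
    { intros t Ht. rewrite <- Eg by auto. auto. }
    apply (is_RInt_ext (V := C_R_NormedModule) (fun t => (f (g t) * g' t)%C)).
    { rewrite Rmin_left, Rmax_right by auto. intros t Ht. unfold contour_integrand.
      rewrite Edg, Eg by lra. reflexivity. }
    rewrite !Eg by lra.
    assert (K : forall p, is_part p -> is_RInt (fun t => p (f (g t) * g' t)%C) a b (p (F (g b) - F (g a))%C)).
    { intros p Hp. rewrite part_sub by auto.
      apply (is_RInt_derive (fun t => p (F (g t)))); rewrite Rmin_left, Rmax_right by auto; intros t Ht.
      - apply (part_deriv p (fun t => F (g t))); auto. apply curve_deriv_comp; auto. now apply Hg.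
      - apply continuous_part_mult; auto. intros q Hq. apply (Ccont_curve q f g t (g' t)); auto. now apply Hg. }
    apply is_Cint_parts; [apply (K Re part_Re)|apply (K Im part_Im)].
  - assert (L1 := piecewise_le _ _ _ H1). assert (L2 := piecewise_le _ _ _ H2).
    replace (F (gamma c) - F (gamma a))%C with ((F (gamma b) - F (gamma a)) + (F (gamma c) - F (gamma b)))%C by ring.
    apply (is_RInt_Chasles (V := C_R_NormedModule)) with b.
    apply IH1; auto. intros; apply H; lra. apply IH2; auto. intros; apply H; lra.
Qed.

Lemma contour_ex_Cint (f : C -> C) a b : a <= b -> (forall t, a <= t <= b -> Ccont f (gamma t)) ->
  ex_RInt (V := C_R_NormedModule) (contour_integrand f gamma) a b.
Proof.
  intros Hab H. generalize (Hsm a b Hab). intros HP. induction HP as [a b _ HC|a b c H1 IH1 H2 IH2].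
  - destruct (C1_on_elim _ _ _ HC) as (g & g' & Dg & Cg & Eg & Edg).
    assert (Hg : forall t, a <= t <= b -> Ccont f (g t)).
    { intros t Ht. rewrite <- Eg by auto. auto. }
    apply (ex_RInt_ext (V := C_R_NormedModule) (fun t => (f (g t) * g' t)%C)).
    { rewrite Rmin_left, Rmax_right by auto. intros t Ht. unfold contour_integrand.
      rewrite Edg, Eg by lra. reflexivity. }
    assert (K : forall p, is_part p -> ex_RInt (fun t => p (f (g t) * g' t)%C) a b).
    { intros p Hp. apply (ex_RInt_continuous (V := R_CompleteNormedModule)). rewrite Rmin_left, Rmax_right by auto. intros t Ht.
      apply continuous_part_mult; auto. intros q Hq. apply (Ccont_curve q f g t (g' t)); auto. }
    destruct (K Re part_Re) as (x & Hx). destruct (K Im part_Im) as (y & Hy).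
    exists (x, y). now apply is_Cint_parts.
  - assert (L1 := piecewise_le _ _ _ H1). assert (L2 := piecewise_le _ _ _ H2).
    apply (ex_RInt_Chasles (V := C_R_NormedModule)) with b.
    apply IH1; auto. intros; apply H; lra. apply IH2; auto. intros; apply H; lra.
Qed.

Lemma continuous_Cmod (z : R -> C) t : (forall p, is_part p -> continuous (fun u => p (z u)) t) ->
  continuous (fun u => Cmod (z u)) t.
Proof.
  intros H. unfold Cmod. apply (continuous_comp (fun u => fst (z u) ^ 2 + snd (z u) ^ 2) sqrt).
  - apply (continuous_plus (fun u => fst (z u) ^ 2) (fun u => snd (z u) ^ 2)); simpl.
    + apply (continuous_mult (K := R_AbsRing) (fun u => fst (z u))). apply (H Re part_Re).
      apply (continuous_mult (K := R_AbsRing) (fun u => fst (z u))). apply (H Re part_Re). apply continuous_const.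
    + apply (continuous_mult (K := R_AbsRing) (fun u => snd (z u))). apply (H Im part_Im).
      apply (continuous_mult (K := R_AbsRing) (fun u => snd (z u))). apply (H Im part_Im). apply continuous_const.
  - apply continuity_pt_filterlim, continuity_pt_sqrt. nra.
Qed.

(** The integral of a real weight against the arc length element. *)
Definition arc_integrand (h : C -> R) (t : R) : R := h (gamma t) * Cmod (curve_derive gamma t).

(** Continuity of a real function of a complex variable. *)
Definition Rcont (h : C -> R) (z : C) : Prop := Ccont (fun s => RtoC (h s)) z.

Lemma arc_ex_RInt h a b : a <= b -> (forall t, a <= t <= b -> Rcont h (gamma t)) ->
  ex_RInt (arc_integrand h) a b.
Proof.
  intros Hab H. generalize (Hsm a b Hab). intros HP. induction HP as [a b _ HC|a b c H1 IH1 H2 IH2].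
  - destruct (C1_on_elim _ _ _ HC) as (g & g' & Dg & Cg & Eg & Edg).
    assert (Hg : forall t, a <= t <= b -> Rcont h (g t)).
    { intros t Ht. rewrite <- Eg by auto. auto. }
    apply (ex_RInt_ext (fun t => h (g t) * Cmod (g' t))).
    { rewrite Rmin_left, Rmax_right by auto. intros t Ht. unfold arc_integrand.
      rewrite Edg, Eg by lra. reflexivity. }
    apply (ex_RInt_continuous (V := R_CompleteNormedModule)). rewrite Rmin_left, Rmax_right by auto. intros t Ht.
    apply (continuous_mult (K := R_AbsRing) (fun t => h (g t)) (fun t => Cmod (g' t))).
    apply (Ccont_curve Re (fun s => RtoC (h s)) g t (g' t)); auto using part_Re. apply Hg; auto.
    apply continuous_Cmod. intros p Hp. now apply Cg.
  - assert (L1 := piecewise_le _ _ _ H1). assert (L2 := piecewise_le _ _ _ H2).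
    apply ex_RInt_Chasles with b.
    apply IH1; auto. intros; apply H; lra. apply IH2; auto. intros; apply H; lra.
Qed.

Lemma contour_norm_le (f : C -> C) h a b l : a <= b -> (forall t, a <= t <= b -> Rcont h (gamma t)) ->
  (forall t, a <= t <= b -> Cmod (f (gamma t)) <= h (gamma t)) ->
  is_Cint (contour_integrand f gamma) a b l -> Cmod l <= RInt (arc_integrand h) a b.
Proof.
  intros Hab Hh Hle Hl. rewrite Cmod_norm.
  apply (norm_RInt_le (V := C_R_NormedModule) (contour_integrand f gamma) (arc_integrand h) a b l); auto.
  - intros t Ht. unfold contour_integrand, arc_integrand. rewrite <- Cmod_norm, Cmod_mult.
    apply Rmult_le_compat_r. apply Cmod_ge_0. auto.
  - apply (RInt_correct (V := R_CompleteNormedModule)). now apply arc_ex_RInt.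
Qed.

Lemma arc_RInt_ge0 h a b : a <= b -> (forall t, a <= t <= b -> Rcont h (gamma t)) ->
  (forall t, a <= t <= b -> 0 <= h (gamma t)) -> 0 <= RInt (arc_integrand h) a b.
Proof.
  intros Hab Hh H0. apply RInt_ge_0; auto. now apply arc_ex_RInt.
  intros t Ht. apply Rmult_le_pos. apply H0; lra. apply Cmod_ge_0.
Qed.

Lemma arc_RInt_le h k a b : a <= b -> (forall t, a <= t <= b -> Rcont h (gamma t)) ->
  (forall t, a <= t <= b -> Rcont k (gamma t)) ->
  (forall t, a <= t <= b -> h (gamma t) <= k (gamma t)) -> RInt (arc_integrand h) a b <= RInt (arc_integrand k) a b.
Proof.
  intros Hab Hh Hk H0. apply RInt_le; auto. now apply arc_ex_RInt. now apply arc_ex_RInt.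
  intros t Ht. apply Rmult_le_compat_r. apply Cmod_ge_0. apply H0; lra.
Qed.

(** * Curves inside a ray *)

Hypothesis Hinj : forall t u, gamma t = gamma u -> t = u.

Section Ray.
Variables (c : C) (theta : R) (a b : R).
Hypotheses (Hab : a <= b) (Hray : forall t, a <= t <= b -> on_ray c theta (gamma t)).

Let e0 : C := (cos theta, - sin theta).
(** The coordinate along the ray. *)
Let rho (t : R) : R := Re ((gamma t - c) * e0)%C.

Let Cmod_e0 : Cmod e0 = 1.
Proof.
  transitivity (sqrt 1); [|apply sqrt_1]. unfold Cmod, e0. simpl. f_equal. assert (S := sin2_cos2 theta). unfold Rsqr in S. lra.
Qed.

Lemma ray_coordinate t : a <= t <= b -> 0 <= rho t /\ gamma t = (c + polar (rho t) theta)%C /\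
  Im ((gamma t - c) * e0)%C = 0 /\ rho t = Cmod (gamma t - c)%C.
Proof.
  intros Ht. destruct (Hray t Ht) as (x & Hx & E). assert (S := sin2_cos2 theta). unfold Rsqr in S.
  assert (E1 : ((gamma t - c) * e0)%C = (x, 0)).
  { rewrite E. unfold e0, polar. destruct c. unfold Cminus, Cplus, Cmult, Copp; simpl. f_equal; [|ring].
    transitivity (x * (sin theta * sin theta + cos theta * cos theta)). ring. rewrite S; ring. }
  unfold rho. rewrite E1. simpl. repeat split; auto.
  rewrite <- (Rmult_1_r (Cmod (gamma t - c)%C)), <- Cmod_e0, <- Cmod_mult, E1.
  change (x, 0) with (RtoC x). rewrite Cmod_R, Rabs_pos_eq; auto.
Qed.

Let rho_cont t : continuity_pt rho t.
Proof.
  unfold rho. apply continuity_pt_ext with (fun t => (Re (gamma t) - Re c) * Re e0 - (Im (gamma t) - Im c) * Im e0).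
  { intros u. destruct (gamma u), c. reflexivity. }
  apply (continuity_pt_minus (fun t => (Re (gamma t) - Re c) * Re e0) (fun t => (Im (gamma t) - Im c) * Im e0));
  apply continuity_pt_mult; try (apply continuity_pt_const; intros ? ?; reflexivity);
  apply continuity_pt_minus; try (apply continuity_pt_const; intros ? ?; reflexivity); apply curve_cont; auto using part_Re, part_Im.
Qed.

Let rho_inj t u : a <= t <= b -> a <= u <= b -> rho t = rho u -> t = u.
Proof.
  intros Ht Hu E. apply Hinj. destruct (ray_coordinate t Ht) as (_ & -> & _). destruct (ray_coordinate u Hu) as (_ & -> & _).
  now rewrite E.
Qed.

Lemma injective_between (r : R -> R) (x y z : R) : (forall t, continuity_pt r t) ->
  (forall t u, x <= t <= z -> x <= u <= z -> r t = r u -> t = u) -> x < y < z -> r x < r z -> r x < r y < r z.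
Proof.
  intros Hc Hi Hy Hz. split; apply Rnot_le_lt; intros N.
  - destruct (IVT_gen r y z (r x)) as (u & Hu & E). intros t. apply Hc.
    rewrite Rmin_left, Rmax_right by lra. lra. rewrite Rmin_left, Rmax_right in Hu by lra.
    assert (u = x) by (apply Hi; auto; lra). lra.
  - destruct (IVT_gen r x y (r z)) as (u & Hu & E). intros t. apply Hc.
    rewrite Rmin_left, Rmax_right by lra. lra. rewrite Rmin_left, Rmax_right in Hu by lra.
    assert (u = z) by (apply Hi; auto; lra). lra.
Qed.

(** A continuous injective function on an interval is monotone. *)
Lemma injective_increasing (r : R -> R) : (forall t, continuity_pt r t) ->
  (forall t u, a <= t <= b -> a <= u <= b -> r t = r u -> t = u) -> r a <= r b ->
  forall x y, a <= x -> x <= y -> y <= b -> r x <= r y.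
Proof.
  intros Hc Hi Hr x y Hx Hxy Hy.
  destruct (Req_dec a b) as [E|N]. { replace y with x by lra. lra. }
  assert (Hr' : r a < r b). { destruct Hr; auto. exfalso. apply N. apply Hi; lra. }
  assert (X : r x < r b \/ x = b).
  { destruct (Req_dec x a) as [->|]; auto. destruct (Req_dec x b) as [->|]; auto.
    left. apply (injective_between r a x b); auto. lra. }
  destruct X as [X|X]. 2: { replace y with x by lra. lra. }
  destruct (Req_dec x y) as [->|]; [lra|]. destruct (Req_dec y b) as [->|]; [lra|].
  left. apply (injective_between r x y b); auto; try lra. intros t u Ht Hu. apply Hi; lra.
Qed.

Lemma rho_monotone : exists sg, (sg = 1 \/ sg = -1) /\
  forall x y, a <= x -> x <= y -> y <= b -> sg * rho x <= sg * rho y.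
Proof.
  destruct (Rle_lt_dec (rho a) (rho b)) as [L|L].
  - exists 1. split; auto. intros x y H1 H2 H3. assert (Q := injective_increasing rho rho_cont rho_inj L x y H1 H2 H3). lra.
  - exists (-1). split; auto. intros x y H1 H2 H3.
    assert (Q := injective_increasing (fun t => - rho t)). cbv beta in Q.
    enough (- rho x <= - rho y) by lra. apply Q; auto; try lra.
    intros t. apply continuity_pt_opp, rho_cont. intros t u Ht Hu E. apply rho_inj; auto; lra.
Qed.

Lemma increasing_derive_ge0 (r : R -> R) x y t l : x < t < y -> (forall u, x < u < y -> t <= u -> r t <= r u) ->
  is_derive r t l -> 0 <= l.
Proof.
  intros Ht Hm Hl. apply Rnot_lt_le. intros N. apply is_derive_Reals in Hl.
  destruct (Hl (- l) ltac:(lra)) as (d & Hd). set (k := Rmin (d / 2) ((y - t) / 2)).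
  assert (Pd := cond_pos d). assert (Hk : 0 < k) by (apply Rmin_pos; lra).
  assert (Q1 := Rmin_l (d / 2) ((y - t) / 2)). assert (Q2 := Rmin_r (d / 2) ((y - t) / 2)). fold k in Q1, Q2.
  specialize (Hd k ltac:(lra)). rewrite (Rabs_pos_eq k) in Hd by lra. specialize (Hd ltac:(lra)).
  apply Rabs_def2 in Hd. specialize (Hm (t + k) ltac:(lra) ltac:(lra)).
  assert (0 <= (r (t + k) - r t) / k). { apply Rmult_le_pos. lra. left; now apply Rinv_0_lt_compat. } lra.
Qed.

(** Substitution in the ray coordinate [rho]. An injective curve inside a ray has
    a monotone coordinate, so that [|gamma'| = |rho'|] is [rho'] up to one
    sign [sg] for the whole interval, whatever the orientation of the curve. *)
Lemma ray_arc_le h M : 0 <= M -> (forall t, a <= t <= b -> Rcont h (gamma t)) ->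
  (forall t, a <= t <= b -> h (gamma t) <= M * exp (- Cmod (gamma t))) ->
  RInt (arc_integrand h) a b <= M * exp (Cmod c) * (exp (- Cmod (gamma a - c)%C) + exp (- Cmod (gamma b - c)%C)).
Proof.
  intros HM Hc Hh. destruct rho_monotone as (sg & Hsg & Hmono).
  set (M' := M * exp (Cmod c)).
  assert (HM' : 0 <= M') by (apply Rmult_le_pos; [auto|left; apply exp_pos]).
  assert (Key : forall x y, piecewise_C1 gamma x y -> a <= x -> y <= b ->
     RInt (arc_integrand h) x y <= M' * (sg * (exp (- rho x) - exp (- rho y)))).
  { intros x y HP. induction HP as [x y Hxy HC|x y z H1 IH1 H2 IH2]; intros Hx Hy.
    - destruct (C1_on_elim _ _ _ HC) as (g & g' & Dg & Cg & Eg & Edg).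
      set (r := fun t => Re ((g t - c) * e0)%C). set (r' := fun t => Re (g' t * e0)%C).
      assert (Er : forall t, x <= t <= y -> rho t = r t). { intros t Ht. unfold rho, r. now rewrite Eg. }
      assert (Dk : forall t, curve_deriv_at (fun t => (g t - c) * e0)%C t (g' t * e0)%C).
      { intros t. replace (g' t * e0)%C with ((g' t - RtoC 0) * e0 + (g t - c) * RtoC 0)%C by ring.
        apply (curve_deriv_mult (fun t => g t - c)%C (fun _ => e0)). 2: apply curve_deriv_const.
        apply curve_deriv_minus; auto. apply curve_deriv_const. }
      assert (Cr' : forall t, continuous r' t).
      { intros t. unfold r'. apply (continuous_part_mult g' (fun _ => e0) t); auto using part_Re.
        intros p Hp. apply continuous_const. }
      assert (I : is_RInt (fun t => M' * (sg * (r' t * exp (- r t)))) x y (M' * (sg * (exp (- r x) - exp (- r y))))).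
      { replace (M' * (sg * (exp (- r x) - exp (- r y)))) with (minus (- (M' * sg) * exp (- r y)) (- (M' * sg) * exp (- r x))) by (unfold minus, plus, opp; simpl; ring).
        apply (is_RInt_derive (fun t => - (M' * sg) * exp (- r t))).
        - intros t _. destruct (Dk t) as [D1 _].
          apply (is_derive_Rmult (fun _ => - (M' * sg)) (fun t => exp (- r t)) t 0 (- r' t * exp (- r t))).
          apply (is_derive_const (V := R_NormedModule)).
          apply (is_derive_comp exp (fun t => - r t)). apply is_derive_exp.
          apply (is_derive_opp r). exact D1. ring.
        - intros t _. apply (continuous_mult (K := R_AbsRing) (fun _ => M')). apply continuous_const.
          apply (continuous_mult (K := R_AbsRing) (fun _ => sg)). apply continuous_const.
          apply (continuous_mult (K := R_AbsRing) r'). apply Cr'.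
          apply (continuous_comp (fun t => - r t) exp). apply (continuous_opp r). apply (ex_derive_continuous r). exists (r' t). exact (proj1 (Dk t)).
          apply (ex_derive_continuous exp). eexists. apply is_derive_exp. }
      rewrite !Er by lra. rewrite <- (is_RInt_unique _ _ _ _ I).
      apply RInt_le; auto.
      + apply arc_ex_RInt; auto. intros t Ht. apply Hc. lra.
      + eexists; apply I.
      + intros t Ht. unfold arc_integrand. rewrite Edg by auto.
        assert (Himz : Im (g' t * e0)%C = 0).
        { destruct (Dk t) as [_ D2]. apply is_derive_unique in D2. rewrite <- D2.
          rewrite (Derive_ext_loc _ (fun _ => 0)). apply Derive_const.
          assert (Hd : 0 < Rmin (t - x) (y - t)) by (apply Rmin_pos; lra).
          exists (mkposreal _ Hd). intros u Hu. change (Rabs (u - t) < Rmin (t - x) (y - t)) in Hu.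
          assert (Q1 := Rmin_l (t - x) (y - t)). assert (Q2 := Rmin_r (t - x) (y - t)). apply Rabs_def2 in Hu.
          rewrite <- Eg by lra. apply ray_coordinate. lra. }
        assert (Emod : Cmod (g' t) = sg * r' t).
        { rewrite <- (Rmult_1_r (Cmod (g' t))), <- Cmod_e0, <- Cmod_mult.
          replace (g' t * e0)%C with (RtoC (r' t)). 2:{ unfold r'. destruct (g' t * e0)%C; simpl in *. rewrite Himz. reflexivity. }
          rewrite Cmod_R.
          assert (0 <= sg * r' t).
          { apply (increasing_derive_ge0 (fun u => sg * r u) x y t); auto.
            - intros u Hu Htu. rewrite <- !Er by lra. apply Hmono; lra.
            - apply (is_derive_Rmult (fun _ => sg) r t 0 (r' t)). apply (is_derive_const (V := R_NormedModule)). exact (proj1 (Dk t)). ring. }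
          destruct Hsg as [-> | ->]. rewrite Rabs_pos_eq; lra. rewrite Rabs_left1; lra. }
        rewrite Emod.
        replace (M' * (sg * (r' t * exp (- r t)))) with (M' * exp (- r t) * (sg * r' t)) by ring.
        apply Rmult_le_compat_r. rewrite <- Emod. apply Cmod_ge_0.
        eapply Rle_trans; [apply Hh; lra|]. unfold M'. rewrite Rmult_assoc, <- exp_plus.
        apply Rmult_le_compat_l; auto. apply exp_le_compat. rewrite <- Er by lra.
        destruct (ray_coordinate t ltac:(lra)) as (_ & _ & _ & ->).
        assert (T := Cmod_triangle_sub (gamma t) c). lra.
    - assert (L1 := piecewise_le _ _ _ H1). assert (L2 := piecewise_le _ _ _ H2).
      rewrite <- (RInt_Chasles (arc_integrand h) x y z).
      + specialize (IH1 Hx ltac:(lra)). specialize (IH2 ltac:(lra) Hy). unfold plus; simpl.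
        eapply Rle_trans; [apply Rplus_le_compat; [apply IH1|apply IH2]|]. right; ring.
      + apply arc_ex_RInt; auto. intros t Ht. apply Hc. lra.
      + apply arc_ex_RInt; auto. intros t Ht. apply Hc. lra. }
  eapply Rle_trans; [apply (Key a b (Hsm a b Hab)); lra|].
  apply Rmult_le_compat_l; auto.
  destruct (ray_coordinate a ltac:(lra)) as (_ & _ & _ & <-). destruct (ray_coordinate b ltac:(lra)) as (_ & _ & _ & <-).
  assert (P1 := exp_pos (- rho a)). assert (P2 := exp_pos (- rho b)). destruct Hsg as [-> | ->]; lra.
Qed.
End Ray.
End Curve.

(** * Improper integrals *)

Section Improper.
Context {V : CompleteNormedModule R_AbsRing}.

(** The Cauchy criterion for improper integrals over the line. *)
Lemma ex_RInt_gen_of_tail (f : R -> V) : (forall a b, a <= b -> ex_RInt f a b) ->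
  (forall eps, 0 < eps -> exists T, 0 <= T /\ forall a b, a <= b -> (T <= a \/ b <= - T) -> norm (RInt f a b) <= eps) ->
  ex_RInt_gen f (Rbar_locally m_infty) (Rbar_locally p_infty).
Proof.
  intros Hex0 Htail.
  assert (Hex : forall a b, ex_RInt f a b).
  { intros a b. destruct (Rle_lt_dec a b). auto. apply ex_RInt_swap, Hex0. lra. }
  assert (HF : exists l : V, filterlim (fun ab : R * R => RInt f (fst ab) (snd ab))
     (filter_prod (Rbar_locally m_infty) (Rbar_locally p_infty)) (locally l)).
  { apply (proj1 (filterlim_locally_cauchy (U := V) (F := filter_prod (Rbar_locally m_infty) (Rbar_locally p_infty))
      (fun ab : R * R => RInt f (fst ab) (snd ab)))). intros [eps He]. simpl.
    assert (He3 : 0 < eps / 3) by lra.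
    destruct (Htail (eps / 3) He3) as (T & HT & H).
    assert (Hs : forall x y, (T <= x /\ T <= y) \/ (x <= - T /\ y <= - T) -> norm (RInt f x y) <= eps / 3).
    { intros x y Hxy. destruct (Rle_lt_dec x y). apply H; auto. tauto.
      rewrite <- (opp_RInt_swap f y x) by apply Hex. eapply Rle_trans; [right; apply (norm_opp (V := V))|]. apply H. lra. lra. }
    exists (fun ab => fst ab < - T /\ T < snd ab). split.
    - apply (Filter_prod _ _ _ (fun x => x < - T) (fun y => T < y)).
      exists (- T). auto. exists T. auto. auto.
    - intros [u1 u2] [v1 v2] [Hu1 Hu2] [Hv1 Hv2]. simpl in *.
      refine (norm_compat1 (V := V) _ _ _ _).
      assert (E : minus (RInt f v1 v2) (RInt f u1 u2) = plus (RInt f v1 u1) (RInt f u2 v2)).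
      { rewrite <- (RInt_Chasles f v1 u1 v2) by apply Hex. rewrite <- (RInt_Chasles f u1 u2 v2) by apply Hex.
        unfold minus. rewrite <- !plus_assoc. f_equal. rewrite plus_comm, <- plus_assoc, plus_opp_l, plus_zero_r. reflexivity. }
      eapply Rle_lt_trans; [right; apply (f_equal norm E)|].
      eapply Rle_lt_trans; [apply (norm_triangle (V := V))|].
      assert (Q1 : norm (RInt f v1 u1) <= eps / 3) by (apply Hs; right; split; lra).
      assert (Q2 : norm (RInt f u2 v2) <= eps / 3) by (apply Hs; left; split; lra).
      eapply Rle_lt_trans; [apply Rplus_le_compat; [apply Q1|apply Q2]|]. lra. }
  destruct HF as (l & Hl). exists l. unfold is_RInt_gen.
  apply (filterlimi_lim_ext (fun ab : R * R => RInt f (fst ab) (snd ab))).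
  intros ab. apply RInt_correct, Hex. exact Hl.
Qed.

Lemma RInt_gen_approx (f : R -> V) : ex_RInt_gen f (Rbar_locally m_infty) (Rbar_locally p_infty) ->
  forall eps, 0 < eps -> exists T, 0 <= T /\ forall a b, a <= - T -> T <= b ->
    norm (minus (RInt f a b) (RInt_gen f (Rbar_locally m_infty) (Rbar_locally p_infty))) <= eps.
Proof.
  intros H eps He. apply RInt_gen_correct in H. set (l := RInt_gen f _ _) in *.
  unfold is_RInt_gen in H.
  assert (Hp : 0 < eps / (@norm_factor _ V)) by (apply Rdiv_lt_0_compat; [auto|apply norm_factor_gt_0]).
  apply filterlimi_locally with (eps := mkposreal _ Hp) in H.
  destruct H as [Q1 Q2 (M1 & H1) (M2 & H2) H].
  exists (Rabs M1 + Rabs M2 + 1). split. assert (X := Rabs_pos M1). assert (Y := Rabs_pos M2). lra.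
  intros a b Ha Hb.
  assert (X := Rabs_pos M1). assert (Y := Rabs_pos M2). assert (X' := Rle_abs (- M1)). rewrite Rabs_Ropp in X'. assert (Y' := Rle_abs M2).
  destruct (H a b) as (y & Hy & B). apply H1. lra. apply H2. lra.
  assert (Ey := is_RInt_unique _ _ _ _ Hy). simpl in Ey. rewrite Ey. apply Rlt_le.
  eapply Rlt_le_trans; [apply (norm_compat2 (V := V)); apply B|]. simpl. right. field.
  apply Rgt_not_eq, norm_factor_gt_0.
Qed.
End Improper.

(** * Directions and cones *)

Lemma Cmod_polar r th : 0 <= r -> Cmod (polar r th) = r.
Proof.
  intros H. unfold Cmod, polar. simpl. assert (S := sin2_cos2 th). unfold Rsqr in S.
  replace (r * cos th * (r * cos th * 1) + r * sin th * (r * sin th * 1)) with (r * r * (sin th * sin th + cos th * cos th)) by ring.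
  rewrite S, Rmult_1_r. now apply sqrt_square.
Qed.

Lemma polar_minus r r' th : (polar r th - polar r' th)%C = polar (r - r') th.
Proof. unfold polar, Cminus, Cplus, Copp; simpl. f_equal; ring. Qed.

Lemma Cmod_polar_abs r th : Cmod (polar r th) = Rabs r.
Proof.
  destruct (Rle_lt_dec 0 r). rewrite Cmod_polar, Rabs_pos_eq; auto.
  replace (polar r th) with (- polar (- r) th)%C. rewrite Cmod_opp, Cmod_polar, Rabs_left; lra.
  unfold polar, Copp; simpl; f_equal; ring.
Qed.

(** A ray of direction [th] stays at bounded distance from the ray of the same
    direction starting at the origin, point by point at equal modulus. *)
Lemma ray_asymptotic c th s : on_ray c th s -> Cmod (s - polar (Cmod s) th)%C <= 2 * Cmod c.
Proof.
  intros (rho & Hr & ->). set (s := (c + polar rho th)%C).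
  replace (s - polar (Cmod s) th)%C with (c + (polar rho th - polar (Cmod s) th))%C by (unfold s; ring).
  eapply Rle_trans; [apply Cmod_triangle|]. rewrite polar_minus, Cmod_polar_abs.
  assert (A : Cmod s <= Cmod c + rho). { unfold s. eapply Rle_trans; [apply Cmod_triangle|]. rewrite Cmod_polar; lra. }
  assert (B : rho - Cmod c <= Cmod s).
  { unfold s. rewrite Cplus_comm. eapply Rle_trans; [|apply Cmod_triangle_rev]. rewrite Cmod_polar; lra. }
  assert (Rabs (rho - Cmod s) <= Cmod c) by (apply Rabs_le; lra). lra.
Qed.

Lemma ray_coordinates c th s : on_ray c th s ->
  Rabs (Re s - Cmod s * cos th) <= 2 * Cmod c /\ Rabs (Im s - Cmod s * sin th) <= 2 * Cmod c.
Proof.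
  intros H. apply ray_asymptotic in H. split; (eapply Rle_trans; [|apply H]).
  change (Re s - Cmod s * cos th) with (Re (s - polar (Cmod s) th)%C). apply re_le_Cmod.
  change (Im s - Cmod s * sin th) with (Im (s - polar (Cmod s) th)%C). apply Im_le_Cmod.
Qed.

(** A convex cone around directions [theta] with [0 < iota sin theta < sigma cos theta]
    ([iota], [sigma] being signs): it stays away from the real axis and [Re s^2 > 0] on it. *)
Definition in_cone (kappa sigma iota : R) (s : C) : Prop :=
  kappa * Cmod s <= iota * Im s /\ (1 + kappa) * (iota * Im s) <= sigma * Re s.

(** A sign, [1] or [-1]. *)
Definition is_sign (x : R) : Prop := x = 1 \/ x = -1.

Lemma sign_abs x y : is_sign x -> x * y <= Rabs y.
Proof. intros [-> | ->]. assert (Q := Rle_abs y). lra. assert (Q := Rle_abs (- y)). rewrite Rabs_Ropp in Q. lra. Qed.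

Lemma in_cone_Im kappa sigma iota s : is_sign iota -> in_cone kappa sigma iota s -> kappa * Cmod s <= Rabs (Im s).
Proof. intros Hi [H _]. eapply Rle_trans; [apply H|]. now apply sign_abs. Qed.

Lemma in_cone_Re_sq kappa sigma iota s : is_sign sigma -> is_sign iota -> 0 < kappa -> in_cone kappa sigma iota s ->
  2 * kappa ^ 3 * Cmod s ^ 2 <= Re (s * s)%C.
Proof.
  intros Hs Hi Hk [H1 H2]. assert (P := Cmod_ge_0 s).
  assert (Q : 0 <= kappa * Cmod s) by (apply Rmult_le_pos; lra).
  set (y := iota * Im s) in *. set (x := sigma * Re s) in *.
  replace (Re (s * s)%C) with (x * x - y * y).
  2:{ unfold x, y. destruct Hs as [-> | ->], Hi as [-> | ->]; destruct s; simpl; ring. }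
  assert (X : ((1 + kappa) * y) * ((1 + kappa) * y) <= x * x) by (apply Rmult_le_compat; nra).
  assert (Y : (kappa * Cmod s) * (kappa * Cmod s) <= y * y) by (apply Rmult_le_compat; lra).
  assert (Z : 2 * kappa * ((kappa * Cmod s) * (kappa * Cmod s)) <= 2 * kappa * (y * y)) by (apply Rmult_le_compat_l; lra).
  replace (2 * kappa ^ 3 * Cmod s ^ 2) with (2 * kappa * ((kappa * Cmod s) * (kappa * Cmod s))) by ring.
  assert (W : 0 <= kappa ^ 2 * (y * y)) by (apply Rmult_le_pos; [apply pow2_ge_0|nra]). nra.
Qed.

Lemma in_cone_convex kappa sigma iota : 0 < kappa -> Cconvex (in_cone kappa sigma iota).
Proof.
  intros Hk z w t [H1 H2] [H3 H4] Ht.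
  assert (E : (z + RtoC t * (w - z))%C = (RtoC (1 - t) * z + RtoC t * w)%C) by (rewrite RtoC_minus; ring).
  assert (M : Cmod (z + RtoC t * (w - z))%C <= (1 - t) * Cmod z + t * Cmod w).
  { rewrite E. eapply Rle_trans; [apply Cmod_triangle|]. rewrite !Cmod_mult, !Cmod_R, !Rabs_pos_eq by lra. lra. }
  unfold in_cone. rewrite (part_segment Im _ _ _ part_Im), (part_segment Re _ _ _ part_Re).
  split.
  - apply Rle_trans with (kappa * ((1 - t) * Cmod z + t * Cmod w)). apply Rmult_le_compat_l; lra.
    assert (A1 : (1 - t) * (kappa * Cmod z) <= (1 - t) * (iota * Im z)) by (apply Rmult_le_compat_l; lra).
    assert (A2 : t * (kappa * Cmod w) <= t * (iota * Im w)) by (apply Rmult_le_compat_l; lra). nra.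
  - assert (A1 : (1 - t) * ((1 + kappa) * (iota * Im z)) <= (1 - t) * (sigma * Re z)) by (apply Rmult_le_compat_l; lra).
    assert (A2 : t * ((1 + kappa) * (iota * Im w)) <= t * (sigma * Re w)) by (apply Rmult_le_compat_l; lra). nra.
Qed.

Lemma ray_in_cone th sigma iota : is_sign sigma -> is_sign iota -> 0 < iota * sin th -> iota * sin th < sigma * cos th ->
  exists k0, 0 < k0 /\ forall kappa, 0 < kappa <= k0 -> forall c, exists R0, 0 < R0 /\
    forall s, on_ray c th s -> R0 <= Cmod s -> in_cone kappa sigma iota s.
Proof.
  intros Hs Hi H1 H2. set (S := iota * sin th) in *. set (X := sigma * cos th) in *.
  assert (HS1 : S <= 1). { unfold S. eapply Rle_trans; [apply sign_abs; auto|]. apply Rabs_le, SIN_bound. }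
  set (k0 := Rmin (S / 2) ((X - S) / 2)). assert (Hk0 : 0 < k0) by (apply Rmin_pos; lra).
  assert (Q1 := Rmin_l (S / 2) ((X - S) / 2)). assert (Q2 := Rmin_r (S / 2) ((X - S) / 2)). fold k0 in Q1, Q2.
  exists k0. split; auto. intros kappa Hk c. set (B := 2 * Cmod c). assert (PB : 0 <= B) by (assert (T := Cmod_ge_0 c); unfold B; lra).
  set (R0 := 3 * B / k0 + B / k0 * kappa + 1).
  assert (PBk : 0 <= B / k0) by (apply Rmult_le_pos; [lra|left; now apply Rinv_0_lt_compat]).
  exists R0. split. { unfold R0, Rdiv in *. nra. }
  intros s Hray Hbig. destruct (ray_coordinates c th s Hray) as [A1 A2]. fold B in A1, A2.
  set (r := Cmod s) in *.
  assert (A3 : B * (3 + kappa) <= k0 * r).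
  { apply Rle_trans with (k0 * R0). unfold R0. replace (k0 * (3 * B / k0 + B / k0 * kappa + 1)) with (B * (3 + kappa) + k0) by (field; lra). lra.
    apply Rmult_le_compat_l; lra. }
  assert (Y1 : Rabs (iota * Im s - r * S) <= B).
  { replace (iota * Im s - r * S) with (iota * (Im s - r * sin th)) by (unfold S; ring).
    destruct Hi as [-> | ->]. now rewrite Rmult_1_l. replace (-1 * (Im s - r * sin th)) with (- (Im s - r * sin th)) by ring. now rewrite Rabs_Ropp. }
  assert (X1 : Rabs (sigma * Re s - r * X) <= B).
  { replace (sigma * Re s - r * X) with (sigma * (Re s - r * cos th)) by (unfold X; ring).
    destruct Hs as [-> | ->]. now rewrite Rmult_1_l. replace (-1 * (Re s - r * cos th)) with (- (Re s - r * cos th)) by ring. now rewrite Rabs_Ropp. }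
  apply Rabs_le_between in Y1. apply Rabs_le_between in X1.
  assert (Pr : 0 <= r) by apply Cmod_ge_0.
  assert (PBk2 : 0 <= B * kappa) by (apply Rmult_le_pos; lra).
  unfold in_cone. fold r. split.
  - assert (kappa * r <= k0 * r) by (apply Rmult_le_compat_r; lra).
    assert (k0 * r <= S / 2 * r) by (apply Rmult_le_compat_r; lra). nra.
  - apply Rle_trans with ((1 + kappa) * (r * S + B)). apply Rmult_le_compat_l; lra.
    assert (kappa * S <= k0 * 1) by (apply Rmult_le_compat; lra).
    assert (r * (kappa * S) <= r * k0) by (apply Rmult_le_compat_l; lra).
    assert (r * (2 * k0) <= r * (X - S)) by (apply Rmult_le_compat_l; lra). nra.
Qed.

Lemma cos_double_sin_cos th : cos (2 * th) = cos th * cos th - sin th * sin th.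
Proof. replace (2 * th) with (th + th) by ring. apply cos_plus. Qed.

(** The sign [sigma] of the cosine tells apart the two sectors of directions with
    [cos (2 theta) > 0] in a half plane. *)
Lemma good_direction th iota : is_sign iota -> 0 < iota * sin th -> 0 < cos (2 * th) ->
  exists sigma, is_sign sigma /\ iota * sin th < sigma * cos th.
Proof.
  intros Hi Hs Hc. rewrite cos_double_sin_cos in Hc.
  assert (E : sin th * sin th = (iota * sin th) * (iota * sin th)) by (destruct Hi as [-> | ->]; ring).
  rewrite E in Hc. destruct (Rle_lt_dec 0 (cos th)).
  - exists 1. split. now left. nra.
  - exists (-1). split. now right. nra.
Qed.

Lemma ray_vertical c th s : cos th = 0 -> on_ray c th s -> 8 * Cmod c <= Cmod s ->
  Re (s * s)%C <= - (Cmod s ^ 2 / 2) /\ / 2 * Cmod s <= Rabs (Im s).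
Proof.
  intros Hc Hr Hbig. destruct (ray_coordinates c th s Hr) as [A1 A2]. rewrite Hc in A1.
  replace (Re s - Cmod s * 0) with (Re s) in A1 by ring.
  assert (E := Cmod2_alt s). assert (P := Cmod_ge_0 s). assert (Pc := Cmod_ge_0 c).
  assert (X : Re s ^ 2 <= Cmod s ^ 2 / 16).
  { rewrite <- (pow2_abs (Re s)). apply Rle_trans with ((Cmod s / 4) ^ 2). apply pow_incr. split. apply Rabs_pos. lra. right; field. }
  split.
  - replace (Re (s * s)%C) with (Re s ^ 2 - Im s ^ 2) by (destruct s; simpl; ring). assert (0 <= Cmod s ^ 2) by apply pow2_ge_0. lra.
  - apply Rsqr_incr_0_var. 2: apply Rabs_pos. unfold Rsqr.
    replace (Rabs (Im s) * Rabs (Im s)) with (Im s ^ 2) by (rewrite <- (pow2_abs (Im s)); ring).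
    assert (0 <= Cmod s ^ 2) by apply pow2_ge_0. nra.
Qed.

(** * Weights *)

Lemma Ccont_Cmod f z : Ccont f z -> Ccont (fun s => RtoC (Cmod (f s))) z.
Proof.
  intros H eps He. destruct (H eps He) as (d & Hd & Hh). exists d. split; auto. intros h Hhd.
  rewrite <- RtoC_minus, Cmod_R. eapply Rle_trans; [|apply (Hh h Hhd)].
  assert (T1 := Cmod_triangle (f z) (f (z + h) - f z)%C). replace (f z + (f (z + h) - f z))%C with (f (z + h)%C) in T1 by ring.
  assert (T2 := Cmod_triangle (f (z + h)%C) (f z - f (z + h))%C). replace (f (z + h) + (f z - f (z + h)))%C with (f z) in T2 by ring.
  rewrite Cmod_sub_comm in T2. apply Rabs_le. lra.
Qed.

Lemma Ccont_exp h z : Ccont (fun s => RtoC (h s)) z -> Ccont (fun s => RtoC (exp (h s))) z.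
Proof.
  intros H. apply Ccont_ext_loc with (fun s => Cexp (RtoC (h s))) 1. lra.
  - intros y _. unfold Cexp, RtoC; simpl. rewrite cos_0, sin_0. f_equal; ring.
  - apply (Ccont_comp Cexp (fun s => RtoC (h s))); auto. eapply Cderiv_cont, Cderiv_Cexp.
Qed.

(** The modulus of [f] with an exponential weight. *)
Definition weight (f : C -> C) (A : R) (s : C) : R := Cmod (f s) * exp (A * Cmod s).

Lemma Rcont_weight f A z : Ccont f z -> Rcont (weight f A) z.
Proof.
  intros H. unfold Rcont, weight.
  apply Ccont_ext_loc with (fun s => RtoC (Cmod (f s)) * RtoC (exp (A * Cmod s)))%C 1. lra.
  intros; now rewrite RtoC_mult.
  apply Ccont_mult. now apply Ccont_Cmod.
  apply (Ccont_exp (fun s => A * Cmod s)).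
  apply Ccont_ext_loc with (fun s => RtoC A * RtoC (Cmod s))%C 1. lra. intros; now rewrite RtoC_mult.
  apply Ccont_mult. apply Ccont_const. apply (Ccont_Cmod (fun s => s)). eapply Cderiv_cont, Cderiv_id.
Qed.

Lemma weight_ge0 f A s : 0 <= weight f A s.
Proof. apply Rmult_le_pos. apply Cmod_ge_0. left; apply exp_pos. Qed.

(** [f] decays faster than every exponential along all rays of direction [th]. *)
Definition ray_decay (f : C -> C) (th : R) : Prop :=
  forall c B, exists R0, forall s, on_ray c th s -> R0 <= Cmod s -> Cmod (f s) <= exp (- (B * Cmod s)).

Lemma grows_like_ray_decay tau g x th iota : 0 < tau -> x < 0 -> (forall kappa, 0 < kappa -> grows_like tau kappa g x) ->
  is_sign iota -> 0 < iota * sin th -> 0 < cos (2 * th) -> ray_decay g th.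
Proof.
  intros Ht Hx Hg Hi Hs Hc c B.
  destruct (good_direction th iota Hi Hs Hc) as (sigma & Hsg & Hlt).
  destruct (ray_in_cone th sigma iota Hsg Hi Hs Hlt) as (k0 & Hk0 & Hcone).
  destruct (Hcone k0 ltac:(lra) c) as (R1 & HR1 & H1).
  destruct (grows_like_decay tau k0 g x (2 * k0 ^ 3) B Ht Hk0 Hx) as (R2 & HR2 & H2); auto.
  { assert (0 < k0 ^ 3) by (apply pow_lt; auto). lra. }
  exists (Rmax R1 R2). intros s Hray Hbig.
  assert (C1 := H1 s Hray ltac:(eapply Rle_trans; [apply Rmax_l|apply Hbig])).
  apply H2. eapply Rle_trans; [apply Rmax_r|apply Hbig].
  exact (in_cone_Im k0 sigma iota s Hi C1). exact (in_cone_Re_sq k0 sigma iota s Hsg Hi Hk0 C1).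
Qed.

Lemma Cconv_zero_plus u v l : Cconv u l -> (forall eps, 0 < eps -> exists N, forall n, (N <= n)%nat -> Cmod (v n - u n)%C <= eps) -> Cconv v l.
Proof.
  intros H H' eps He. destruct (H (eps/2) ltac:(lra)) as (N & HN). destruct (H' (eps/2) ltac:(lra)) as (N' & HN').
  exists (N + N')%nat. intros n Hn. replace (v n - l)%C with ((v n - u n) + (u n - l))%C by ring.
  eapply Rle_trans; [apply Cmod_triangle|]. assert (A := HN n ltac:(lia)). assert (A' := HN' n ltac:(lia)). lra.
Qed.

Lemma Cconv_unique u l l' : Cconv u l -> Cconv u l' -> l = l'.
Proof. intros H H'. rewrite <- (Cconv_Clim_seq _ _ H). now apply Cconv_Clim_seq. Qed.

Lemma Copen_of_open (U : C -> Prop) : open U -> Copen U.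
Proof.
  intros H z Hz. destruct (H z Hz) as (eps & He). exists eps. split. apply cond_pos.
  intros y Hy. apply He. now apply C_NormedModule_mixin_compat1.
Qed.

Lemma open_of_Copen (U : C -> Prop) : Copen U -> open U.
Proof.
  intros H z Hz. destruct (H z Hz) as (r & Hr & HU).
  assert (H2 : 0 < r / 2) by lra. exists (mkposreal _ H2). intros y Hy.
  apply HU. apply C_NormedModule_mixin_compat2 in Hy. simpl in Hy. eapply Rlt_le_trans; [apply Hy|].
  assert (sqrt 2 <= 2). { rewrite <- (sqrt_pow2 2) at 2 by lra. apply sqrt_le_1; lra. } nra.
Qed.

(** The increments of the logarithm become small far from the real axis. *)
Lemma Clog_sub_small s p : Rabs (Im s) >= 2 * Cmod p + 1 -> Cmod (Clog (s - p) - Clog s)%C <= 4 * Cmod p / Rabs (Im s).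
Proof.
  intros H. assert (P := Cmod_ge_0 p). assert (Hs : 0 < Rabs (Im s)) by lra.
  assert (Seg : forall t, 0 <= t <= 1 -> Rabs (Im s) / 2 <= Rabs (Im (s + RtoC t * (- p))%C)).
  { intros t Ht. replace (Im (s + RtoC t * (- p))%C) with (Im s + - (t * Im p)) by (destruct s, p; simpl; ring).
    assert (Q := Im_le_Cmod p). assert (Q2 : Rabs (t * Im p) <= Cmod p).
    { rewrite Rabs_mult, (Rabs_pos_eq t) by lra. assert (T := Rabs_pos (Im p)). nra. }
    assert (T := Rabs_triang (Im s + - (t * Im p)) (t * Im p)). replace (Im s + - (t * Im p) + t * Im p) with (Im s) in T by ring. lra. }
  assert (MV := Cderiv_mean_value Clog (fun y => / y)%C s (- p)%C (RtoC 0) (2 / Rabs (Im s))).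
  replace (Clog (s - p) - Clog s)%C with (Clog (s + - p) - Clog s - RtoC 0 * - p)%C by (unfold Cminus; ring).
  eapply Rle_trans; [apply MV|].
  - intros t Ht. apply Clog_deriv. left. specialize (Seg t Ht). intros E. rewrite E, Rabs_R0 in Seg. lra.
  - intros t Ht. specialize (Seg t Ht).
    set (y := (s + RtoC t * - p)%C) in *. replace (/ y - RtoC 0)%C with (/ y)%C by ring.
    assert (Q := Im_le_Cmod y). rewrite Cmod_inv by (apply neq_0_of_Cmod; lra).
    replace (2 / Rabs (Im s)) with (/ (Rabs (Im s) / 2)) by (field; lra). apply Rinv_le_contravar; lra.
  - rewrite Cmod_opp. right. field. lra.
Qed.

Section Contour.
Variables (Lp Lm : C -> Prop) (thm thp : R) (gamma : R -> C).
Hypothesis H : is_contour Lp Lm thm thp gamma.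

Let Hsm := contour_smooth _ _ _ _ _ H.
Let Hinj := contour_simple _ _ _ _ _ H.

Lemma contour_far X : exists T, 0 <= T /\ forall t, T <= Rabs t -> X <= Cmod (gamma t).
Proof.
  assert (Hp := contour_proper_p _ _ _ _ _ H). assert (Hm := contour_proper_m _ _ _ _ _ H).
  apply is_lim_spec in Hp. apply is_lim_spec in Hm. simpl in Hp, Hm.
  destruct (Hp X) as (T1 & H1). destruct (Hm X) as (T2 & H2).
  exists (Rabs T1 + Rabs T2 + 1). assert (A1 := Rabs_pos T1). assert (A2 := Rabs_pos T2).
  assert (B1 := Rle_abs T1). assert (B2 := Rle_abs (- T2)). rewrite Rabs_Ropp in B2.
  split. lra. intros t Ht. destruct (Rle_lt_dec 0 t).
  - rewrite (Rabs_pos_eq t) in Ht by auto. left. apply H1. lra.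
  - rewrite (Rabs_left t) in Ht by auto. left. apply H2. lra.
Qed.

Lemma contour_ends : exists cm cp T, 0 <= T /\ (forall t, T <= t -> on_ray cp thp (gamma t)) /\
  (forall t, t <= - T -> on_ray cm thm (gamma t)).
Proof.
  destruct (contour_rays _ _ _ _ _ H) as (cm & cp & rad & _ & (M1 & H1) & (M2 & H2)).
  exists cm, cp, (Rabs M1 + Rabs M2 + 1). assert (A1 := Rabs_pos M1). assert (A2 := Rabs_pos M2).
  assert (B1 := Rle_abs M2). assert (B2 := Rle_abs (- M1)). rewrite Rabs_Ropp in B2.
  split. lra. split; intros t Ht. apply H2; lra. apply H1; lra.
Qed.

Lemma sin_thp : 0 < sin thp.
Proof. destruct (contour_angle_p _ _ _ _ _ H). now apply sin_gt_0. Qed.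

Lemma sin_thm : 0 < -1 * sin thm.
Proof.
  destruct (contour_angle_m _ _ _ _ _ H). replace (-1 * sin thm) with (sin (- thm)) by (rewrite sin_neg; ring). apply sin_gt_0; lra.
Qed.

(** The ends of a contour go up and down, respectively, without bound. *)
Lemma contour_Im X : exists T, 0 <= T /\ (forall t, T <= t -> X <= Im (gamma t)) /\ (forall t, t <= - T -> Im (gamma t) <= - X).
Proof.
  destruct contour_ends as (cm & cp & T & HT & Hp & Hm).
  assert (S1 := sin_thp). assert (S2 := sin_thm).
  set (Y := (Rabs X + 2 * Cmod cp + 2 * Cmod cm)).
  assert (PX := Rabs_pos X). assert (Pp := Cmod_ge_0 cp). assert (Pm := Cmod_ge_0 cm). assert (LX := Rle_abs X).
  assert (PY : 0 <= Y) by (unfold Y; lra).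
  destruct (contour_far (Y / sin thp + Y / (-1 * sin thm))) as (T' & HT' & Hfar).
  assert (Q1 : 0 <= Y / sin thp) by (apply Rmult_le_pos; [lra|left; now apply Rinv_0_lt_compat]).
  assert (Q2 : 0 <= Y / (-1 * sin thm)) by (apply Rmult_le_pos; [lra|left; now apply Rinv_0_lt_compat]).
  exists (T + T'). split. lra. split; intros t Ht.
  - destruct (ray_coordinates _ _ _ (Hp t ltac:(lra))) as [_ A]. apply Rabs_le_between in A.
    assert (F := Hfar t ltac:(rewrite Rabs_pos_eq; lra)).
    assert (Y <= Cmod (gamma t) * sin thp).
    { apply Rle_trans with (Y / sin thp * sin thp). right; field; lra. apply Rmult_le_compat_r; lra. }
    unfold Y in *. lra.
  - destruct (ray_coordinates _ _ _ (Hm t ltac:(lra))) as [_ A]. apply Rabs_le_between in A.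
    assert (F := Hfar t ltac:(rewrite Rabs_left1; lra)).
    assert (Y <= Cmod (gamma t) * (-1 * sin thm)).
    { apply Rle_trans with (Y / (-1 * sin thm) * (-1 * sin thm)). right; field; lra. apply Rmult_le_compat_r; lra. }
    unfold Y in *. lra.
Qed.

(** * Integrability along a contour *)

Section Weight.
Variable f : C -> C.
Hypotheses (Hc : forall t, Ccont f (gamma t)) (Hdp : ray_decay f thp) (Hdm : ray_decay f thm).

Lemma ray_weight_small th c A : ray_decay f th -> forall eps, 0 < eps -> exists X,
  forall a b, a <= b -> (forall t, a <= t <= b -> on_ray c th (gamma t) /\ X <= Cmod (gamma t)) ->
  RInt (arc_integrand gamma (weight f A)) a b <= eps.
Proof.
  intros Hd eps He. destruct (Hd c (A + 1)) as (R0 & HR0).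
  set (K := exp (Cmod c) * exp (Cmod c)).
  assert (PK : 0 < K) by (apply Rmult_lt_0_compat; apply exp_pos).
  exists (Rmax R0 (ln (2 * K / eps))). intros a b Hab Hray.
  assert (HX1 := Rmax_l R0 (ln (2 * K / eps))). assert (HX2 := Rmax_r R0 (ln (2 * K / eps))).
  eapply Rle_trans.
  - apply (ray_arc_le gamma Hsm Hinj c th a b Hab) with (M := 1).
    + intros t Ht. now apply Hray.
    + lra.
    + intros t Ht. now apply Rcont_weight.
    + intros t Ht. destruct (Hray t Ht) as [R1 R2]. unfold weight.
      apply Rle_trans with (exp (- ((A + 1) * Cmod (gamma t))) * exp (A * Cmod (gamma t))).
      apply Rmult_le_compat_r. left; apply exp_pos. apply HR0; auto. lra.
      rewrite <- exp_plus, Rmult_1_l. right. f_equal. ring.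
  - assert (E : forall t, a <= t <= b -> exp (- Cmod (gamma t - c)%C) <= exp (Cmod c) * exp (- ln (2 * K / eps))).
    { intros t Ht. rewrite <- exp_plus. apply exp_le_compat. destruct (Hray t Ht) as [_ R2].
      assert (T := Cmod_triangle (gamma t - c)%C c). replace (gamma t - c + c)%C with (gamma t) in T by ring. lra. }
    assert (E1 := E a ltac:(lra)). assert (E2 := E b ltac:(lra)).
    assert (EL : exp (- ln (2 * K / eps)) = / (2 * K / eps)) by (rewrite exp_Ropp, exp_ln by (apply Rdiv_lt_0_compat; lra); reflexivity).
    rewrite EL in E1, E2.
    apply Rle_trans with (1 * exp (Cmod c) * (2 * (exp (Cmod c) * / (2 * K / eps)))).
    apply Rmult_le_compat_l. rewrite Rmult_1_l. left; apply exp_pos. lra.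
    right. fold K. unfold K. assert (PE := exp_pos (Cmod c)). field. split; lra.
Qed.

(** All weighted integrals of a decaying function over the ends are small. *)
Lemma contour_weight_tail A eps : 0 < eps -> exists T, 0 <= T /\
  forall a b, a <= b -> (T <= a \/ b <= - T) -> RInt (arc_integrand gamma (weight f A)) a b <= eps.
Proof.
  intros He. destruct contour_ends as (cm & cp & T & HT & Hp & Hm).
  destruct (ray_weight_small thp cp A Hdp eps He) as (X1 & H1).
  destruct (ray_weight_small thm cm A Hdm eps He) as (X2 & H2).
  destruct (contour_far (Rmax X1 X2)) as (T' & HT' & Hfar).
  exists (T + T'). split. lra. intros a b Hab [Ha|Hb].
  - apply H1; auto. intros t Ht. split. apply Hp; lra.
    eapply Rle_trans; [apply Rmax_l|apply Hfar]. rewrite Rabs_pos_eq; lra.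
  - apply H2; auto. intros t Ht. split. apply Hm; lra.
    eapply Rle_trans; [apply Rmax_r|apply Hfar]. rewrite Rabs_left1; lra.
Qed.

Let W A := arc_integrand gamma (weight f A).

Let W_ex A a b : a <= b -> ex_RInt (W A) a b.
Proof. intros Hab. apply arc_ex_RInt; auto. intros; now apply Rcont_weight. Qed.

Let W_pos A a b : a <= b -> 0 <= RInt (W A) a b.
Proof. intros Hab. apply arc_RInt_ge0; auto. intros; now apply Rcont_weight. intros; apply weight_ge0. Qed.

Lemma contour_weight_bounded A : exists M, 0 <= M /\ forall a b, a <= b -> RInt (arc_integrand gamma (weight f A)) a b <= M.
Proof.
  destruct (contour_weight_tail A 1 Rlt_0_1) as (T & HT & Ht).
  exists (1 + RInt (W A) (- T) T + 1). assert (P := W_pos A (- T) T ltac:(lra)). split. lra.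
  intros a b Hab. fold (W A).
  assert (Q1 := Rmin_l a (- T)). assert (Q2 := Rmin_r a (- T)). assert (Q3 := Rmax_l b T). assert (Q4 := Rmax_r b T).
  set (a' := Rmin a (- T)) in *. set (b' := Rmax b T) in *.
  assert (E1 : RInt (W A) a' b' = RInt (W A) a' a + RInt (W A) a b + RInt (W A) b b').
  { rewrite <- (RInt_Chasles (W A) a' b b'), <- (RInt_Chasles (W A) a' a b) by (apply W_ex; lra). reflexivity. }
  assert (E2 : RInt (W A) a' b' = RInt (W A) a' (- T) + RInt (W A) (- T) T + RInt (W A) T b').
  { rewrite <- (RInt_Chasles (W A) a' T b'), <- (RInt_Chasles (W A) a' (- T) T) by (apply W_ex; lra). reflexivity. }
  assert (P1 := W_pos A a' a ltac:(lra)). assert (P2 := W_pos A b b' ltac:(lra)).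
  assert (B1 := Ht a' (- T) ltac:(lra) ltac:(lra)). assert (B2 := Ht T b' ltac:(lra) ltac:(lra)). fold (W A) in B1, B2.
  lra.
Qed.

Variable k : C -> C.
Variables (Mk Ak : R).
Hypotheses (Hkc : forall t, Ccont k (gamma t)) (HMk : 0 <= Mk)
  (Hk : forall s, Cmod (k s) <= Mk * exp (Ak * Cmod s)).

Let g := fun s => (f s * k s)%C.

Lemma dominated_cont t : Ccont g (gamma t).
Proof. now apply Ccont_mult. Qed.

(** Integrals of [f k] are controlled by weighted integrals of [f] when [k] has
    at most exponential growth. *)
Lemma dominated_le a b l : a <= b -> is_Cint (contour_integrand g gamma) a b l ->
  Cmod l <= Mk * RInt (arc_integrand gamma (weight f Ak)) a b.
Proof.
  intros Hab Hl.
  assert (E : RInt (arc_integrand gamma (fun s => Mk * weight f Ak s)) a b = Mk * RInt (arc_integrand gamma (weight f Ak)) a b).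
  { assert (E0 := RInt_scal (W Ak) a b Mk (W_ex Ak a b Hab)).
    change (RInt (fun y => Mk * W Ak y) a b = Mk * RInt (W Ak) a b) in E0. unfold W in E0 at 2. rewrite <- E0.
    apply RInt_ext. intros t _. change (Mk * weight f Ak (gamma t) * Cmod (curve_derive gamma t) = Mk * (weight f Ak (gamma t) * Cmod (curve_derive gamma t))). ring. }
  rewrite <- E. apply (contour_norm_le gamma Hsm g); auto.
  - intros t _. unfold Rcont. apply Ccont_ext_loc with (fun s => RtoC Mk * RtoC (weight f Ak s))%C 1. lra.
    intros; now rewrite RtoC_mult. apply Ccont_mult. apply Ccont_const. now apply Rcont_weight.
  - intros t _. unfold g, weight. rewrite Cmod_mult.
    replace (Mk * (Cmod (f (gamma t)) * exp (Ak * Cmod (gamma t)))) with (Cmod (f (gamma t)) * (Mk * exp (Ak * Cmod (gamma t)))) by ring.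
    apply Rmult_le_compat_l. apply Cmod_ge_0. apply Hk.
Qed.

Lemma contour_dominated_ex : contour_ex_RInt g gamma.
Proof.
  refine (ex_RInt_gen_of_tail (V := C_R_CompleteNormedModule) (contour_integrand g gamma) _ _).
  - intros a b Hab. apply (contour_ex_Cint gamma Hsm g); auto. intros; apply dominated_cont.
  - intros eps He. destruct (contour_weight_tail Ak (eps / (Mk + 1))) as (T & HT & Ht). apply Rdiv_lt_0_compat; lra.
    exists T. split; auto. intros a b Hab Hor.
    assert (Ex : ex_RInt (V := C_R_NormedModule) (contour_integrand g gamma) a b).
    { apply (contour_ex_Cint gamma Hsm g); auto. intros; apply dominated_cont. }
    apply (RInt_correct (V := C_R_CompleteNormedModule)) in Ex.
    assert (Q := dominated_le a b _ Hab Ex). rewrite Cmod_norm in Q. eapply Rle_trans; [apply Q|].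
    apply Rle_trans with ((Mk + 1) * (eps / (Mk + 1))).
    + specialize (Ht a b Hab Hor). assert (P := W_pos Ak a b Hab). fold (W Ak) in *. apply Rmult_le_compat; lra.
    + right; field; lra.
Qed.

Lemma contour_dominated_abs : contour_abs_finite g gamma.
Proof.
  assert (Ce : forall t, Rcont (fun s => Cmod (g s)) (gamma t)).
  { intros t. apply Ccont_Cmod, dominated_cont. }
  unfold contour_abs_finite.
  apply (ex_RInt_gen_ext_eq (V := R_NormedModule) (arc_integrand gamma (fun s => Cmod (g s)))).
  { intros t. unfold arc_integrand, contour_integrand. now rewrite Cmod_mult. }
  refine (ex_RInt_gen_of_tail (V := R_CompleteNormedModule) (arc_integrand gamma (fun s => Cmod (g s))) _ _).
  - intros a b Hab. apply arc_ex_RInt; auto.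
  - intros eps He. destruct (contour_weight_tail Ak (eps / (Mk + 1))) as (T & HT & Ht). apply Rdiv_lt_0_compat; lra.
    exists T. split; auto. intros a b Hab Hor.
    change (Rabs (RInt (arc_integrand gamma (fun s => Cmod (g s))) a b) <= eps).
    rewrite Rabs_pos_eq by (apply arc_RInt_ge0; auto; intros; apply Cmod_ge_0).
    assert (E : RInt (arc_integrand gamma (fun s => Mk * weight f Ak s)) a b = Mk * RInt (arc_integrand gamma (weight f Ak)) a b).
    { assert (E0 := RInt_scal (W Ak) a b Mk (W_ex Ak a b Hab)).
    change (RInt (fun y => Mk * W Ak y) a b = Mk * RInt (W Ak) a b) in E0. unfold W in E0 at 2. rewrite <- E0.
      apply RInt_ext. intros t _. change (Mk * weight f Ak (gamma t) * Cmod (curve_derive gamma t) = Mk * (weight f Ak (gamma t) * Cmod (curve_derive gamma t))). ring. }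
    apply Rle_trans with (Mk * RInt (arc_integrand gamma (weight f Ak)) a b).
    + rewrite <- E. apply arc_RInt_le; auto.
      * intros t _. unfold Rcont. apply Ccont_ext_loc with (fun s => RtoC Mk * RtoC (weight f Ak s))%C 1. lra.
        intros; now rewrite RtoC_mult. apply Ccont_mult. apply Ccont_const. now apply Rcont_weight.
      * intros t _. unfold g, weight. rewrite Cmod_mult.
        replace (Mk * (Cmod (f (gamma t)) * exp (Ak * Cmod (gamma t)))) with (Cmod (f (gamma t)) * (Mk * exp (Ak * Cmod (gamma t)))) by ring.
        apply Rmult_le_compat_l. apply Cmod_ge_0. apply Hk.
    + apply Rle_trans with ((Mk + 1) * (eps / (Mk + 1))).
      * specialize (Ht a b Hab Hor). assert (P := W_pos Ak a b Hab). fold (W Ak) in *. apply Rmult_le_compat; lra.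
      * right; field; lra.
Qed.
End Weight.

(** * The index of a point *)

(** The Cauchy kernel [1 / (s - p)]. *)
Definition cauchy_kernel (p s : C) : C := (/ (s - p))%C.

(** The integral of the Cauchy kernel over a piece of the contour. *)
Definition Jint (p : C) (a b : R) : C := RInt (V := C_R_CompleteNormedModule) (contour_integrand (cauchy_kernel p) gamma) a b.

Lemma Ccont_cauchy_kernel p s : s <> p -> Ccont (cauchy_kernel p) s.
Proof.
  intros N. apply (hol_cont (fun z => z <> p)); auto. apply (hol_inv_sub (fun z => z <> p) p). auto.
Qed.

Lemma is_Cint_unique f a b l : is_Cint f a b l -> RInt (V := C_R_CompleteNormedModule) f a b = l.
Proof. intros Q. apply (is_RInt_unique (V := C_R_CompleteNormedModule)). exact Q. Qed.

Lemma Jint_FTC F p a b : a <= b -> (forall t, a <= t <= b -> gamma t <> p /\ Cderiv F (gamma t) (/ (gamma t - p))%C) ->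
  Jint p a b = (F (gamma b) - F (gamma a))%C.
Proof.
  intros Hab HF. apply is_Cint_unique. apply (contour_FTC gamma Hsm F (cauchy_kernel p)); auto.
  intros t Ht. destruct (HF t Ht). split; auto. now apply Ccont_cauchy_kernel.
Qed.

(** The index of [p], normalised as the limit of the integral of [ds / (s - p)] minus the
    variation of the principal logarithm between the two ends. The ends stay away
    from the cut, so that this only compares the contour with a path that crosses
    the positive half line. *)
Definition has_index (p v : C) : Prop :=
  Cconv (fun n => Jint p (- INR n) (INR n) - Clog (gamma (INR n)) + Clog (gamma (- INR n)))%C v.

(** The index is locally constant: [Clog ((s - p') / (s - p))] is a primitive of the
    difference of the two kernels along the contour as soon as [|p - p'|] is smaller
    than the distance from the contour to [p]. *)
Lemma has_index_near p p' v d : 0 < d -> (forall t, 2 * d <= Cmod (gamma t - p)%C) -> Cmod (p' - p)%C < d ->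
  has_index p v -> has_index p' v.
Proof.
  intros Hd Hg Hp Hi. apply (Cconv_zero_plus _ _ _ Hi).
  assert (Hg' : forall t, d <= Cmod (gamma t - p')%C).
  { intros t. specialize (Hg t). replace (gamma t - p)%C with ((gamma t - p') + (p' - p))%C in Hg by ring.
    assert (T := Cmod_triangle (gamma t - p')%C (p' - p)%C). lra. }
  set (q := fun s => (1 + (p - p') * / (s - p))%C).
  assert (Hq : forall t, 0 < Re (q (gamma t))).
  { intros t. unfold q. assert (N : Cmod ((p - p') * / (gamma t - p))%C <= 1 / 2).
    { rewrite Cmod_mult, Cmod_inv by (apply neq_0_of_Cmod; specialize (Hg t); lra). rewrite Cmod_sub_comm.
      apply Rle_trans with (d * / (2 * d)). apply Rmult_le_compat. apply Cmod_ge_0. left; apply Rinv_0_lt_compat; specialize (Hg t); lra. lra.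
      apply Rinv_le_contravar. lra. apply Hg. right; field; lra. }
    apply Re_1_plus_pos in N. lra. }
  assert (Np : forall t, gamma t <> p) by (intros t E; specialize (Hg t); rewrite E in Hg; replace (p - p)%C with (RtoC 0) in Hg by ring; rewrite Cmod_0 in Hg; lra).
  assert (Np' : forall t, gamma t <> p') by (intros t E; specialize (Hg' t); rewrite E in Hg'; replace (p' - p')%C with (RtoC 0) in Hg' by ring; rewrite Cmod_0 in Hg'; lra).
  assert (Dq : forall t, Cderiv (fun s => Clog (q s)) (gamma t) (/ (gamma t - p') - / (gamma t - p))%C).
  { intros t. assert (N1 := sub_neq_0 _ _ (Np t)). assert (N2 := sub_neq_0 _ _ (Np' t)).
    assert (Dsub : Cderiv (fun s => s - p)%C (gamma t) (RtoC 1)).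
    { eapply Cderiv_eq. apply Cderiv_minus. apply Cderiv_id. apply Cderiv_const. ring. }
    eapply Cderiv_eq. apply (Cderiv_comp Clog q).
    apply (Cderiv_plus (fun _ => RtoC 1) (fun s => (p - p') * / (s - p))%C). apply Cderiv_const.
    apply (Cderiv_scal (p - p')%C (fun s => / (s - p))%C).
    apply (Cderiv_comp (fun y => / y)%C (fun s => s - p)%C). apply Dsub. now apply Cderiv_inv.
    apply Clog_deriv. right. apply Hq.
    unfold q. assert (Eq : (1 + (p - p') * / (gamma t - p))%C = ((gamma t - p') / (gamma t - p))%C) by (field; auto).
    rewrite Eq. field. auto. }
  assert (EJ : forall n, (Jint p' (- INR n) (INR n) - Jint p (- INR n) (INR n))%C = (Clog (q (gamma (INR n))) - Clog (q (gamma (- INR n))))%C).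
  { intros n. assert (Pn := pos_INR n).
    assert (X1 : is_Cint (contour_integrand (cauchy_kernel p) gamma) (- INR n) (INR n) (Jint p (- INR n) (INR n))).
    { apply (RInt_correct (V := C_R_CompleteNormedModule)). apply (contour_ex_Cint gamma Hsm); [lra|]. intros; now apply Ccont_cauchy_kernel. }
    assert (X2 : is_Cint (contour_integrand (cauchy_kernel p') gamma) (- INR n) (INR n) (Jint p' (- INR n) (INR n))).
    { apply (RInt_correct (V := C_R_CompleteNormedModule)). apply (contour_ex_Cint gamma Hsm); [lra|]. intros; now apply Ccont_cauchy_kernel. }
    assert (X3 := is_RInt_minus (V := C_R_NormedModule) _ _ _ _ _ _ X2 X1).
    assert (X4 := contour_FTC gamma Hsm (fun s => Clog (q s)) (fun s => cauchy_kernel p' s - cauchy_kernel p s)%C (- INR n) (INR n) ltac:(lra)).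
    rewrite <- (is_Cint_unique _ _ _ _ (X4 ltac:(intros t _; split; [apply Dq|apply (Ccont_plus (cauchy_kernel p') (fun s => - cauchy_kernel p s)%C);
       [now apply Ccont_cauchy_kernel|apply (hol_cont (fun z => z <> p)); [apply hol_opp, hol_inv_sub; auto|auto]]]))).
    symmetry. apply is_Cint_unique. eapply is_RInt_ext; [|apply X3].
    intros t _. change ((cauchy_kernel p' (gamma t) * curve_derive gamma t - cauchy_kernel p (gamma t) * curve_derive gamma t)%C
      = ((cauchy_kernel p' (gamma t) - cauchy_kernel p (gamma t)) * curve_derive gamma t)%C). ring. }
  (* both boundary terms tend to [Clog 1 = 0] because [q (gamma t)] tends to [1] *)
  intros eps He.
  assert (C1 : Ccont Clog (RtoC 1)) by (eapply Cderiv_cont, Clog_deriv; right; simpl; lra).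
  destruct (C1 (eps / 2) ltac:(lra)) as (e & Hep & Hcl).
  assert (Pq : 0 <= Cmod (p - p')%C) by apply Cmod_ge_0.
  destruct (contour_far (Cmod p + 2 * (Cmod (p - p')%C + 1) / e)) as (T & HT & Hfar).
  assert (Small : forall t, T <= Rabs t -> Cmod (Clog (q (gamma t))) <= eps / 2).
  { intros t Ht. specialize (Hfar t Ht). unfold q.
    replace (Clog (1 + (p - p') * / (gamma t - p))) with (Clog (RtoC 1 + (p - p') * / (gamma t - p)) - Clog (RtoC 1))%C by (rewrite Clog_1; ring).
    apply Hcl. assert (N := sub_neq_0 _ _ (Np t)). rewrite Cmod_mult, Cmod_inv by auto.
    assert (T1 := Cmod_triangle (gamma t - p)%C p). replace (gamma t - p + p)%C with (gamma t) in T1 by ring.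
    assert (Pe : 0 < 2 * (Cmod (p - p')%C + 1) / e) by (apply Rdiv_lt_0_compat; lra).
    apply Rle_lt_trans with (Cmod (p - p')%C * / (2 * (Cmod (p - p')%C + 1) / e)).
    apply Rmult_le_compat_l; auto. apply Rinv_le_contravar; lra.
    apply Rle_lt_trans with (Cmod (p - p')%C / (Cmod (p - p')%C + 1) * (e / 2)). right; field; lra.
    apply Rle_lt_trans with (1 * (e / 2)); [|lra]. apply Rmult_le_compat_r. lra.
    apply Rmult_le_reg_r with (Cmod (p - p')%C + 1). lra. unfold Rdiv. rewrite Rmult_assoc, Rinv_l; lra. }
  destruct (nfloor_ex T HT) as (N & HN). exists (S N). intros n Hn.
  assert (HnT : T <= INR n). { apply le_INR in Hn. rewrite S_INR in Hn. lra. }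
  replace (Jint p' (- INR n) (INR n) - Clog (gamma (INR n)) + Clog (gamma (- INR n)) -
     (Jint p (- INR n) (INR n) - Clog (gamma (INR n)) + Clog (gamma (- INR n))))%C
    with (Jint p' (- INR n) (INR n) - Jint p (- INR n) (INR n))%C by ring.
  rewrite EJ. eapply Rle_trans; [apply Cmod_triangle_sub|].
  assert (S1 := Small (INR n) ltac:(rewrite Rabs_pos_eq; lra)). assert (S2 := Small (- INR n) ltac:(rewrite Rabs_Ropp, Rabs_pos_eq; lra)). lra.
Qed.

Lemma has_index_connected U v x0 : open U -> connected U -> (forall p, U p -> forall t, gamma t <> p) ->
  U x0 -> has_index x0 v -> forall p, U p -> has_index p v.
Proof.
  intros OU CU HU Hx Hix p Hp. apply NNPP. intros N.
  assert (OU' := Copen_of_open U OU).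
  assert (Near : forall y, U y -> exists d, 0 < d /\ forall y', Cmod (y' - y)%C < d -> U y' /\ (has_index y v <-> has_index y' v)).
  { intros y Hy. destruct (OU' y Hy) as (r & Hr & HrU). exists (r / 4). split. lra. intros y' Hy'.
    assert (Hy2 : U y') by (apply HrU; lra). split; auto.
    assert (G : forall t, r <= Cmod (gamma t - y)%C).
    { intros t. apply Rnot_lt_le. intros L. apply (HU (gamma t)) with t; auto. }
    split.
    - apply (has_index_near y y' v (r / 4)); auto. lra. intros t. specialize (G t). lra.
    - apply (has_index_near y' y v (r / 4)); auto. lra.
      + intros t. specialize (G t). replace (gamma t - y)%C with ((gamma t - y') + (y' - y))%C in G by ring.
        assert (T := Cmod_triangle (gamma t - y')%C (y' - y)%C). lra.
      + now rewrite Cmod_sub_comm. }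
  destruct (CU (fun y => U y /\ has_index y v) (fun y => U y /\ ~ has_index y v)) as (s & Hs & [_ A] & [_ B]).
  - apply open_of_Copen. intros y [Hy Hi]. destruct (Near y Hy) as (d & Hd & Hd'). exists d. split; auto.
    intros y' Hy'. destruct (Hd' y' Hy') as [E1 E2]. split; [exact E1|exact (proj1 E2 Hi)].
  - apply open_of_Copen. intros y [Hy Hi]. destruct (Near y Hy) as (d & Hd & Hd'). exists d. split; auto.
    intros y' Hy'. destruct (Hd' y' Hy') as [E1 E2]. split; [exact E1|intros K; exact (Hi (proj2 E2 K))].
  - intros s Hs. destruct (classic (has_index s v)) as [K|K]; [left; exact (conj Hs K)|right; exact (conj Hs K)].
  - exists x0. split; [exact Hx|split; [exact Hx|exact Hix]].
  - exists p. split; [exact Hp|split; [exact Hp|exact N]].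
  - exact (B A).
Qed.

(** The contour meets the real axis in a bounded set. *)
Lemma contour_real_bounded : exists X, 0 < X /\ forall t, Im (gamma t) = 0 -> Rabs (Re (gamma t)) < X.
Proof.
  destruct (contour_rays _ _ _ _ _ H) as (cm & cp & rad & Hr & _).
  assert (S1 := sin_thp). assert (S2 := sin_thm).
  assert (Pp := Cmod_ge_0 cp). assert (Pm := Cmod_ge_0 cm).
  assert (Ray : forall c th iota s, is_sign iota -> 0 < iota * sin th -> on_ray c th s -> Im s = 0 -> Cmod s <= 2 * Cmod c / (iota * sin th)).
  { intros c th iota s Hi Hs Hray H0. destruct (ray_coordinates c th s Hray) as [_ A]. rewrite H0 in A.
    apply Rmult_le_reg_r with (iota * sin th); auto. replace (2 * Cmod c / (iota * sin th) * (iota * sin th)) with (2 * Cmod c).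
    2:{ field. split; intros E; rewrite E in Hs; lra. }
    eapply Rle_trans; [|apply A]. replace (0 - Cmod s * sin th) with (- (Cmod s * sin th)) by ring. rewrite Rabs_Ropp.
    replace (Cmod s * (iota * sin th)) with (iota * (Cmod s * sin th)) by ring. now apply sign_abs. }
  assert (Q1 : 0 <= 2 * Cmod cp / (1 * sin thp)) by (apply Rmult_le_pos; [lra|left; apply Rinv_0_lt_compat; lra]).
  assert (Q2 : 0 <= 2 * Cmod cm / (-1 * sin thm)) by (apply Rmult_le_pos; [lra|left; apply Rinv_0_lt_compat; lra]).
  exists (Rabs rad + 2 * Cmod cp / (1 * sin thp) + 2 * Cmod cm / (-1 * sin thm) + 1).
  assert (Pr := Rabs_pos rad). assert (Lr := Rle_abs rad). split. lra.
  intros t Ht. eapply Rle_lt_trans; [apply re_le_Cmod|].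
  destruct (Rle_lt_dec (Cmod (gamma t)) rad) as [L|L]. lra.
  destruct (proj1 (Hr (gamma t) L) (ex_intro _ t eq_refl)) as [K|K].
  - assert (Z := Ray cm thm (-1) _ (or_intror eq_refl) S2 K Ht). lra.
  - assert (Z := Ray cp thp 1 _ (or_introl eq_refl) ltac:(lra) K Ht). lra.
Qed.

Lemma Clog_shift_small p eps : 0 < eps -> exists T, 0 <= T /\ forall t, T <= Rabs t ->
  Cmod (Clog (gamma t - p) - Clog (gamma t))%C <= eps.
Proof.
  intros He. assert (P := Cmod_ge_0 p). assert (P2 : 0 <= 4 * Cmod p / eps) by (apply Rmult_le_pos; [lra|left; now apply Rinv_0_lt_compat]).
  destruct (contour_Im (2 * Cmod p + 1 + 4 * Cmod p / eps)) as (T & HT & H1 & H2).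
  exists T. split; auto. intros t Ht.
  assert (A : 2 * Cmod p + 1 + 4 * Cmod p / eps <= Rabs (Im (gamma t))).
  { destruct (Rle_lt_dec 0 t).
    - rewrite Rabs_pos_eq in Ht by auto. eapply Rle_trans; [apply (H1 t Ht)|apply Rle_abs].
    - rewrite Rabs_left in Ht by auto. specialize (H2 t ltac:(lra)). rewrite <- Rabs_Ropp. eapply Rle_trans; [|apply Rle_abs]. lra. }
  eapply Rle_trans; [apply Clog_sub_small; lra|].
  apply Rmult_le_reg_r with (Rabs (Im (gamma t))). lra. unfold Rdiv. rewrite Rmult_assoc, Rinv_l by lra.
  assert (eps * (4 * Cmod p / eps) <= eps * Rabs (Im (gamma t))) by (apply Rmult_le_compat_l; lra).
  replace (eps * (4 * Cmod p / eps)) with (4 * Cmod p) in H0 by (field; lra). lra.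
Qed.

(** The period [2 pi i] of the exponential. *)
Definition two_pi_i : C := (0%R, (2 * PI)%R).

(** Translating the argument of the logarithm by [p] changes the two boundary terms
    by quantities that tend to zero. *)
Lemma has_index_of_primitive p v : (exists N, forall n, (N <= n)%nat ->
    Jint p (- INR n) (INR n) = (Clog (gamma (INR n) - p) - Clog (gamma (- INR n) - p) + v)%C) -> has_index p v.
Proof.
  intros (N0 & HJ) eps He. destruct (Clog_shift_small p (eps / 2) ltac:(lra)) as (T & HT & Hs).
  destruct (nfloor_ex T HT) as (N & HN). exists (N0 + S N)%nat. intros n Hn. rewrite HJ by lia.
  assert (HnT : T <= INR n). { assert (Hn' : (S N <= n)%nat) by lia. apply le_INR in Hn'. rewrite S_INR in Hn'. lra. }
  replace (Clog (gamma (INR n) - p) - Clog (gamma (- INR n) - p) + v - Clog (gamma (INR n)) + Clog (gamma (- INR n)) - v)%C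
    with ((Clog (gamma (INR n) - p) - Clog (gamma (INR n))) - (Clog (gamma (- INR n) - p) - Clog (gamma (- INR n))))%C by ring.
  eapply Rle_trans; [apply Cmod_triangle_sub|].
  assert (S1 := Hs (INR n) ltac:(rewrite Rabs_pos_eq; lra)). assert (S2 := Hs (- INR n) ltac:(rewrite Rabs_Ropp, Rabs_pos_eq; lra)). lra.
Qed.

(** For points far to the left the principal logarithm is a primitive along the whole
    contour; for points far to the right the logarithm cut along the positive half
    line is one. *)
Lemma index_far_left : exists X, 0 < X /\ forall x, x <= - X -> (forall t, gamma t <> RtoC x) /\ has_index (RtoC x) (RtoC 0).
Proof.
  destruct contour_real_bounded as (X & HX & Hb). exists X. split; auto. intros x Hx.
  assert (N : forall t, gamma t <> RtoC x).
  { intros t E. assert (Q := Hb t). rewrite E in Q. simpl in Q. specialize (Q eq_refl). rewrite Rabs_left in Q; lra. }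
  split; auto. apply has_index_of_primitive. exists 0%nat. intros n _. assert (Pn := pos_INR n).
  rewrite (Jint_FTC (fun s => Clog (s - RtoC x))) by (lra || (intros t _; split; [auto|]; apply Clog_sub_deriv;
    destruct (Req_dec (Im (gamma t)) 0) as [E|E]; [right; assert (Q := Hb t E); apply Rabs_def2 in Q; destruct (gamma t); simpl in *; lra
      |left; destruct (gamma t); simpl in *; lra])).
  ring.
Qed.

Lemma index_far_right : exists X, 0 < X /\ forall x, X <= x -> (forall t, gamma t <> RtoC x) /\ has_index (RtoC x) (- two_pi_i)%C.
Proof.
  destruct contour_real_bounded as (X & HX & Hb). exists X. split; auto. intros x Hx.
  assert (N : forall t, gamma t <> RtoC x).
  { intros t E. assert (Q := Hb t). rewrite E in Q. simpl in Q. specialize (Q eq_refl). rewrite Rabs_pos_eq in Q; lra. }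
  split; auto. apply has_index_of_primitive.
  destruct (contour_Im 1) as (T & HT & H1 & H2). destruct (nfloor_ex T HT) as (N0 & HN0).
  exists (S N0). intros n Hn. assert (Pn := pos_INR n).
  assert (HnT : T <= INR n). { apply le_INR in Hn. rewrite S_INR in Hn. lra. }
  rewrite (Jint_FTC (fun s => Clog (- (s - RtoC x)) + (0%R, PI))%C) by (lra || (intros t _; split; [auto|]; apply Clog_opp_sub_deriv;
    destruct (Req_dec (Im (gamma t)) 0) as [E|E]; [right; assert (Q := Hb t E); apply Rabs_def2 in Q; destruct (gamma t); simpl in *; lra
      |left; destruct (gamma t); simpl in *; lra])).
  rewrite Clog_opp_upper, Clog_opp_lower. unfold two_pi_i. ring.
  specialize (H2 (- INR n) ltac:(lra)). destruct (gamma (- INR n)); simpl in *; lra.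
  specialize (H1 (INR n) HnT). destruct (gamma (INR n)); simpl in *; lra.
Qed.

(** Poles on the left of the contour have index [0], those on the right [- 2 pi i]. *)
Theorem contour_index p : (Lp p -> has_index p (- two_pi_i)%C) /\ (Lm p -> has_index p (RtoC 0)).
Proof.
  destruct (contour_separates _ _ _ _ _ H) as (U & V & HUV & HUr & HLp & HLm).
  destruct HUV as (OU & OV & CU & CV & _ & _ & _ & HW).
  destruct index_far_right as (X & HX & Hright). destruct index_far_left as (X' & HX' & Hleft).
  destruct HUr as (M & HM).
  assert (KU : forall q, U q -> has_index q (- two_pi_i)%C).
  { set (x := Rmax X (M + 1)). assert (Q1 := Rmax_l X (M + 1)). assert (Q2 := Rmax_r X (M + 1)). fold x in Q1, Q2.
    apply (has_index_connected U _ (RtoC x)); auto. intros q Hq. apply HW; auto. apply HM; lra. now apply Hright. }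
  assert (KV : forall q, V q -> has_index q (RtoC 0)).
  { destruct (Hleft (- X') ltac:(lra)) as [N I].
    apply (has_index_connected V _ (RtoC (- X'))); auto. intros q Hq. apply HW; auto.
    destruct (proj1 (HW (RtoC (- X')%R)) N) as [K|K]; auto. exfalso.
    assert (E := Cconv_unique _ _ _ (KU _ K) I). apply (f_equal snd) in E. simpl in E. assert (PP := PI_RGT_0). lra. }
  split; auto.
Qed.

(** The limit that defines the index is attained: the ends lie in half planes on
    which the logarithm is a primitive of the kernel. *)
Theorem index_exact p v T a b : (forall t, gamma t <> p) -> has_index p v -> 0 <= T ->
  (forall t, T <= t -> Im p < Im (gamma t)) -> (forall t, t <= - T -> Im (gamma t) < Im p) -> a <= - T -> T <= b ->
  Jint p a b = (v + Clog (gamma b - p) - Clog (gamma a - p))%C.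
Proof.
  intros Np Hi HT Hup Hlow Ha Hb.
  assert (Seg : forall x y, x <= y -> (T <= x \/ y <= - T) -> Jint p x y = (Clog (gamma y - p) - Clog (gamma x - p))%C).
  { intros x y Hxy Hor. apply (Jint_FTC (fun s => Clog (s - p))%C); auto. intros t Ht. split; auto.
    apply Clog_sub_deriv. left. destruct Hor as [K|K].
    specialize (Hup t ltac:(lra)). destruct (gamma t), p; simpl in *; lra.
    specialize (Hlow t ltac:(lra)). destruct (gamma t), p; simpl in *; lra. }
  assert (Ex : forall x y, ex_RInt (V := C_R_CompleteNormedModule) (contour_integrand (cauchy_kernel p) gamma) x y).
  { intros x y. destruct (Rle_lt_dec x y). 2: apply ex_RInt_swap.
    apply (contour_ex_Cint gamma Hsm); auto. intros; now apply Ccont_cauchy_kernel.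
    apply (contour_ex_Cint gamma Hsm); [lra|]. intros; now apply Ccont_cauchy_kernel. }
  assert (Ch : forall x y z, (Jint p x y + Jint p y z)%C = Jint p x z).
  { intros x y z. apply (RInt_Chasles (V := C_R_CompleteNormedModule)); apply Ex. }
  set (w := (Jint p a b - Clog (gamma b - p) + Clog (gamma a - p))%C).
  enough (E : v = w) by (rewrite E; unfold w; ring).
  apply (Cconv_unique (fun n => Jint p (- INR n) (INR n) - Clog (gamma (INR n)) + Clog (gamma (- INR n)))%C); auto.
  apply has_index_of_primitive.
  assert (Hx : 0 <= Rmax b (- a)) by (eapply Rle_trans; [|apply Rmax_l]; lra).
  destruct (nfloor_ex _ Hx) as (N & HN). exists (S N). intros n Hn.
  assert (Q1 := Rmax_l b (- a)). assert (Q2 := Rmax_r b (- a)).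
  assert (Hn' : Rmax b (- a) <= INR n). { apply le_INR in Hn. rewrite S_INR in Hn. lra. }
  rewrite <- (Ch (- INR n) a (INR n)), <- (Ch a b (INR n)).
  rewrite (Seg (- INR n) a), (Seg b (INR n)) by lra. unfold w. ring.
Qed.

End Contour.

(** The value of the integral of a complex function of a real variable. *)
Notation CInt f a b := (RInt (V := C_R_CompleteNormedModule) f a b).

Lemma CInt_unique f a b l : is_Cint f a b l -> CInt f a b = l.
Proof. intros Q. apply (is_RInt_unique (V := C_R_CompleteNormedModule)). exact Q. Qed.

Lemma is_Cint_part f a b l : is_Cint f a b l -> forall p, is_part p -> is_RInt (fun t => p (f t)) a b (p l).
Proof.
  intros H p [-> | ->].
  - apply (is_RInt_fct_extend_fst (U := R_NormedModule) (V := R_NormedModule) f a b l H).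
  - apply (is_RInt_fct_extend_snd (U := R_NormedModule) (V := R_NormedModule) f a b l H).
Qed.

Lemma is_Cint_ext f g a b l : (forall t, f t = g t) -> is_Cint f a b l -> is_Cint g a b l.
Proof. intros E. apply (is_RInt_ext (V := C_R_NormedModule)). auto. Qed.

Lemma is_Cint_scal c f a b l : is_Cint f a b l -> is_Cint (fun t => (c * f t)%C) a b (c * l)%C.
Proof.
  intros H. assert (H1 := is_Cint_part _ _ _ _ H Re part_Re). assert (H2 := is_Cint_part _ _ _ _ H Im part_Im).
  apply is_Cint_parts.
  - exact (is_RInt_minus (V := R_NormedModule) _ _ _ _ _ _
      (is_RInt_scal (V := R_NormedModule) _ _ _ (Re c) _ H1) (is_RInt_scal (V := R_NormedModule) _ _ _ (Im c) _ H2)).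
  - exact (is_RInt_plus (V := R_NormedModule) _ _ _ _ _ _
      (is_RInt_scal (V := R_NormedModule) _ _ _ (Re c) _ H2) (is_RInt_scal (V := R_NormedModule) _ _ _ (Im c) _ H1)).
Qed.

Lemma is_Cint_plus f g a b l m : is_Cint f a b l -> is_Cint g a b m -> is_Cint (fun t => (f t + g t)%C) a b (l + m)%C.
Proof. apply (is_RInt_plus (V := C_R_NormedModule)). Qed.

Lemma is_Cint_zero a b : is_Cint (fun _ => RtoC 0) a b (RtoC 0).
Proof.
  assert (H := is_RInt_const (V := C_R_NormedModule) a b (RtoC 0)).
  assert (E : scal (V := C_R_NormedModule) (b - a) (RtoC 0) = RtoC 0).
  { change ((((b - a) * 0)%R, ((b - a) * 0)%R) = RtoC 0). unfold RtoC. f_equal; ring. }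
  exact (eq_ind _ (fun l => is_Cint (fun _ => RtoC 0) a b l) H _ E).
Qed.

(** * Segments *)

(** The segment from [z] to [w], parametrised by [[0, 1]]. *)
Definition line (z w : C) (t : R) : C := (z + RtoC t * (w - z))%C.

Lemma line_deriv z w t : curve_derive (line z w) t = (w - z)%C.
Proof.
  destruct (curve_deriv_line z (w - z)%C t) as [D1 D2]. unfold curve_derive, line.
  apply is_derive_unique in D1. apply is_derive_unique in D2.
  rewrite (surjective_pairing (w - z)%C). f_equal; [exact D1|exact D2].
Qed.

Lemma line_smooth z w a b : a <= b -> piecewise_C1 (line z w) a b.
Proof.
  intros Hab. apply piecewise_C1_one; auto. exists (line z w). split; auto.
  assert (D : forall t, curve_deriv_at (line z w) t (w - z)%C) by (intros t; apply curve_deriv_line).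
  intros t. repeat split.
  - exists (Re (w - z)%C). exact (proj1 (D t)).
  - exists (Im (w - z)%C). exact (proj2 (D t)).
  - apply continuous_ext with (fun _ => Re (w - z)%C). intros u. symmetry. apply is_derive_unique, (D u). apply continuous_const.
  - apply continuous_ext with (fun _ => Im (w - z)%C). intros u. symmetry. apply is_derive_unique, (D u). apply continuous_const.
Qed.

Lemma line_in U z w t : Cconvex U -> U z -> U w -> 0 <= t <= 1 -> U (line z w t).
Proof. intros HU Hz Hw Ht. apply HU; auto. Qed.

Lemma line_integral_le f z w M : 0 <= M -> (forall t, 0 <= t <= 1 -> Ccont f (line z w t) /\ Cmod (f (line z w t)) <= M) ->
  Cmod (CInt (contour_integrand f (line z w)) 0 1) <= M * Cmod (w - z)%C.
Proof.
  intros HM Hf.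
  assert (Ex : is_Cint (contour_integrand f (line z w)) 0 1 (CInt (contour_integrand f (line z w)) 0 1)).
  { apply (RInt_correct (V := C_R_CompleteNormedModule)). apply (contour_ex_Cint (line z w)). intros; now apply line_smooth. lra.
    intros t Ht. now apply Hf. }
  eapply Rle_trans. apply (contour_norm_le (line z w) (line_smooth z w) f (fun _ => M) 0 1 _ ltac:(lra)).
  intros t _. exact (Ccont_const (RtoC M) (line z w t)). intros t Ht. now apply Hf. exact Ex.
  rewrite (RInt_ext _ (fun _ => M * Cmod (w - z)%C)).
  rewrite RInt_const. right. unfold scal; simpl. unfold mult; simpl. ring.
  intros t _. unfold arc_integrand. now rewrite line_deriv.
Qed.

Lemma curve_bounded gamma a b : (forall a b, a <= b -> piecewise_C1 gamma a b) -> a <= b ->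
  exists M, forall t, a <= t <= b -> Cmod (gamma t) <= M.
Proof.
  intros Hsm Hab. destruct (continuity_ab_maj (fun t => Cmod (gamma t)) a b Hab) as (x & Hx & _).
  - intros t _. apply continuity_pt_filterlim. apply continuous_Cmod. intros p Hp.
    apply continuity_pt_filterlim. now apply curve_cont.
  - exists (Cmod (gamma x)). auto.
Qed.

Lemma curve_modulus_continuous gamma : (forall a b, a <= b -> piecewise_C1 gamma a b) ->
  forall t, continuity_pt (fun t => Cmod (gamma t)) t.
Proof.
  intros Hsm t. apply continuity_pt_filterlim. apply continuous_Cmod. intros p Hp.
  apply continuity_pt_filterlim. now apply curve_cont.
Qed.

(** * Principal parts along a contour *)

(** The primitive of [principal_part rs] given by principal logarithms. *)
Fixpoint log_part (rs : list (C * C)) (s : C) : C :=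
  match rs with
  | nil => RtoC 0
  | (p, r) :: rs' => (r * Clog (s - p) + log_part rs' s)%C
  end.

(** The sum of residue times index. *)
Fixpoint index_part (v : C -> C) (rs : list (C * C)) : C :=
  match rs with
  | nil => RtoC 0
  | (p, r) :: rs' => (r * v p + index_part v rs')%C
  end.

Lemma log_part_deriv rs s : (forall pr, In pr rs -> slit (s - fst pr)%C) -> Cderiv (log_part rs) s (principal_part rs s).
Proof.
  induction rs as [|[p r] rs IH]; intros Hs; simpl.
  - apply Cderiv_const.
  - apply (Cderiv_plus (fun s => r * Clog (s - p))%C).
    + apply (Cderiv_scal r). apply Clog_sub_deriv. apply (Hs (p, r)). now left.
    + apply IH. intros pr Hpr. apply Hs. now right.
Qed.

Section OneContour.
Variables (Lp Lm : C -> Prop) (thm thp : R) (gamma : R -> C).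
Hypothesis H : is_contour Lp Lm thm thp gamma.
Let Hsm := contour_smooth _ _ _ _ _ H.

(** The index of a pole depends only on the side on which it lies. *)
Definition pole_index (p : C) : C := if excluded_middle_informative (Lp p) then (- two_pi_i)%C else RtoC 0.

Lemma pole_has_index p : Lp p \/ Lm p -> has_index gamma p (pole_index p).
Proof.
  intros Hp. destruct (contour_index Lp Lm thm thp gamma H p) as [H1 H2].
  unfold pole_index. destruct (excluded_middle_informative (Lp p)); auto. apply H2. tauto.
Qed.

Lemma pole_off_contour p t : Lp p \/ Lm p -> gamma t <> p.
Proof. intros Hp E. destruct (contour_avoids _ _ _ _ _ H t) as [A1 A2]. rewrite E in A1, A2. tauto. Qed.

Variables (B T : R).
Hypotheses (HB : forall p, Lp p \/ Lm p -> Rabs (Im p) <= B) (HT : 0 <= T)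
  (Hup : forall t, T <= t -> B < Im (gamma t)) (Hlow : forall t, t <= - T -> Im (gamma t) < - B).

Lemma principal_part_integral rs a b : (forall pr, In pr rs -> Lp (fst pr) \/ Lm (fst pr)) -> a <= - T -> T <= b ->
  is_Cint (contour_integrand (principal_part rs) gamma) a b
    (index_part pole_index rs + (log_part rs (gamma b) - log_part rs (gamma a)))%C.
Proof.
  intros Hrs Ha Hb. induction rs as [|[p r] rs IH]; simpl.
  - replace (RtoC 0 + (RtoC 0 - RtoC 0))%C with (RtoC 0) by ring.
    apply is_Cint_ext with (fun _ => RtoC 0). intros t. unfold contour_integrand; simpl. ring. apply is_Cint_zero.
  - assert (Hp : Lp p \/ Lm p) by (apply (Hrs (p, r)); now left).
    assert (HI : Rabs (Im p) <= B) by auto. apply Rabs_le_between in HI.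
    assert (EJ := index_exact Lp Lm thm thp gamma H p _ T a b (fun t => pole_off_contour p t Hp) (pole_has_index p Hp) HT
      ltac:(intros t Ht; specialize (Hup t Ht); lra) ltac:(intros t Ht; specialize (Hlow t Ht); lra) Ha Hb).
    assert (EJ' : is_Cint (contour_integrand (cauchy_kernel p) gamma) a b (Jint gamma p a b)).
    { apply (RInt_correct (V := C_R_CompleteNormedModule)). apply (contour_ex_Cint gamma Hsm); [lra|]. intros.
      apply Ccont_cauchy_kernel. now apply pole_off_contour. }
    rewrite EJ in EJ'.
    replace (r * pole_index p + index_part pole_index rs + (r * Clog (gamma b - p) + log_part rs (gamma b) - (r * Clog (gamma a - p) + log_part rs (gamma a))))%C
      with (r * (pole_index p + Clog (gamma b - p) - Clog (gamma a - p)) + (index_part pole_index rs + (log_part rs (gamma b) - log_part rs (gamma a))))%C by ring.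
    apply is_Cint_ext with (fun t => r * contour_integrand (cauchy_kernel p) gamma t + contour_integrand (principal_part rs) gamma t)%C.
    { intros t. unfold contour_integrand, cauchy_kernel; simpl. unfold Cdiv. ring. }
    apply is_Cint_plus. now apply is_Cint_scal. apply IH. intros pr Hpr. apply Hrs. now right.
Qed.

(** The residue theorem on a piece of a contour with both end points beyond the poles.
    The boundary terms involve a function that does not depend on the contour. *)
Lemma meromorphic_integral f F rs a b : (forall pr, In pr rs -> Lp (fst pr) \/ Lm (fst pr)) -> a <= - T -> T <= b ->
  (forall t, Ccont f (gamma t)) ->
  (forall t, a <= t <= b -> Cderiv F (gamma t) (f (gamma t) - principal_part rs (gamma t))%C) ->
  CInt (contour_integrand f gamma) a b =
   (index_part pole_index rs + ((F (gamma b) + log_part rs (gamma b)) - (F (gamma a) + log_part rs (gamma a))))%C.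
Proof.
  intros Hrs Ha Hb Hf HF. apply CInt_unique.
  replace (index_part pole_index rs + ((F (gamma b) + log_part rs (gamma b)) - (F (gamma a) + log_part rs (gamma a))))%C
    with ((F (gamma b) - F (gamma a)) + (index_part pole_index rs + (log_part rs (gamma b) - log_part rs (gamma a))))%C by ring.
  apply is_Cint_ext with (fun t => contour_integrand (fun s => f s - principal_part rs s)%C gamma t + contour_integrand (principal_part rs) gamma t)%C.
  { intros t. unfold contour_integrand. ring. }
  apply is_Cint_plus. 2: now apply principal_part_integral.
  apply (contour_FTC gamma Hsm F (fun s => f s - principal_part rs s)%C). lra.
  intros t Ht. split; auto. apply (Ccont_plus f (fun s => - principal_part rs s)%C); auto.
  apply (hol_cont (fun s => s = gamma t)); auto. apply hol_opp, hol_principal_part.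
  intros z pr -> Hpr. apply pole_off_contour. auto.
Qed.

(** Both ends of a contour take every large modulus. *)
Lemma contour_modulus_value R0 : exists Y, forall r, Y <= r ->
  exists a b, a <= - R0 /\ R0 <= b /\ Cmod (gamma a) = r /\ Cmod (gamma b) = r.
Proof.
  exists (Rmax (Cmod (gamma (Rabs R0))) (Cmod (gamma (- Rabs R0)))). intros r Hr.
  assert (Q1 := Rmax_l (Cmod (gamma (Rabs R0))) (Cmod (gamma (- Rabs R0)))).
  assert (Q2 := Rmax_r (Cmod (gamma (Rabs R0))) (Cmod (gamma (- Rabs R0)))).
  destruct (contour_far Lp Lm thm thp gamma H r) as (X & HX & Hfar).
  assert (Pa := Rabs_pos R0). assert (La := Rle_abs R0).
  assert (Lx := Rmax_l (Rabs R0) X). assert (Lx2 := Rmax_r (Rabs R0) X).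
  assert (C := curve_modulus_continuous gamma Hsm).
  set (x := Rmax (Rabs R0) X) in *.
  assert (F1 := Hfar x ltac:(rewrite Rabs_pos_eq; lra)). assert (F2 := Hfar (- x) ltac:(rewrite Rabs_Ropp, Rabs_pos_eq; lra)).
  destruct (IVT_gen (fun t => Cmod (gamma t)) (Rabs R0) x r C) as (b & Hb & Eb).
  { rewrite Rmin_left, Rmax_right; lra. }
  destruct (IVT_gen (fun t => Cmod (gamma t)) (- x) (- Rabs R0) r C) as (a & Ha' & Ea).
  { rewrite Rmin_right, Rmax_left; lra. }
  rewrite Rmin_left, Rmax_right in Hb by lra. rewrite Rmin_left, Rmax_right in Ha' by lra.
  exists a, b. repeat split; auto; lra.
Qed.
End OneContour.

(** * Comparison of two contours *)

Section TwoContours.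
Variables (Lp Lm : C -> Prop) (thm thp thm' thp' : R) (gamma gamma' : R -> C) (f : C -> C) (B : R).
Hypotheses (H : is_contour Lp Lm thm thp gamma) (H' : is_contour Lp Lm thm' thp' gamma')
  (Hf : hol (fun s => ~ Lp s /\ ~ Lm s) f)
  (HB : forall p, Lp p \/ Lm p -> Rabs (Im p) <= B)
  (Hloc : forall R0, exists l, (forall p, In p l -> Lp p \/ Lm p) /\ (forall p, Cmod p < R0 -> Lp p \/ Lm p -> In p l)).

Let f_cont s : ~ (Lp s \/ Lm s) -> Ccont f s.
Proof. intros N. eapply hol_cont; [apply Hf|]. cbv beta. tauto. Qed.

(** Two contours that separate the poles in the same way have integrals that differ by
    those over the segments joining their ends: both contours give all poles the same
    index. *)
Lemma contour_comparison T T' a b a' b' :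
  0 <= T -> (forall t, T <= t -> B < Im (gamma t)) -> (forall t, t <= - T -> Im (gamma t) < - B) ->
  0 <= T' -> (forall t, T' <= t -> B < Im (gamma' t)) -> (forall t, t <= - T' -> Im (gamma' t) < - B) ->
  a <= - T -> T <= b -> a' <= - T' -> T' <= b' ->
  (CInt (contour_integrand f gamma) a b - CInt (contour_integrand f gamma') a' b')%C =
  (CInt (contour_integrand f (line (gamma a) (gamma' a'))) 0 1
   - CInt (contour_integrand f (line (gamma b) (gamma' b'))) 0 1)%C.
Proof.
  intros HT Hup Hlow HT' Hup' Hlow' Ha Hb Ha' Hb'.
  destruct (curve_bounded gamma a b (contour_smooth _ _ _ _ _ H) ltac:(lra)) as (M & HM).
  destruct (curve_bounded gamma' a' b' (contour_smooth _ _ _ _ _ H') ltac:(lra)) as (M' & HM').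
  set (r := Rmax M M' + 1). assert (Q1 := Rmax_l M M'). assert (Q2 := Rmax_r M M').
  destruct (Hloc r) as (l & Hl1 & Hl2).
  set (U := fun s => Cmod s < r).
  destruct (residue_decomposition l U f) as (rs & Hrs & F & HF).
  { apply Copen_disc. } { apply Cconvex_disc. }
  { eapply hol_sub; [|apply Hf]. intros z [H1 H2]. split; intros K; apply H2, Hl2; auto. }
  assert (Hpole : forall pr, In pr rs -> Lp (fst pr) \/ Lm (fst pr)) by (intros pr Hpr; apply Hl1, Hrs, Hpr).
  assert (UG : forall t, a <= t <= b -> U (gamma t)) by (intros t Ht; specialize (HM t Ht); unfold U, r; lra).
  assert (UG' : forall t, a' <= t <= b' -> U (gamma' t)) by (intros t Ht; specialize (HM' t Ht); unfold U, r; lra).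
  assert (E := meromorphic_integral Lp Lm thm thp gamma H B T HB HT Hup Hlow f F rs a b Hpole Ha Hb).
  assert (E' := meromorphic_integral Lp Lm thm' thp' gamma' H' B T' HB HT' Hup' Hlow' f F rs a' b' Hpole Ha' Hb').
  rewrite E, E'.
  2:{ intros t. apply f_cont. intros K. apply (pole_off_contour _ _ _ _ _ H' _ t K). reflexivity. }
  2:{ intros t Ht. apply HF. split. auto. intros K. apply (pole_off_contour _ _ _ _ _ H' _ t (Hl1 _ K)). reflexivity. }
  2:{ intros t. apply f_cont. intros K. apply (pole_off_contour _ _ _ _ _ H _ t K). reflexivity. }
  2:{ intros t Ht. apply HF. split. auto. intros K. apply (pole_off_contour _ _ _ _ _ H _ t (Hl1 _ K)). reflexivity. }
  assert (Key : forall (V : C -> Prop) z w, Cconvex V -> (forall s, V s -> B < Rabs (Im s)) -> U z -> U w -> V z -> V w ->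
     CInt (contour_integrand f (line z w)) 0 1 = ((F w + log_part rs w) - (F z + log_part rs z))%C).
  { intros V z w CV HV Uz Uw Vz Vw.
    assert (Hline : forall t, 0 <= t <= 1 -> U (line z w t) /\ B < Rabs (Im (line z w t))).
    { intros t Ht. split. apply line_in; auto. apply Cconvex_disc. apply HV. apply line_in; auto. }
    assert (Hnp : forall t, 0 <= t <= 1 -> ~ (Lp (line z w t) \/ Lm (line z w t))).
    { intros t Ht K. destruct (Hline t Ht). specialize (HB _ K). lra. }
    assert (E1 : line z w 1 = w) by (unfold line; ring). assert (E0 : line z w 0 = z) by (unfold line; ring).
    assert (FT := contour_FTC (line z w) (line_smooth z w) (fun s => F s + log_part rs s)%C f 0 1 ltac:(lra)).
    cbv beta in FT. rewrite E1, E0 in FT. apply CInt_unique, FT.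
    intros t Ht. split; [|apply f_cont; auto].
    eapply Cderiv_eq. apply Cderiv_plus. apply HF. split. now apply Hline. intros K. apply (Hnp t Ht). now apply Hl1.
    apply log_part_deriv. intros pr Hpr. left. destruct (Hline t Ht) as [_ K]. specialize (HB _ (Hpole pr Hpr)).
    intros E2. replace (Im (line z w t)) with (Im (fst pr)) in K. lra.
    destruct (line z w t), (fst pr); simpl in *; lra. ring. }
  assert (PB : 0 <= B \/ forall p, ~ (Lp p \/ Lm p)).
  { destruct (classic (exists p, Lp p \/ Lm p)) as [(p & Hp)|N].
    left. eapply Rle_trans; [apply Rabs_pos|apply (HB p Hp)]. right. intros p K. apply N; eauto. }
  rewrite (Key (fun s => Im s < - B) (gamma a) (gamma' a')).
  rewrite (Key (fun s => B < Im s) (gamma b) (gamma' b')).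
  ring.
  - apply (convex_part_gt Im _ part_Im).
  - intros s Hs. eapply Rlt_le_trans; [apply Hs|apply Rle_abs].
  - apply UG; lra.
  - apply UG'; lra.
  - apply Hup; lra.
  - apply Hup'; lra.
  - apply (convex_part_lt Im _ part_Im).
  - intros s Hs. rewrite <- Rabs_Ropp. eapply Rlt_le_trans; [|apply Rle_abs]. lra.
  - apply UG; lra.
  - apply UG'; lra.
  - apply Hlow; lra.
  - apply Hlow'; lra.
Qed.

(* Both ends of the two contours lie in cones on which [f] decays. *)
Variables (kp km sp sm X Y : R).
Hypotheses (Hkp : 0 < kp) (Hkm : 0 < km)
  (Hcp : forall t, Y <= t -> in_cone kp sp 1 (gamma t) /\ in_cone kp sp 1 (gamma' t))
  (Hcm : forall t, t <= - Y -> in_cone km sm (-1) (gamma t) /\ in_cone km sm (-1) (gamma' t))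
  (Hdp : forall s, in_cone kp sp 1 s -> X <= Cmod s -> Cmod (f s) <= exp (- Cmod s))
  (Hdm : forall s, in_cone km sm (-1) s -> X <= Cmod s -> Cmod (f s) <= exp (- Cmod s)).

Let far_off_poles s : B < Rabs (Im s) -> Ccont f s.
Proof. intros K. apply f_cont. intros K'. specialize (HB _ K'). lra. Qed.

Let segment_small k sg io z w r : is_sign io -> 0 < k -> (forall s, in_cone k sg io s -> X <= Cmod s -> Cmod (f s) <= exp (- Cmod s)) ->
  in_cone k sg io z -> in_cone k sg io w -> Cmod z = r -> Cmod w = r -> X <= k * r -> B < k * r -> 0 < r ->
  Cmod (CInt (contour_integrand f (line z w)) 0 1) <= 8 / (k ^ 2 * r).
Proof.
  intros Hio Hk Hd Cz Cw Ez Ew HX HBr Hr.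
  assert (Hin : forall t, 0 <= t <= 1 -> in_cone k sg io (line z w t) /\ k * r <= io * Im (line z w t)).
  { intros t Ht. split. apply line_in; auto. now apply in_cone_convex.
    unfold line. rewrite (part_segment Im _ _ _ part_Im). destruct Cz as [Cz _], Cw as [Cw _]. rewrite Ez in Cz. rewrite Ew in Cw.
    assert (A1 : (1 - t) * (k * r) <= (1 - t) * (io * Im z)) by (apply Rmult_le_compat_l; lra).
    assert (A2 : t * (k * r) <= t * (io * Im w)) by (apply Rmult_le_compat_l; lra). nra. }
  assert (Hkr : 0 < k * r) by (apply Rmult_lt_0_compat; lra).
  eapply Rle_trans. apply (line_integral_le f z w (exp (- (k * r)))). left; apply exp_pos.
  - intros t Ht. destruct (Hin t Ht) as [C1 C2]. assert (S := sign_abs io (Im (line z w t)) Hio).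
    split. apply far_off_poles. lra.
    assert (M := Im_le_Cmod (line z w t)).
    eapply Rle_trans; [apply Hd; auto; lra|]. apply exp_le_compat. lra.
  - assert (L : Cmod (w - z)%C <= 2 * r). { eapply Rle_trans; [apply Cmod_triangle_sub|]. lra. }
    apply Rle_trans with (exp (- (k * r)) * (2 * r)). apply Rmult_le_compat_l; auto. left; apply exp_pos.
    rewrite exp_Ropp.
    assert (Ex : (k * r) ^ 2 / 4 <= exp (k * r)).
    { replace (k * r) with (k * r / 2 + k * r / 2) at 2 by field. rewrite exp_plus.
      assert (E1 := exp_ineq1_le (k * r / 2)). apply Rle_trans with ((1 + k * r / 2) * (1 + k * r / 2)).
      nra. apply Rmult_le_compat; lra. }
    apply Rle_trans with (/ ((k * r) ^ 2 / 4) * (2 * r)).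
    apply Rmult_le_compat_r. lra. apply Rinv_le_contravar; auto. apply Rdiv_lt_0_compat; [apply pow_lt; auto|lra].
    right. field. split; lra.
Qed.

(** End points of equal modulus [r] are joined by segments inside a cone of decay, of
    length at most [2 r], and the comparison is applied for [r] going to infinity. *)
Theorem contour_integrals_agree : contour_ex_RInt f gamma -> contour_ex_RInt f gamma' ->
  contour_RInt f gamma = contour_RInt f gamma'.
Proof.
  intros I I'.
  assert (D : forall eps, 0 < eps -> Cmod (contour_RInt f gamma - contour_RInt f gamma')%C <= 4 * eps).
  { intros eps He.
    destruct (RInt_gen_approx (V := C_R_CompleteNormedModule) (contour_integrand f gamma) I eps He) as (T1 & HT1 & A1).
    destruct (RInt_gen_approx (V := C_R_CompleteNormedModule) (contour_integrand f gamma') I' eps He) as (T2 & HT2 & A2).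
    destruct (contour_Im _ _ _ _ _ H (B + 1)) as (T3 & HT3 & Up & Low).
    destruct (contour_Im _ _ _ _ _ H' (B + 1)) as (T4 & HT4 & Up' & Low').
    set (T := T1 + T2 + T3 + T4 + Rabs Y). assert (PY := Rabs_pos Y). assert (LY := Rle_abs Y).
    destruct (contour_modulus_value _ _ _ _ _ H T) as (Z & HZ). destruct (contour_modulus_value _ _ _ _ _ H' T) as (Z' & HZ').
    set (r := Rabs Z + Rabs Z' + (Rabs X + Rabs B + 1) / kp + (Rabs X + Rabs B + 1) / km + 8 / (kp ^ 2 * eps) + 8 / (km ^ 2 * eps)).
    assert (PX := Rabs_pos X). assert (PB := Rabs_pos B). assert (LX := Rle_abs X). assert (LB := Rle_abs B).
    assert (PZ := Rabs_pos Z). assert (PZ' := Rabs_pos Z'). assert (LZ := Rle_abs Z). assert (LZ' := Rle_abs Z').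
    assert (R1 : 0 < (Rabs X + Rabs B + 1) / kp) by (apply Rdiv_lt_0_compat; lra).
    assert (R2 : 0 < (Rabs X + Rabs B + 1) / km) by (apply Rdiv_lt_0_compat; lra).
    assert (R3 : 0 < 8 / (kp ^ 2 * eps)) by (apply Rdiv_lt_0_compat; [lra|apply Rmult_lt_0_compat; auto; apply pow_lt; auto]).
    assert (R4 : 0 < 8 / (km ^ 2 * eps)) by (apply Rdiv_lt_0_compat; [lra|apply Rmult_lt_0_compat; auto; apply pow_lt; auto]).
    assert (Hr : 0 < r) by (unfold r; lra).
    destruct (HZ r ltac:(unfold r; lra)) as (a & b & Ha & Hb & Ea & Eb).
    destruct (HZ' r ltac:(unfold r; lra)) as (a' & b' & Ha' & Hb' & Ea' & Eb').
    assert (Cmp := contour_comparison T3 T4 a b a' b' HT3 ltac:(intros t Ht; specialize (Up t Ht); lra) ltac:(intros t Ht; specialize (Low t Ht); lra)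
      HT4 ltac:(intros t Ht; specialize (Up' t Ht); lra) ltac:(intros t Ht; specialize (Low' t Ht); lra)
      ltac:(unfold T in *; lra) ltac:(unfold T in *; lra) ltac:(unfold T in *; lra) ltac:(unfold T in *; lra)).
    assert (Small : forall k x, 0 < k -> 0 < x -> 8 / (k ^ 2 * eps) <= x -> 8 / (k ^ 2 * x) <= eps).
    { intros k x Hk Hx Hle. assert (0 < k ^ 2) by (apply pow_lt; auto).
      apply Rmult_le_reg_r with (k ^ 2 * x). apply Rmult_lt_0_compat; auto.
      replace (8 / (k ^ 2 * x) * (k ^ 2 * x)) with 8 by (field; lra).
      apply Rle_trans with (eps * (k ^ 2 * (8 / (k ^ 2 * eps)))). right; field; lra.
      apply Rmult_le_compat_l. lra. apply Rmult_le_compat_l; lra. }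
    assert (Big : forall k, 0 < k -> (Rabs X + Rabs B + 1) / k <= r -> X <= k * r /\ B < k * r).
    { intros k Hk Hle. assert (Rabs X + Rabs B + 1 <= k * r).
      apply Rle_trans with (k * ((Rabs X + Rabs B + 1) / k)). right; field; lra. apply Rmult_le_compat_l; lra. lra. }
    destruct (Big kp Hkp ltac:(unfold r; lra)) as [B1 B2]. destruct (Big km Hkm ltac:(unfold r; lra)) as [B3 B4].
    assert (S1 : Cmod (CInt (contour_integrand f (line (gamma b) (gamma' b'))) 0 1) <= eps).
    { eapply Rle_trans; [apply (segment_small kp sp 1 _ _ r)|]; auto. now left. apply Hcp; unfold T in *; lra. apply Hcp; unfold T in *; lra.
      apply Small; auto. unfold r; lra. }
    assert (S2 : Cmod (CInt (contour_integrand f (line (gamma a) (gamma' a'))) 0 1) <= eps).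
    { eapply Rle_trans; [apply (segment_small km sm (-1) _ _ r)|]; auto. now right. apply Hcm; unfold T in *; lra. apply Hcm; unfold T in *; lra.
      apply Small; auto. unfold r; lra. }
    specialize (A1 a b ltac:(unfold T in *; lra) ltac:(unfold T in *; lra)). specialize (A2 a' b' ltac:(unfold T in *; lra) ltac:(unfold T in *; lra)).
    assert (A1' : Cmod (CInt (contour_integrand f gamma) a b - contour_RInt f gamma)%C <= eps) by (rewrite Cmod_norm; exact A1).
    assert (A2' : Cmod (CInt (contour_integrand f gamma') a' b' - contour_RInt f gamma')%C <= eps) by (rewrite Cmod_norm; exact A2).
    replace (contour_RInt f gamma - contour_RInt f gamma')%C with
      (((CInt (contour_integrand f gamma) a b - CInt (contour_integrand f gamma') a' b')
       - (CInt (contour_integrand f gamma) a b - contour_RInt f gamma)) + (CInt (contour_integrand f gamma') a' b' - contour_RInt f gamma'))%C by ring.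
    eapply Rle_trans; [apply Cmod_triangle|]. eapply Rle_trans; [apply Rplus_le_compat_r, Cmod_triangle_sub|].
    rewrite Cmp. assert (T5 := Cmod_triangle_sub (CInt (contour_integrand f (line (gamma a) (gamma' a'))) 0 1) (CInt (contour_integrand f (line (gamma b) (gamma' b'))) 0 1)). lra. }
  assert (Z : Cmod (contour_RInt f gamma - contour_RInt f gamma')%C = 0).
  { apply Rle_antisym. 2: apply Cmod_ge_0. apply le_epsilon. intros eps He. specialize (D (eps / 4) ltac:(lra)). lra. }
  apply Cmod_eq_0 in Z. replace (contour_RInt f gamma) with (contour_RInt f gamma - contour_RInt f gamma' + contour_RInt f gamma')%C by ring.
  rewrite Z. ring.
Qed.
End TwoContours.

(** * The poles *)

Lemma list_bound {T} (g : T -> R) (l : list T) : exists M, 0 <= M /\ forall x, In x l -> g x <= M.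
Proof.
  induction l as [|x l (M & HM & H)].
  - exists 0. split. lra. contradiction.
  - exists (Rmax (g x) M). split. eapply Rle_trans; [apply HM|apply Rmax_r].
    intros y [->|Hy]. apply Rmax_l. eapply Rle_trans; [apply H, Hy|apply Rmax_r].
Qed.

Lemma poles_Im_bounded tau m n a b : exists B, forall p, Lambda_plus tau n a p \/ Lambda_minus tau m b p -> Rabs (Im p) <= B.
Proof.
  destruct (list_bound (fun x => Rabs (Im x)) (skipn n a)) as (M1 & HM1 & H1).
  destruct (list_bound (fun x => Rabs (Im x)) (skipn m b)) as (M2 & HM2 & H2).
  exists (M1 + M2). intros p [(x & l & k & Hx & ->)|(x & l & k & _ & _ & Hx & ->)].
  - specialize (H1 x Hx). replace (Im (x + RtoC (INR l * tau) + RtoC (INR k))%C) with (Im x) by (destruct x; simpl; ring). cbv beta in H1. lra.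
  - specialize (H2 x Hx). replace (Im (x - RtoC (INR l * tau) - RtoC (INR k))%C) with (Im x) by (destruct x; simpl; ring). cbv beta in H2. lra.
Qed.

Lemma poles_locally_finite tau m n a b : 0 < tau -> forall R0, exists l : list C,
  (forall p, In p l -> Lambda_plus tau n a p \/ Lambda_minus tau m b p) /\
  (forall p, Cmod p < R0 -> Lambda_plus tau n a p \/ Lambda_minus tau m b p -> In p l).
Proof.
  intros Ht R0.
  destruct (list_bound Cmod (skipn n a)) as (M1 & HM1 & H1).
  destruct (list_bound Cmod (skipn m b)) as (M2 & HM2 & H2).
  set (c := Rmin tau 1). assert (Hc : 0 < c) by (apply Rmin_pos; lra).
  assert (Hc1 : c <= tau) by apply Rmin_l. assert (Hc2 : c <= 1) by apply Rmin_r.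
  destruct (INR_unbounded ((Rabs R0 + M1 + M2) / c)) as (N & HN).
  assert (HN' : Rabs R0 + M1 + M2 < c * INR N).
  { apply Rle_lt_trans with (c * ((Rabs R0 + M1 + M2) / c)). right; field; lra. apply Rmult_lt_compat_l; lra. }
  assert (Small : forall l k : nat, INR l * tau + INR k <= Rabs R0 + M1 + M2 -> (l < N)%nat /\ (k < N)%nat).
  { intros l k Hlk. assert (P1 := pos_INR l). assert (P2 := pos_INR k).
    split; apply INR_lt; apply Rmult_lt_reg_l with c; auto; nra. }
  exists (flat_map (fun x => map (fun lk => (x + RtoC (INR (fst lk) * tau) + RtoC (INR (snd lk)))%C) (list_prod (seq 0 N) (seq 0 N))) (skipn n a)
    ++ flat_map (fun x => map (fun lk => (x - RtoC (INR (fst lk) * tau) - RtoC (INR (snd lk)))%C) (list_prod (seq 1 N) (seq 1 N))) (skipn m b)).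
  split.
  - intros p Hp. apply in_app_or in Hp. destruct Hp as [Hp|Hp]; apply in_flat_map in Hp; destruct Hp as (x & Hx & Hp);
    apply in_map_iff in Hp; destruct Hp as ([l k] & <- & Hlk); apply in_prod_iff in Hlk; simpl.
    + left. exists x, l, k. auto.
    + right. destruct Hlk as [Hl Hk]. apply in_seq in Hl. apply in_seq in Hk. exists x, l, k. repeat split; auto; lia.
  - intros p Hp [(x & l & k & Hx & E)|(x & l & k & Hl & Hk & Hx & E)]; apply in_or_app; [left|right];
    apply in_flat_map; exists x; (split; [auto|]); apply in_map_iff; exists (l, k); (split; [now rewrite E|]);
    assert (LR := Rle_abs R0); assert (P1 := pos_INR l); assert (P2 := pos_INR k); assert (Pk : 0 <= INR l * tau + INR k) by nra.
    + specialize (H1 x Hx). assert (T := Cmod_triangle_sub p x). replace (p - x)%C with (RtoC (INR l * tau + INR k)) in T.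
      2:{ rewrite E, RtoC_plus. ring. } rewrite Cmod_R, Rabs_pos_eq in T by auto.
      destruct (Small l k ltac:(lra)). apply in_prod; apply in_seq; lia.
    + specialize (H2 x Hx). assert (T := Cmod_triangle_sub x p). replace (x - p)%C with (RtoC (INR l * tau + INR k)) in T.
      2:{ rewrite E, RtoC_plus. ring. } rewrite Cmod_R, Rabs_pos_eq in T by auto.
      destruct (Small l k ltac:(lra)). apply in_prod; apply in_seq; lia.
Qed.

(** * The directions of a contour *)

Section Directions.
Variables (Lp Lm : C -> Prop) (thm thp : R) (gamma : R -> C).
Hypothesis H : is_contour Lp Lm thm thp gamma.
Hypotheses (Hp : 0 < cos (2 * thp)) (Hm : 0 < cos (2 * thm)).

Let Sp : 0 < 1 * sin thp.
Proof. rewrite Rmult_1_l. exact (sin_thp _ _ _ _ _ H). Qed.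
Let Sm : 0 < -1 * sin thm := sin_thm _ _ _ _ _ H.

(** Far away the contour runs in the region where the growth estimate is effective. *)
Lemma contour_far_region : exists kappa delta R0, 0 < kappa /\ 0 < delta /\ forall t, R0 <= Cmod (gamma t) ->
  kappa * Cmod (gamma t) <= Rabs (Im (gamma t)) /\ delta * Cmod (gamma t) ^ 2 <= Re (gamma t * gamma t)%C.
Proof.
  destruct (contour_rays _ _ _ _ _ H) as (cm & cp & rad & Hr & _).
  destruct (good_direction thp 1 (or_introl eq_refl) Sp Hp) as (sp & Hsp & Ep).
  destruct (good_direction thm (-1) (or_intror eq_refl) Sm Hm) as (sm & Hsm & Em).
  destruct (ray_in_cone thp sp 1 Hsp (or_introl eq_refl) Sp Ep) as (kp & Hkp & Kp).
  destruct (ray_in_cone thm sm (-1) Hsm (or_intror eq_refl) Sm Em) as (km & Hkm & Km).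
  set (k := Rmin kp km). assert (Hk : 0 < k) by now apply Rmin_pos.
  destruct (Kp k ltac:(split; [auto|apply Rmin_l]) cp) as (R1 & _ & C1).
  destruct (Km k ltac:(split; [auto|apply Rmin_r]) cm) as (R2 & _ & C2).
  exists k, (2 * k ^ 3), (Rmax (Rmax R1 R2) (rad + 1)). split; auto.
  split. { assert (0 < k ^ 3) by (apply pow_lt; auto). lra. }
  intros t Ht. assert (Q1 := Rmax_l (Rmax R1 R2) (rad + 1)). assert (Q2 := Rmax_r (Rmax R1 R2) (rad + 1)).
  assert (Q3 := Rmax_l R1 R2). assert (Q4 := Rmax_r R1 R2).
  destruct (proj1 (Hr (gamma t) ltac:(lra)) (ex_intro _ t eq_refl)) as [K|K].
  - specialize (C2 _ K ltac:(lra)). split. exact (in_cone_Im k sm (-1) _ (or_intror eq_refl) C2).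
    exact (in_cone_Re_sq k sm (-1) _ Hsm (or_intror eq_refl) Hk C2).
  - specialize (C1 _ K ltac:(lra)). split. exact (in_cone_Im k sp 1 _ (or_introl eq_refl) C1).
    exact (in_cone_Re_sq k sp 1 _ Hsp (or_introl eq_refl) Hk C1).
Qed.

Lemma contour_end_in_cone sp sm : is_sign sp -> is_sign sm -> 1 * sin thp < sp * cos thp -> -1 * sin thm < sm * cos thm ->
  exists k0, 0 < k0 /\ forall k, 0 < k <= k0 -> exists Y, 0 <= Y /\
   (forall t, Y <= t -> in_cone k sp 1 (gamma t)) /\ (forall t, t <= - Y -> in_cone k sm (-1) (gamma t)).
Proof.
  intros Hsp Hsm Ep Em.
  destruct (ray_in_cone thp sp 1 Hsp (or_introl eq_refl) Sp Ep) as (kp & Hkp & Kp).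
  destruct (ray_in_cone thm sm (-1) Hsm (or_intror eq_refl) Sm Em) as (km & Hkm & Km).
  destruct (contour_ends _ _ _ _ _ H) as (cm & cp & T & HT & Ap & Am).
  exists (Rmin kp km). split. now apply Rmin_pos. intros k Hk.
  assert (Q1 := Rmin_l kp km). assert (Q2 := Rmin_r kp km).
  destruct (Kp k ltac:(lra) cp) as (R1 & _ & C1). destruct (Km k ltac:(lra) cm) as (R2 & _ & C2).
  destruct (contour_far _ _ _ _ _ H (Rmax R1 R2)) as (T' & HT' & Far).
  assert (Q3 := Rmax_l R1 R2). assert (Q4 := Rmax_r R1 R2).
  exists (T + T'). split. lra. split; intros t Ht.
  - apply C1. apply Ap; lra. eapply Rle_trans; [apply Q3|]. apply Far. rewrite Rabs_pos_eq; lra.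
  - apply C2. apply Am; lra. eapply Rle_trans; [apply Q4|]. apply Far. rewrite Rabs_left1; lra.
Qed.
End Directions.

(** A contour determines the cosines of its two directions. *)
Lemma contour_directions_unique Lp Lm thm thp thm' thp' gamma : is_contour Lp Lm thm thp gamma ->
  is_contour Lp Lm thm' thp' gamma -> cos thm = cos thm' /\ cos thp = cos thp'.
Proof.
  intros H H'.
  destruct (contour_ends _ _ _ _ _ H) as (cm & cp & T & HT & Ap & Am).
  destruct (contour_ends _ _ _ _ _ H') as (cm' & cp' & T' & HT' & Ap' & Am').
  assert (Key : forall th th' c c', (forall X, exists t, on_ray c th (gamma t) /\ on_ray c' th' (gamma t) /\ X <= Cmod (gamma t)) -> cos th = cos th').
  { intros th th' c c' Hx. apply Rminus_diag_uniq. apply NNPP. intros N.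
    assert (Hd : 0 < Rabs (cos th - cos th')) by now apply Rabs_pos_lt.
    set (d := Rabs (cos th - cos th')) in *. assert (P1 := Cmod_ge_0 c). assert (P2 := Cmod_ge_0 c').
    destruct (Hx ((2 * Cmod c + 2 * Cmod c' + 1) / d)) as (t & R1 & R2 & Hbig).
    destruct (ray_coordinates _ _ _ R1) as [A1 _]. destruct (ray_coordinates _ _ _ R2) as [A2 _].
    set (r := Cmod (gamma t)) in *. assert (Pr : 0 <= r) by apply Cmod_ge_0.
    assert (E : r * d <= 2 * Cmod c + 2 * Cmod c').
    { unfold d. rewrite <- (Rabs_pos_eq r) at 1 by auto. rewrite <- Rabs_mult.
      replace (r * (cos th - cos th')) with ((Re (gamma t) - r * cos th') - (Re (gamma t) - r * cos th)) by ring.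
      eapply Rle_trans; [apply Rabs_triang|]. rewrite Rabs_Ropp. lra. }
    assert ((2 * Cmod c + 2 * Cmod c' + 1) / d * d <= r * d) by (apply Rmult_le_compat_r; lra).
    replace ((2 * Cmod c + 2 * Cmod c' + 1) / d * d) with (2 * Cmod c + 2 * Cmod c' + 1) in H0 by (field; lra). lra. }
  split.
  - apply (Key _ _ cm cm'). intros X. destruct (contour_far _ _ _ _ _ H X) as (T2 & HT2 & Far).
    exists (- (T + T' + T2)). split. apply Am; lra. split. apply Am'; lra. apply Far. rewrite Rabs_left1; lra.
  - apply (Key _ _ cp cp'). intros X. destruct (contour_far _ _ _ _ _ H X) as (T2 & HT2 & Far).
    exists (T + T' + T2). split. apply Ap; lra. split. apply Ap'; lra. apply Far. rewrite Rabs_pos_eq; lra.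
Qed.

(** A function with absolutely convergent integral cannot stay above [1] in modulus at an
    end of the contour, which has infinite length. *)
Lemma admissible_small Lp Lm thm thp gamma g : is_contour Lp Lm thm thp gamma -> (forall t, Ccont g (gamma t)) ->
  contour_abs_finite g gamma -> forall T,
  ~ (forall t, T <= t -> 1 <= Cmod (g (gamma t))) /\ ~ (forall t, t <= T -> 1 <= Cmod (g (gamma t))).
Proof.
  intros H Hg Hfin T. assert (Hsm := contour_smooth _ _ _ _ _ H).
  set (h := fun s => Cmod (g s)).
  assert (Ch : forall t, Rcont h (gamma t)) by (intros t; now apply Ccont_Cmod).
  assert (Hfin' : ex_RInt_gen (V := R_NormedModule) (arc_integrand gamma h) (Rbar_locally m_infty) (Rbar_locally p_infty)).
  { unfold contour_abs_finite in Hfin. revert Hfin. apply (ex_RInt_gen_ext_eq (V := R_NormedModule)).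
    intros t. unfold arc_integrand, contour_integrand, h. now rewrite Cmod_mult. }
  destruct (RInt_gen_approx (V := R_CompleteNormedModule) _ Hfin' 1 Rlt_0_1) as (T0 & HT0 & Happ).
  set (L := RInt_gen (V := R_CompleteNormedModule) (arc_integrand gamma h) (Rbar_locally m_infty) (Rbar_locally p_infty)) in *.
  assert (Ex : forall a b, a <= b -> ex_RInt (arc_integrand gamma h) a b) by (intros a b Hab; apply arc_ex_RInt; auto).
  assert (Pos : forall a b, a <= b -> 0 <= RInt (arc_integrand gamma h) a b).
  { intros a b Hab. apply arc_RInt_ge0; auto. intros; apply Cmod_ge_0. }
  assert (Bd : forall a b, a <= b -> RInt (arc_integrand gamma h) a b <= L + 1).
  { intros a b Hab. assert (Q1 := Rmin_l a (- T0)). assert (Q2 := Rmin_r a (- T0)). assert (Q3 := Rmax_l b T0). assert (Q4 := Rmax_r b T0).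
    set (a' := Rmin a (- T0)) in *. set (b' := Rmax b T0) in *.
    assert (A := Happ a' b' Q2 Q4). change (Rabs (RInt (arc_integrand gamma h) a' b' - L) <= 1) in A. apply Rabs_le_between in A.
    assert (E1 : RInt (arc_integrand gamma h) a' b' = RInt (arc_integrand gamma h) a' a + RInt (arc_integrand gamma h) a b + RInt (arc_integrand gamma h) b b').
    { rewrite <- (RInt_Chasles _ a' b b'), <- (RInt_Chasles _ a' a b) by (apply Ex; lra). reflexivity. }
    assert (P1 := Pos a' a ltac:(lra)). assert (P2 := Pos b b' ltac:(lra)). lra. }
  assert (Len : forall a b, a <= b -> (forall t, a <= t <= b -> 1 <= Cmod (g (gamma t))) -> Cmod (gamma b - gamma a)%C <= L + 1).
  { intros a b Hab H1. eapply Rle_trans; [|apply (Bd a b Hab)].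
    apply (contour_norm_le gamma Hsm (fun _ => RtoC 1) h a b); auto. intros t Ht. rewrite Cmod_1. now apply H1.
    apply (contour_FTC gamma Hsm (fun s => s) (fun _ => RtoC 1)); auto. intros t _. split. apply Cderiv_id. apply Ccont_const. }
  destruct (contour_far _ _ _ _ _ H (Cmod (gamma T) + L + 2)) as (T1 & HT1 & Far).
  assert (PT := Rabs_pos T). assert (LT := Rle_abs T). assert (LT' := Rle_abs (- T)). rewrite Rabs_Ropp in LT'.
  split; intros H1.
  - set (x := Rabs T + T1). assert (A := Len T x ltac:(unfold x; lra) ltac:(intros; apply H1; lra)).
    assert (F := Far x ltac:(unfold x; rewrite Rabs_pos_eq; lra)).
    assert (Tr := Cmod_triangle (gamma x - gamma T)%C (gamma T)). replace (gamma x - gamma T + gamma T)%C with (gamma x) in Tr by ring. lra.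
  - set (x := - (Rabs T + T1)). assert (A := Len x T ltac:(unfold x; lra) ltac:(intros; apply H1; lra)).
    assert (F := Far x ltac:(unfold x; rewrite Rabs_left1; lra)). rewrite Cmod_sub_comm in A.
    assert (Tr := Cmod_triangle (gamma x - gamma T)%C (gamma T)). replace (gamma x - gamma T + gamma T)%C with (gamma x) in Tr by ring. lra.
Qed.

(** The intermediate value theorem for a function that is only known to be continuous
    at the points of the unit interval. *)
Lemma IVT_unit_interval (g : R -> R) : (forall u, 0 <= u <= 1 -> continuous g u) -> g 0 * g 1 <= 0 -> exists u, 0 <= u <= 1 /\ g u = 0.
Proof.
  intros Hg Hs. set (cl := fun u => Rmax 0 (Rmin 1 u)).
  assert (Hcl : forall u, 0 <= cl u <= 1).
  { intros u. unfold cl. split. apply Rmax_l. apply Rmax_lub. lra. apply Rmin_l. }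
  assert (Lip : forall u v, Rabs (cl u - cl v) <= Rabs (u - v)).
  { intros u v. unfold cl, Rmax, Rmin. repeat destruct Rle_dec; unfold Rabs; repeat destruct Rcase_abs; lra. }
  assert (Cc : Ranalysis1.continuity (fun u => g (cl u))).
  { intros u. apply (continuity_pt_comp cl g).
    - intros eps He. exists eps. split; auto. intros x [_ Hx]. simpl in *. unfold R_dist in *. eapply Rle_lt_trans; [apply Lip|auto].
    - apply continuity_pt_filterlim. apply Hg, Hcl. }
  assert (E0 : cl 0 = 0) by (unfold cl; rewrite Rmin_right, Rmax_left; lra).
  assert (E1 : cl 1 = 1) by (unfold cl; rewrite Rmin_left, Rmax_right; lra).
  destruct (IVT_gen (fun u => g (cl u)) 0 1 0 Cc) as (u & Hu & E).
  - rewrite E0, E1. unfold Rmin, Rmax. repeat destruct Rle_dec; nra.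
  - exists (cl u). auto.
Qed.

(** * Differentiation under the integral sign *)

Section Transform.
Variables (Lp Lm : C -> Prop) (thm thp : R) (gamma : R -> C) (f : C -> C).
Hypotheses (H : is_contour Lp Lm thm thp gamma) (Hc : forall t, Ccont f (gamma t))
  (Hdp : ray_decay f thp) (Hdm : ray_decay f thm).
Let Hsm := contour_smooth _ _ _ _ _ H.

(** A continuous function of at most exponential growth. *)
Definition dominated (k : C -> C) (M A : R) : Prop :=
  (forall s, Ccont k s) /\ 0 <= M /\ forall s, Cmod (k s) <= M * exp (A * Cmod s).

(** A bound on a linear combination of improper integrals by a bound on the integrands,
    obtained on finite pieces and passed to the limit. *)
Lemma contour_linear_bound k1 k2 k3 h M A W : (exists M1 A1, dominated k1 M1 A1) -> (exists M2 A2, dominated k2 M2 A2) ->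
  (exists M3 A3, dominated k3 M3 A3) -> 0 <= M ->
  (forall s, Cmod (k1 s - k2 s - h * k3 s)%C <= M * exp (A * Cmod s)) ->
  (forall a b, a <= b -> RInt (arc_integrand gamma (weight f A)) a b <= W) ->
  Cmod (contour_RInt (fun s => f s * k1 s)%C gamma - contour_RInt (fun s => f s * k2 s)%C gamma
     - h * contour_RInt (fun s => f s * k3 s)%C gamma)%C <= M * W.
Proof.
  intros (M1 & A1 & C1 & P1 & D1) (M2 & A2 & C2 & P2 & D2) (M3 & A3 & C3 & P3 & D3) HM Hk HW.
  assert (I1 := contour_dominated_ex Lp Lm thm thp gamma H f Hc Hdp Hdm k1 M1 A1 ltac:(auto) P1 D1).
  assert (I2 := contour_dominated_ex Lp Lm thm thp gamma H f Hc Hdp Hdm k2 M2 A2 ltac:(auto) P2 D2).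
  assert (I3 := contour_dominated_ex Lp Lm thm thp gamma H f Hc Hdp Hdm k3 M3 A3 ltac:(auto) P3 D3).
  apply le_epsilon. intros eps He.
  assert (Ph := Cmod_ge_0 h). set (e := eps / (2 + Cmod h)). assert (Hee : 0 < e) by (apply Rdiv_lt_0_compat; lra).
  destruct (RInt_gen_approx (V := C_R_CompleteNormedModule) _ I1 e Hee) as (T1 & HT1 & B1).
  destruct (RInt_gen_approx (V := C_R_CompleteNormedModule) _ I2 e Hee) as (T2 & HT2 & B2).
  destruct (RInt_gen_approx (V := C_R_CompleteNormedModule) _ I3 e Hee) as (T3 & HT3 & B3).
  set (T := T1 + T2 + T3).
  specialize (B1 (- T) T ltac:(unfold T; lra) ltac:(unfold T; lra)).
  specialize (B2 (- T) T ltac:(unfold T; lra) ltac:(unfold T; lra)).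
  specialize (B3 (- T) T ltac:(unfold T; lra) ltac:(unfold T; lra)).
  assert (HT : - T <= T) by (unfold T; lra).
  assert (Ex : forall k, (forall s, Ccont k s) -> is_Cint (contour_integrand (fun s => f s * k s)%C gamma) (- T) T (CInt (contour_integrand (fun s => f s * k s)%C gamma) (- T) T)).
  { intros k Ck. apply (RInt_correct (V := C_R_CompleteNormedModule)). apply (contour_ex_Cint gamma Hsm); auto.
    intros t _. now apply Ccont_mult. }
  set (J1 := (CInt (contour_integrand (fun s => f s * k1 s)%C gamma) (- T) T) : C) in *.
  set (J2 := (CInt (contour_integrand (fun s => f s * k2 s)%C gamma) (- T) T) : C) in *.
  set (J3 := (CInt (contour_integrand (fun s => f s * k3 s)%C gamma) (- T) T) : C) in *.
  set (K1 := contour_RInt (fun s => f s * k1 s)%C gamma) in *.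
  set (K2 := contour_RInt (fun s => f s * k2 s)%C gamma) in *.
  set (K3 := contour_RInt (fun s => f s * k3 s)%C gamma) in *.
  assert (B1' : Cmod (J1 - K1)%C <= e) by (rewrite Cmod_norm; exact B1).
  assert (B2' : Cmod (J2 - K2)%C <= e) by (rewrite Cmod_norm; exact B2).
  assert (B3' : Cmod (J3 - K3)%C <= e) by (rewrite Cmod_norm; exact B3).
  set (k := fun s => (k1 s - k2 s - h * k3 s)%C).
  assert (Ck : forall s, Ccont k s).
  { intros s. unfold k. apply (Ccont_plus (fun s => k1 s - k2 s)%C (fun s => - (h * k3 s))%C).
    - apply (Ccont_plus k1 (fun s => - k2 s)%C); auto.
      apply Ccont_ext_loc with (fun s => RtoC (-1) * k2 s)%C 1. lra. intros y _. destruct (k2 y); unfold Cmult, Copp, RtoC; simpl; f_equal; ring.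
      apply Ccont_mult; auto. apply Ccont_const.
    - apply Ccont_ext_loc with (fun s => (- h) * k3 s)%C 1. lra. intros y _. ring. apply Ccont_mult; auto. apply Ccont_const. }
  assert (JJ : is_Cint (contour_integrand (fun s => f s * k s)%C gamma) (- T) T (J1 + (RtoC (-1) * J2 + (- h) * J3))%C).
  { apply is_Cint_ext with (fun t => contour_integrand (fun s => f s * k1 s)%C gamma t + (RtoC (-1) * contour_integrand (fun s => f s * k2 s)%C gamma t + (- h) * contour_integrand (fun s => f s * k3 s)%C gamma t))%C.
    { intros t. unfold contour_integrand, k. replace (RtoC (-1)) with (- RtoC 1)%C by (unfold RtoC, Copp; simpl; f_equal; ring). ring. }
    apply is_Cint_plus. now apply Ex. apply is_Cint_plus; apply is_Cint_scal; now apply Ex. }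
  assert (Bd := dominated_le Lp Lm thm thp gamma H f Hc k M A Hk (- T) T _ HT JJ).
  specialize (HW (- T) T HT).
  replace (J1 + (RtoC (-1) * J2 + - h * J3))%C with (J1 - J2 - h * J3)%C in Bd.
  2:{ replace (RtoC (-1)) with (- RtoC 1)%C by (unfold RtoC, Copp; simpl; f_equal; ring). ring. }
  replace (K1 - K2 - h * K3)%C with ((J1 - J2 - h * J3) - ((J1 - K1) - (J2 - K2) - h * (J3 - K3)))%C by ring.
  eapply Rle_trans; [apply Cmod_triangle_sub|].
  assert (Tr := Cmod_triangle_sub (J1 - K1 - (J2 - K2))%C (h * (J3 - K3))%C). rewrite Cmod_mult in Tr.
  assert (Tr2 := Cmod_triangle_sub (J1 - K1)%C (J2 - K2)%C).
  assert (Cmod h * Cmod (J3 - K3)%C <= Cmod h * e) by (apply Rmult_le_compat_l; lra).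
  assert (e * (2 + Cmod h) = eps) by (unfold e; field; lra).
  assert (M * RInt (arc_integrand gamma (weight f A)) (- T) T <= M * W) by (apply Rmult_le_compat_l; lra). nra.
Qed.

(** The function [z^(-s)] at [z = exp (2 pi w)], and its derivative in [w]. *)
Definition kernel (w s : C) : C := Cexp (- (s * (RtoC (2 * PI) * w)))%C.
Definition kernel' (w s : C) : C := (- (s * RtoC (2 * PI)) * kernel w s)%C.

Lemma Cmod_kernel_le w s : Cmod (kernel w s) <= exp (2 * PI * Cmod w * Cmod s).
Proof.
  unfold kernel. rewrite Cmod_Cexp. apply exp_le_compat. eapply Rle_trans; [apply Rle_abs|].
  eapply Rle_trans; [apply re_le_Cmod|]. rewrite Cmod_opp, !Cmod_mult, Cmod_R, Rabs_pos_eq by (assert (P := PI_RGT_0); lra).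
  right; ring.
Qed.

Lemma sq_le_exp x : 0 <= x -> x ^ 2 <= 4 * exp x.
Proof.
  intros Hx. replace x with (x / 2 + x / 2) at 2 by field. rewrite exp_plus.
  assert (E1 := exp_ineq1_le (x / 2)). nra.
Qed.

Lemma Ccont_kernel w s : Ccont (kernel w) s.
Proof.
  apply (hol_cont (fun _ => True)); auto. unfold kernel. apply hol_Cexp, hol_opp. apply (hol_mult _ (fun s => s)). apply hol_id. apply hol_const.
Qed.

Lemma kernel_dominated w : dominated (kernel w) 1 (2 * PI * Cmod w).
Proof.
  split. apply Ccont_kernel. split. lra. intros s. rewrite Rmult_1_l. apply Cmod_kernel_le.
Qed.

Lemma kernel'_dominated w : dominated (kernel' w) (2 * PI) (2 * PI * Cmod w + 1).
Proof.
  assert (P := PI_RGT_0). split; [|split; [lra|]].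
  - intros s. unfold kernel'. apply (Ccont_mult (fun s => - (s * RtoC (2 * PI)))%C (kernel w)). 2: apply Ccont_kernel.
    apply (hol_cont (fun _ => True)); auto. apply hol_opp. apply (hol_mult _ (fun s => s)). apply hol_id. apply hol_const.
  - intros s. unfold kernel'. rewrite Cmod_mult, Cmod_opp, Cmod_mult, Cmod_R, Rabs_pos_eq by lra.
    assert (Q := Cmod_kernel_le w s). assert (Ps := Cmod_ge_0 s). assert (E := exp_ineq1_le (Cmod s)).
    rewrite Rmult_plus_distr_r, exp_plus, Rmult_1_l.
    apply Rle_trans with (exp (Cmod s) * (2 * PI) * exp (2 * PI * Cmod w * Cmod s)). 2: right; ring.
    apply Rmult_le_compat; try apply Cmod_ge_0; auto. apply Rmult_le_pos; lra. apply Rmult_le_compat_r; lra.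
Qed.

Lemma kernel_taylor w h s : Cmod h <= 1 ->
  Cmod (kernel (w + h) s - kernel w s - h * kernel' w s)%C <= (64 * PI ^ 2 * Cmod h ^ 2) * exp ((2 * PI * (Cmod w + 1) + 1) * Cmod s).
Proof.
  intros Hh. assert (P := PI_RGT_0). set (u := (- (s * (RtoC (2 * PI) * h)))%C).
  assert (Eu : Cmod u = 2 * PI * Cmod h * Cmod s).
  { unfold u. rewrite Cmod_opp, !Cmod_mult, Cmod_R, Rabs_pos_eq by lra. ring. }
  assert (E1 : kernel (w + h) s = (kernel w s * Cexp u)%C).
  { unfold kernel, u. rewrite <- Cexp_add. f_equal. ring. }
  replace (kernel (w + h) s - kernel w s - h * kernel' w s)%C with (kernel w s * (Cexp u - RtoC 1 - u))%C.
  2:{ rewrite E1. unfold kernel', u. ring. }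
  rewrite Cmod_mult. assert (T := Cexp_taylor1 u). rewrite Eu in T.
  assert (Ps := Cmod_ge_0 s). assert (Ph := Cmod_ge_0 h). assert (Q := sq_le_exp (Cmod s) Ps).
  replace ((2 * PI * (Cmod w + 1) + 1) * Cmod s) with (2 * PI * Cmod w * Cmod s + (Cmod s + 2 * PI * Cmod s)) by ring.
  rewrite !exp_plus.
  apply Rle_trans with (exp (2 * PI * Cmod w * Cmod s) * (64 * PI ^ 2 * Cmod h ^ 2 * (exp (Cmod s) * exp (2 * PI * Cmod s)))). 2: right; ring.
  apply Rmult_le_compat; try apply Cmod_ge_0. apply Cmod_kernel_le.
  eapply Rle_trans; [apply T|].
  replace (4 * (2 * PI * Cmod h * Cmod s * (2 * PI * Cmod h * Cmod s)) * exp (2 * PI * Cmod h * Cmod s)) with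
    (16 * PI ^ 2 * Cmod h ^ 2 * (Cmod s ^ 2 * exp (2 * PI * Cmod h * Cmod s))) by ring.
  replace (64 * PI ^ 2 * Cmod h ^ 2 * (exp (Cmod s) * exp (2 * PI * Cmod s))) with
    (16 * PI ^ 2 * Cmod h ^ 2 * (4 * exp (Cmod s) * exp (2 * PI * Cmod s))) by ring.
  apply Rmult_le_compat_l. { apply Rmult_le_pos. apply Rmult_le_pos. lra. apply pow2_ge_0. apply pow2_ge_0. }
  apply Rmult_le_compat; auto. apply pow2_ge_0. left; apply exp_pos.
  apply exp_le_compat. apply Rmult_le_compat_r; auto. assert (2 * PI * Cmod h <= 2 * PI * 1) by (apply Rmult_le_compat_l; lra). lra.
Qed.

(** Differentiation under the integral sign: the Taylor remainder of the kernel is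
    quadratic in the increment, uniformly up to an exponential weight. *)
Theorem contour_transform_deriv w :
  Cderiv (fun w => contour_RInt (fun s => f s * kernel w s)%C gamma) w (contour_RInt (fun s => f s * kernel' w s)%C gamma).
Proof.
  intros eps He. assert (P := PI_RGT_0).
  destruct (contour_weight_bounded Lp Lm thm thp gamma H f Hc Hdp Hdm (2 * PI * (Cmod w + 1) + 1)) as (W & HW & HWb).
  assert (PP : 0 < PI ^ 2) by (apply pow_lt; auto).
  set (Q := 64 * PI ^ 2 * (W + 1)). assert (HQ : 0 < Q) by (unfold Q; nra).
  exists (Rmin 1 (eps / Q)). split. apply Rmin_pos. lra. apply Rdiv_lt_0_compat; auto.
  intros h Hh. assert (L1 : Cmod h < 1) by (eapply Rlt_le_trans; [apply Hh|apply Rmin_l]).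
  assert (L2 : Cmod h < eps / Q) by (eapply Rlt_le_trans; [apply Hh|apply Rmin_r]).
  assert (Ph := Cmod_ge_0 h).
  rewrite (Cmult_comm _ h).
  eapply Rle_trans; [apply (contour_linear_bound (kernel (w + h)) (kernel w) (kernel' w) h (64 * PI ^ 2 * Cmod h ^ 2) (2 * PI * (Cmod w + 1) + 1) W)|].
  - do 2 eexists; apply kernel_dominated.
  - do 2 eexists; apply kernel_dominated.
  - do 2 eexists; apply kernel'_dominated.
  - apply Rmult_le_pos. lra. apply pow2_ge_0.
  - intros s. apply kernel_taylor. lra.
  - auto.
  - apply Rle_trans with (Q * Cmod h * Cmod h). unfold Q. assert (0 <= 64 * PI ^ 2 * (Cmod h * Cmod h)) by (apply Rmult_le_pos; nra). nra.
    apply Rmult_le_compat_r; auto. apply Rle_trans with (Q * (eps / Q)). apply Rmult_le_compat_l; lra. right; field; lra.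
Qed.
End Transform.

(** * The integrand on a contour *)

Section Integrand.
Variables (p q m n : nat) (a b : list C) (alpha : C) (tau : R).
Hypotheses (Hm : (m <= q)%nat) (Hn : (n <= p)%nat) (Ha : length a = p) (Hb : length b = q)
  (Htau : 0 < tau) (HN : (index_N p q m n < 0)%Z).

Let Lp := Lambda_plus tau n a.
Let Lm := Lambda_minus tau m b.
Let f := phi tau m n a b alpha.
Let x := IZR (index_N p q m n).
Let integrand (z : log_surface) (s : C) : C := (f s * power_neg z s)%C.

Let x_neg : x < 0.
Proof. apply (IZR_lt _ 0). exact HN. Qed.

Lemma integrand_grows z kappa : 0 < kappa -> grows_like tau kappa (integrand z) x.
Proof.
  intros Hk. apply grows_like_ext with (fun s => f s * power_neg z s)%C (x + 0); auto. ring.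
  apply grows_like_mult. now apply grows_like_phi. apply grows_like_power_neg.
Qed.

Lemma phi_grows kappa : 0 < kappa -> grows_like tau kappa f x.
Proof. intros Hk. now apply grows_like_phi. Qed.

Lemma hol_integrand z : hol (fun s => ~ Lp s /\ ~ Lm s) (integrand z).
Proof. apply hol_mult. now apply hol_phi. apply hol_power_neg. Qed.

Lemma Ccont_power_neg z s : Ccont (power_neg z) s.
Proof. apply (hol_cont (fun _ => True)); auto. apply hol_power_neg. Qed.

Lemma power_neg_le z s : Cmod (power_neg z s) <= 1 * exp (Cmod (slog z) * Cmod s).
Proof.
  unfold power_neg. rewrite Cmod_Cexp, Rmult_1_l. apply exp_le_compat. eapply Rle_trans; [apply Rle_abs|].
  eapply Rle_trans; [apply re_le_Cmod|]. rewrite Cmod_opp, Cmod_mult. right; ring.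
Qed.

Section OnContour.
Variables (thm thp : R) (gamma : R -> C).
Hypotheses (H : is_contour Lp Lm thm thp gamma) (Hcp : 0 < cos (2 * thp)) (Hcm : 0 < cos (2 * thm)).

Lemma phi_cont_contour t : Ccont f (gamma t).
Proof.
  apply (hol_cont (fun s => ~ Lp s /\ ~ Lm s)). now apply hol_phi. apply (contour_avoids _ _ _ _ _ H t).
Qed.

Lemma integrand_cont_contour z t : Ccont (integrand z) (gamma t).
Proof. apply Ccont_mult. apply phi_cont_contour. apply Ccont_power_neg. Qed.

Lemma phi_decay_p : ray_decay f thp.
Proof.
  apply (grows_like_ray_decay tau f x thp 1); auto using phi_grows. now left.
  rewrite Rmult_1_l. exact (sin_thp _ _ _ _ _ H).
Qed.

Lemma phi_decay_m : ray_decay f thm.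
Proof.
  apply (grows_like_ray_decay tau f x thm (-1)); auto using phi_grows. now right. exact (sin_thm _ _ _ _ _ H).
Qed.

Lemma integrand_ex z : contour_ex_RInt (integrand z) gamma.
Proof.
  apply (contour_dominated_ex Lp Lm thm thp gamma H f phi_cont_contour phi_decay_p phi_decay_m (power_neg z) 1 (Cmod (slog z))).
  intros; apply Ccont_power_neg. lra. apply power_neg_le.
Qed.

Lemma integrand_abs z : contour_abs_finite (integrand z) gamma.
Proof.
  apply (contour_dominated_abs Lp Lm thm thp gamma H f phi_cont_contour phi_decay_p phi_decay_m (power_neg z) 1 (Cmod (slog z))).
  intros; apply Ccont_power_neg. lra. apply power_neg_le.
Qed.

(** The error is [o r = - C / ln r]: the cosine is bounded below along the ends, so that
    the error [O(r^2)] is absorbed by a multiple of [cos (2 theta) r^2]. *)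
Lemma integrand_bound z : exists o : R -> R, is_lim o p_infty 0 /\
  Rbar_locally p_infty (fun r => forall t theta : R, gamma t = polar r theta ->
    Cmod (integrand z (gamma t)) <= exp (- (- x / (2 * tau) * cos (2 * theta) * r ^ 2 * ln r * (1 + o r)))).
Proof.
  destruct (contour_far_region Lp Lm thm thp gamma H Hcp Hcm) as (kappa & delta & R0 & Hk & Hd & Hfar).
  destruct (integrand_grows z kappa Hk) as (K & R1 & HK & HR1 & Hg).
  set (K2 := K * (2 * tau) / (- x * delta)).
  exists (fun r => - K2 / ln r). split.
  - apply is_lim_ext with (fun r => - K2 * / ln r). reflexivity.
    replace (Finite 0) with (Rbar_mult (Finite (- K2)) (Finite 0)) by (simpl; f_equal; ring).
    apply (is_lim_scal_l (fun r => / ln r)).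
    apply (is_lim_inv ln p_infty p_infty). apply is_lim_ln_p. discriminate.
  - exists (Rmax (Rmax R0 R1) 1). intros r Hr t theta E.
    assert (Q1 := Rmax_l (Rmax R0 R1) 1). assert (Q2 := Rmax_r (Rmax R0 R1) 1).
    assert (Q3 := Rmax_l R0 R1). assert (Q4 := Rmax_r R0 R1).
    assert (Er : Cmod (gamma t) = r) by (rewrite E; apply Cmod_polar; lra).
    assert (Es : Re (gamma t * gamma t)%C = r ^ 2 * cos (2 * theta)).
    { rewrite E, cos_double_sin_cos. unfold polar; simpl. ring. }
    destruct (Hfar t ltac:(lra)) as [F1 F2]. rewrite Er in F1, F2. rewrite Es in F2.
    destruct (Hg (gamma t) ltac:(lra) ltac:(rewrite Er; lra)) as [G1 G2]. rewrite Er in G2.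
    unfold main_term in G2. rewrite Er, Es in G2. apply Rabs_le_between in G2.
    rewrite <- (exp_ln (Cmod (integrand z (gamma t)))) by auto. apply exp_le_compat.
    assert (Pr2 : 0 < r ^ 2) by (apply pow_lt; lra).
    assert (Hcos : delta <= cos (2 * theta)) by (apply Rmult_le_reg_l with (r ^ 2); lra).
    assert (Lr : 0 < ln r) by (rewrite <- ln_1; apply ln_increasing; lra).
    replace (- (- x / (2 * tau) * cos (2 * theta) * r ^ 2 * ln r * (1 + - K2 / ln r)))
      with (x * (r ^ 2 * cos (2 * theta) / (2 * tau) * ln r) + K * r ^ 2 * (cos (2 * theta) / delta)).
    2:{ unfold K2. field. repeat split; lra. }
    assert (1 <= cos (2 * theta) / delta).
    { apply Rmult_le_reg_r with delta; auto. unfold Rdiv. rewrite Rmult_assoc, Rinv_l; lra. }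
    assert (K * r ^ 2 * 1 <= K * r ^ 2 * (cos (2 * theta) / delta)).
    { apply Rmult_le_compat_l; auto. apply Rmult_le_pos; lra. }
    lra.
Qed.

Lemma power_neg_sexp w s : power_neg (sexp (RtoC (2 * PI) * w)%C) s = kernel w s.
Proof.
  unfold power_neg, kernel. f_equal. f_equal. f_equal. unfold slog, sexp. cbn [fst snd pos].
  rewrite ln_exp. symmetry. apply surjective_pairing.
Qed.

Lemma Kfun_entire : entire (fun w => Kfun f gamma (sexp (RtoC (2 * PI) * w)%C)).
Proof.
  intros w.
  assert (D := contour_transform_deriv Lp Lm thm thp gamma f H phi_cont_contour phi_decay_p phi_decay_m w).
  eexists. apply Cderiv_is_C_derive. unfold Kfun. apply (Cderiv_scal (/ (2 * RtoC PI * Ci))%C).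
  eapply Cderiv_ext; [|exact D]. intros y.
  assert (E : (fun s => f s * kernel y s)%C = (fun s => f s * power_neg (sexp (RtoC (2 * PI) * y)%C) s)%C).
  { apply functional_extensionality. intros s. rewrite power_neg_sexp. reflexivity. }
  exact (f_equal (fun g => contour_RInt g gamma) E).
Qed.
End OnContour.

(** An admissible contour has no vertical end: there [Re s^2 ~ - |s|^2] and the
    integrand, whose growth exponent [N] is negative, is at least [1] in modulus. *)
Lemma no_vertical_direction z thm thp gamma : admissible (integrand z) Lp Lm thm thp gamma -> cos thm <> 0 /\ cos thp <> 0.
Proof.
  intros [H Hfin].
  destruct (contour_ends _ _ _ _ _ H) as (cm & cp & T & HT & Ap & Am).
  destruct (grows_like_lower tau (/ 2) (integrand z) x Htau ltac:(lra) x_neg (integrand_grows z (/ 2) ltac:(lra))) as (R0 & HR0 & Hlow).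
  destruct (contour_far _ _ _ _ _ H (R0 + 8 * Cmod cm + 8 * Cmod cp)) as (T' & HT' & Far).
  assert (P1 := Cmod_ge_0 cm). assert (P2 := Cmod_ge_0 cp).
  assert (Adm := admissible_small Lp Lm thm thp gamma (integrand z) H (integrand_cont_contour thm thp gamma H z) Hfin).
  split; intros E.
  - apply (proj2 (Adm (- (T + T')))). intros t Ht.
    assert (F := Far t ltac:(rewrite Rabs_left1; lra)).
    destruct (ray_vertical cm thm (gamma t) E (Am t ltac:(lra)) ltac:(lra)). apply Hlow; auto; lra.
  - apply (proj1 (Adm (T + T'))). intros t Ht.
    assert (F := Far t ltac:(rewrite Rabs_pos_eq; lra)).
    destruct (ray_vertical cp thp (gamma t) E (Ap t ltac:(lra)) ltac:(lra)). apply Hlow; auto; lra.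
Qed.

(** Directions that move continuously without becoming vertical keep the sign of their
    cosine. *)
Lemma same_sector (c : R -> R) : (forall u, 0 <= u <= 1 -> continuous c u) -> (forall u, 0 <= u <= 1 -> cos (c u) <> 0) ->
  0 < cos (c 0) * cos (c 1).
Proof.
  intros Hc H0. apply Rnot_le_lt. intros N.
  destruct (IVT_unit_interval (fun u => cos (c u))) as (u & Hu & E); auto.
  - intros u Hu. apply (continuous_comp c cos). auto. apply continuous_cos.
  - apply (H0 u Hu E).
Qed.

Lemma is_contour_ext th th' g g' : (forall t, g t = g' t) -> is_contour Lp Lm th th' g -> is_contour Lp Lm th th' g'.
Proof. intros E H. now replace g' with g by (apply functional_extensionality; auto). Qed.

Lemma sign_transfer th th' iota sigma : is_sign iota -> is_sign sigma -> 0 < iota * sin th' -> 0 < cos (2 * th') ->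
  iota * sin th < sigma * cos th -> 0 < iota * sin th -> 0 < cos th * cos th' -> iota * sin th' < sigma * cos th'.
Proof.
  intros Hi Hs S' C' E S Hpos. destruct (good_direction th' iota Hi S' C') as (sg & Hsg & E').
  replace sigma with sg; auto. destruct Hs as [-> | ->], Hsg as [-> | ->]; auto; exfalso; nra.
Qed.

(** Of the homotopy only the directions matter: since no intermediate direction is
    vertical, the ends of the two contours lie in the same sectors, and the
    comparison of contours applies. *)
Lemma Kfun_same_class z thm thp gamma thm' thp' gamma' :
  is_contour Lp Lm thm thp gamma -> 0 < cos (2 * thm) -> 0 < cos (2 * thp) ->
  is_contour Lp Lm thm' thp' gamma' -> 0 < cos (2 * thm') -> 0 < cos (2 * thp') ->
  same_class (integrand z) Lp Lm gamma gamma' -> Kfun f gamma z = Kfun f gamma' z.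
Proof.
  intros H Cm Cp H' Cm' Cp' (Hu & am & ap & _ & Hang & Hadm & H0 & H1).
  (* the ends of the two contours lie in the same sectors *)
  assert (A0 : is_contour Lp Lm (am 0) (ap 0) gamma) by (eapply is_contour_ext; [exact H0|apply Hadm; lra]).
  assert (A1 : is_contour Lp Lm (am 1) (ap 1) gamma') by (eapply is_contour_ext; [exact H1|apply Hadm; lra]).
  destruct (contour_directions_unique _ _ _ _ _ _ _ H A0) as [E0m E0p].
  destruct (contour_directions_unique _ _ _ _ _ _ _ H' A1) as [E1m E1p].
  assert (Sm : 0 < cos thm * cos thm').
  { rewrite E0m, E1m. apply same_sector. intros u Hu0. apply (Hang u Hu0). intros u Hu0. apply (no_vertical_direction z _ _ _ (Hadm u Hu0)). }
  assert (Sp : 0 < cos thp * cos thp').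
  { rewrite E0p, E1p. apply same_sector. intros u Hu0. apply (Hang u Hu0). intros u Hu0. apply (no_vertical_direction z _ _ _ (Hadm u Hu0)). }
  assert (Tp : 0 < 1 * sin thp) by (rewrite Rmult_1_l; exact (sin_thp _ _ _ _ _ H)).
  assert (Tm := sin_thm _ _ _ _ _ H).
  assert (Tp' : 0 < 1 * sin thp') by (rewrite Rmult_1_l; exact (sin_thp _ _ _ _ _ H')).
  assert (Tm' := sin_thm _ _ _ _ _ H').
  destruct (good_direction thp 1 (or_introl eq_refl) Tp Cp) as (sp & Hsp & Ep).
  destruct (good_direction thm (-1) (or_intror eq_refl) Tm Cm) as (sm & Hsm & Em).
  assert (Ep' := sign_transfer thp thp' 1 sp (or_introl eq_refl) Hsp Tp' Cp' Ep Tp Sp).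
  assert (Em' := sign_transfer thm thm' (-1) sm (or_intror eq_refl) Hsm Tm' Cm' Em Tm Sm).
  destruct (contour_end_in_cone _ _ _ _ _ H sp sm Hsp Hsm Ep Em) as (k1 & Hk1 & K1).
  destruct (contour_end_in_cone _ _ _ _ _ H' sp sm Hsp Hsm Ep' Em') as (k2 & Hk2 & K2).
  set (k := Rmin k1 k2). assert (Hk : 0 < k) by now apply Rmin_pos.
  destruct (K1 k ltac:(split; [auto|apply Rmin_l])) as (Y1 & HY1 & U1 & D1).
  destruct (K2 k ltac:(split; [auto|apply Rmin_r])) as (Y2 & HY2 & U2 & D2).
  destruct (grows_like_decay tau k (integrand z) x (2 * k ^ 3) 1 Htau Hk x_neg) as (X & HX & Dec).
  { assert (0 < k ^ 3) by (apply pow_lt; auto). lra. } { now apply integrand_grows. }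
  destruct (poles_Im_bounded tau m n a b) as (B & HB).
  unfold Kfun. apply (f_equal (Cmult (/ (2 * RtoC PI * Ci)))).
  assert (Dec' : forall sg io, is_sign sg -> is_sign io -> forall s, in_cone k sg io s -> X <= Cmod s -> Cmod (integrand z s) <= exp (- Cmod s)).
  { intros sg io Hsg Hio s Hc Hs. replace (- Cmod s) with (- (1 * Cmod s)) by ring. apply Dec; auto.
    exact (in_cone_Im k sg io s Hio Hc). exact (in_cone_Re_sq k sg io s Hsg Hio Hk Hc). }
  apply (contour_integrals_agree Lp Lm thm thp thm' thp' gamma gamma' (integrand z) B H H' (hol_integrand z) HB
     (poles_locally_finite tau m n a b Htau) k k sp sm X (Y1 + Y2) Hk Hk).
  - intros t Ht. split. apply U1; lra. apply U2; lra.
  - intros t Ht. split. apply D1; lra. apply D2; lra.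
  - apply Dec'; auto. now left.
  - apply Dec'; auto. now right.
  - now apply (integrand_ex thm thp).
  - now apply (integrand_ex thm' thp').
Qed.
End Integrand.

Theorem theorem4p1
  (p q m n : nat) (a b : list C) (alpha : C) (tau : R)
  (Hm : (m <= q)%nat) (Hn : (n <= p)%nat)
  (Ha : length a = p) (Hb : length b = q)
  (Htau : 0 < tau)
  (HN : (index_N p q m n < 0)%Z)
  (Hlambda : Rbar_lt (lambda_sharp tau m b) (lambda_flat n a))
  (eps : R) (Heps : 0 < eps)
  (thm thp : R) (gamma : R -> C)
  (Hgamma : is_contour (Lambda_plus tau n a) (Lambda_minus tau m b) thm thp gamma)
  (Hthm : good_angle eps thm) (Hthp : good_angle eps thp) :
  let f := phi tau m n a b alpha in
  let absN := IZR (Z.abs (index_N p q m n)) in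
  (forall z : log_surface,
     exists o : R -> R, is_lim o p_infty 0 /\
       Rbar_locally p_infty (fun r => forall t theta : R,
         gamma t = polar r theta ->
         Cmod (f (gamma t) * power_neg z (gamma t))%C
         <= exp (- (absN / (2 * tau) * cos (2 * theta) * r ^ 2 * ln r
                    * (1 + o r))))) /\
  (forall z : log_surface,
     contour_abs_finite (fun s => (f s * power_neg z s)%C) gamma /\
     contour_ex_RInt (fun s => (f s * power_neg z s)%C) gamma) /\
  (forall (z : log_surface) (thm' thp' : R) (gamma' : R -> C),
     is_contour (Lambda_plus tau n a) (Lambda_minus tau m b) thm' thp' gamma' ->
     good_angle eps thm' -> good_angle eps thp' ->
     same_class (fun s => (f s * power_neg z s)%C)
       (Lambda_plus tau n a) (Lambda_minus tau m b) gamma gamma' ->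
     Kfun f gamma z = Kfun f gamma' z) /\
  (exists F : C -> C, entire F /\
     forall w : C, F w = Kfun f gamma (sexp (RtoC (2 * PI) * w)%C)).
Proof.
  intros f absN. destruct Hthm as [Cm _], Hthp as [Cp _].
  assert (EN : absN = - IZR (index_N p q m n)).
  { unfold absN. rewrite Z.abs_neq by lia. apply opp_IZR. }
  split; [|split; [|split]].
  - intros z. rewrite EN. exact (integrand_bound p q m n a b alpha tau Hm Hn Ha Hb Htau HN thm thp gamma Hgamma Cp Cm z).
  - intros z. split.
    + exact (integrand_abs p q m n a b alpha tau Hm Hn Ha Hb Htau HN thm thp gamma Hgamma Cp Cm z).
    + exact (integrand_ex p q m n a b alpha tau Hm Hn Ha Hb Htau HN thm thp gamma Hgamma Cp Cm z).
  - intros z thm' thp' gamma' H' [Cm' _] [Cp' _] Hs.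
    exact (Kfun_same_class p q m n a b alpha tau Hm Hn Ha Hb Htau HN z thm thp gamma thm' thp' gamma' Hgamma Cm Cp H' Cm' Cp' Hs).
  - eexists. split; [|intros w; reflexivity].
    exact (Kfun_entire p q m n a b alpha tau Hm Hn Ha Hb Htau HN thm thp gamma Hgamma Cp Cm).
Qed.
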